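(* Let $\mathcal T=\{T_s\}_{s\ge 0}$ be a semigroup of Dunford-Schwartz operators that is strongly continuous in $\mathcal L^1$. Given $1\le p<\infty$ and $f\in\mathcal L^p$, there exists $\widehat f\in\mathcal L^p$ such that the averages $M_t(\mathcal T)(f)=\frac1t\int_0^tT_s(f)\,ds$ converge almost uniformly to $\widehat f$ as $t\to\infty$.
   Context: Let $(\Omega,\mathcal A,\mu)$ be a $\sigma$-finite measure space with $\mu(\Omega)=\infty$. $\mathcal L^0$ is the algebra of equivalence classes of a.e. finite complex-valued measurable functions on $\Omega$, and $\mathcal L^p=\mathcal L^p(\Omega,\mu)\subset\mathcal L^0$ ($1\le p\le\infty$) is the usual space with norm $\|\cdot\|_p$. A Dunford-Schwartz operator ($T\in DS$) is a linear operator $T:\mathcal L^1\to\mathcal L^1$ with $\|T(f)\|_1\le\|f\|_1$ for all $f\in\mathcal L^1$ and $\|T(f)\|_\infty\le\|f\|_\infty$ for all $f\in\mathcal L^1\cap\mathcal L^\infty$. Such $T$ is identified with its unique linear extension to $\mathcal L^1+\mathcal L^\infty$ that contracts $\mathcal L^\infty$ and whose restriction to $\mathcal L^\infty$ is $\sigma(\mathcal L^\infty,\mathcal L^1)$-continuous; the extension also contracts every $\mathcal L^p$, $1<p<\infty$. A semigroup $\{T_s\}_{s\ge0}\subset DS$ satisfies $T_0=I$ and $T_{r+s}=T_rT_s$ for $r,s\ge0$. It is strongly continuous in $\mathcal L^1$ if $\|T_s(f)-T_{s_0}(f)\|_1\to0$ whenever $s\to s_0$, for all $f\in\mathcal L^1$.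 For $f\in\mathcal L^p$, $1\le p<\infty$, the integral $\int_0^tT_s(f)\,ds$ is a Bochner integral in $\mathcal L^p$. A net $\{f_\alpha\}\subset\mathcal L^0$ converges almost uniformly (a.u.) to $f\in\mathcal L^0$ if for every $\varepsilon>0$ there is a measurable set $G\subset\Omega$ with $\mu(\Omega\setminus G)\le\varepsilon$ and $\|(f-f_\alpha)\chi_G\|_\infty\to0$. *)

(* Defs.v *)
From HB Require Import structures.
From mathcomp Require Import all_boot all_order all_algebra.
From mathcomp Require Import all_classical all_reals all_analysis.
From mathcomp Require Import measurable_realfun complex.

Set Implicit Arguments.
Unset Strict Implicit.
Unset Printing Implicit Defensive.

Import Order.TTheory GRing.Theory Num.Theory.
Import numFieldNormedType.Exports.
Import ComplexField.Normc.

Local Open Scope classical_set_scope.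
Local Open Scope ring_scope.
Local Open Scope complex_scope.
Local Open Scope quotient_scope.

Local Notation Re := complex.Re.
Local Notation Im := complex.Im.

(* The Borel sigma-algebra of R[i], i.e. that of the product R * R. *)
Section complex_measurable.
Variable R : realType.

Definition ReIm (z : R[i]) : R * R := (Re z, Im z).

HB.instance Definition _ := isPointed.Build R[i] 0.

Definition complex_measurable : set (set R[i]) :=
  preimage_set_system setT ReIm measurable.

Let sigma_algebra_complex : sigma_algebra setT complex_measurable.
Proof. exact/sigma_algebra_preimage/sigma_algebra_measurable. Qed.

Let complex_measurable0 : complex_measurable set0.
Proof. by case: sigma_algebra_complex. Qed.

Let complex_measurableC A : complex_measurable A -> complex_measurable (~` A).
Proof.
by case: sigma_algebra_complex => _ + _ => /[apply]; rewrite setTD.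
Qed.

Let complex_measurable_bigcup (F : (set R[i])^nat) :
  (forall i, complex_measurable (F i)) -> complex_measurable (\bigcup_i F i).
Proof. by case: sigma_algebra_complex => _ _; exact. Qed.

Fact complex_display : measure_display. Proof. exact. Qed.

HB.instance Definition _ := @isMeasurable.Build complex_display R[i]
  complex_measurable complex_measurable0 complex_measurableC
  complex_measurable_bigcup.

Lemma measurable_fun_complexP d (T : measurableType d) (f : T -> R[i]) :
  measurable_fun setT f <->
  measurable_fun setT (fun x => Re (f x)) /\
  measurable_fun setT (fun x => Im (f x)).
Proof.
rewrite -(@measurable_fun_pairP _ _ _ _ _ _ (ReIm \o f)); split=> mf _ A mA.
- rewrite comp_preimage; apply: mf => //.
  by exists A => //; rewrite setTI.
- case: mA => B mB <-; rewrite [X in _ (_ `&` X)]preimage_setI preimage_setT.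
  by rewrite setTI -comp_preimage; exact: mf.
Qed.

End complex_measurable.

Section L0.
Context d (Omega : measurableType d) (R : realType).
Variable mu : {measure set Omega -> \bar R}.

Definition L0 : Type := {mfun_ mu, Omega >-> R[i]}.
HB.instance Definition _ := Choice.on L0.
HB.instance Definition _ := EqQuotient.on L0.

Definition L0_fun (f : L0) : Omega -> R[i] := aqEqMfun_to_fun f.
Coercion L0_fun : L0 >-> Funclass.

Definition L0_class (f : Omega -> R[i]) (mf : measurable_fun setT f) : L0 :=
  \pi_L0 (mfun_Sub (mem_set mf)).

Lemma L0_classE f (mf : measurable_fun setT f) : L0_class mf = f %[ae mu].
Proof.
apply/asboolP.
rewrite -/(ae_eq_op mu (repr (L0_class mf)) (mfun_Sub (mem_set mf))).
by rewrite -eqmodE reprK.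
Qed.

Lemma L0_measurable (f : L0) : measurable_fun setT f.
Proof. exact: measurable_funPT. Qed.

Lemma L0P (f g : L0) : f = g <-> f = g %[ae mu].
Proof.
split=> [->|fg]; first exact: ae_eq_refl.
by rewrite -[f]reprK -[g]reprK; apply/eqP; rewrite eqmodE; apply/asboolP.
Qed.

Lemma measurable_complexD (f g : Omega -> R[i]) :
  measurable_fun setT f -> measurable_fun setT g ->
  measurable_fun setT (fun x => f x + g x).
Proof.
move=> /measurable_fun_complexP[mf1 mf2] /measurable_fun_complexP[mg1 mg2].
apply/measurable_fun_complexP; split.
- rewrite (_ : (fun _ => _) = (fun x => Re (f x) + Re (g x))).
    exact: measurable_funD.
  by apply/funext => x; case: (f x) (g x) => ? ? [].
- rewrite (_ : (fun _ => _) = (fun x => Im (f x) + Im (g x))).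
    exact: measurable_funD.
  by apply/funext => x; case: (f x) (g x) => ? ? [].
Qed.

Lemma measurable_complexM (f g : Omega -> R[i]) :
  measurable_fun setT f -> measurable_fun setT g ->
  measurable_fun setT (fun x => f x * g x).
Proof.
move=> /measurable_fun_complexP[mf1 mf2] /measurable_fun_complexP[mg1 mg2].
apply/measurable_fun_complexP; split.
- rewrite (_ : (fun _ => _) =
    (fun x => Re (f x) * Re (g x) - Im (f x) * Im (g x))).
    by apply: measurable_funB; exact: measurable_funM.
  by apply/funext => x; case: (f x) (g x) => ? ? [].
- rewrite (_ : (fun _ => _) =
    (fun x => Re (f x) * Im (g x) + Im (f x) * Re (g x))).
    by apply: measurable_funD; exact: measurable_funM.
  by apply/funext => x; case: (f x) (g x) => ? ? [].
Qed.

Definition L0_zero : L0 := L0_class (@measurable_cst _ _ Omega R[i] setT 0).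
Definition L0_add (f g : L0) : L0 :=
  L0_class (measurable_complexD (L0_measurable f) (L0_measurable g)).
Definition L0_scale (a : R[i]) (f : L0) : L0 :=
  L0_class (measurable_complexM (@measurable_cst _ _ Omega R[i] setT a)
                                (L0_measurable f)).
Definition L0_opp (f : L0) : L0 := L0_scale (- 1) f.

Let addE f g : L0_add f g = (fun x => f x + g x) %[ae mu].
Proof. exact: L0_classE. Qed.
Let scaleE a f : L0_scale a f = (fun x => a * f x) %[ae mu].
Proof. exact: L0_classE. Qed.
Let zeroE : L0_zero = (fun=> 0) %[ae mu].
Proof. exact: L0_classE. Qed.

Let aeI (P Q : Omega -> Prop) : (\forall x \ae mu, P x) ->
  (\forall x \ae mu, Q x) -> \forall x \ae mu, P x /\ Q x.
Proof. exact: filterI. Qed.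

Let L0_addA : associative L0_add.
Proof.
move=> f g h; apply/L0P.
have e12 := aeI (addE f (L0_add g h)) (addE g h).
have e34 := aeI (addE (L0_add f g) h) (addE f g).
apply: filterS2 e34 e12 => x [e3 e4] [e1 e2] _.
by rewrite e1// e2// e3// e4// addrA.
Qed.

Let L0_addC : commutative L0_add.
Proof.
move=> f g; apply/L0P; move: (addE f g) (addE g f).
by apply: filterS2 => x e1 e2 _; rewrite e1// e2// addrC.
Qed.

Let L0_add0 : left_id L0_zero L0_add.
Proof.
move=> f; apply/L0P; move: (addE L0_zero f) zeroE.
by apply: filterS2 => x e1 e2 _; rewrite e1// e2// add0r.
Qed.

Let L0_addN : left_inverse L0_zero L0_opp L0_add.
Proof.
move=> f; apply/L0P; move: (addE (L0_opp f) f) (scaleE (- 1) f) zeroE.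
by apply: filterS3 => x e1 e2 e3 _; rewrite e1// e2// e3// mulN1r addNr.
Qed.

HB.instance Definition _ :=
  GRing.isZmodule.Build L0 L0_addA L0_addC L0_add0 L0_addN.

Let L0_scaleA a b f : L0_scale a (L0_scale b f) = L0_scale (a * b) f.
Proof.
apply/L0P; move: (scaleE a (L0_scale b f)) (scaleE b f) (scaleE (a * b) f).
by apply: filterS3 => x e1 e2 e3 _; rewrite e1// e2// e3// mulrA.
Qed.

Let L0_scale1 : left_id 1 L0_scale.
Proof.
move=> f; apply/L0P; move: (scaleE 1 f).
by apply: filterS => x e1 _; rewrite e1// mul1r.
Qed.

Let L0_scaleDr : right_distributive L0_scale +%R.
Proof.
move=> a f g; apply/L0P.
have e12 := aeI (scaleE a (f + g)) (addE f g).
have e45 := aeI (scaleE a f) (scaleE a g).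
have e3 := addE (L0_scale a f) (L0_scale a g).
apply: filterS3 e3 e45 e12 => x {}e3 [e4 e5] [e1 e2] _.
by rewrite e1// e2// e3// e4// e5// mulrDr.
Qed.

Let L0_scaleDl f : {morph L0_scale^~ f : a b / a + b}.
Proof.
move=> a b; apply/L0P.
have e14 := aeI (scaleE (a + b) f) (addE (L0_scale a f) (L0_scale b f)).
have e23 := aeI (scaleE a f) (scaleE b f).
apply: filterS2 e23 e14 => x [e2 e3] [e1 e4] _.
by rewrite e1// e4// e2// e3// mulrDl.
Qed.

HB.instance Definition _ := GRing.Zmodule_isLmodule.Build R[i] L0
  L0_scaleA L0_scale1 L0_scaleDr L0_scaleDl.

Lemma L0_0E : (0 : L0) = (fun=> 0) %[ae mu].
Proof. exact: zeroE. Qed.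

Lemma L0_DE (f g : L0) : (f + g : L0) = (fun x => f x + g x) %[ae mu].
Proof. exact: addE. Qed.

Lemma L0_ZE (a : R[i]) (f : L0) : (a *: f : L0) = (fun x => a * f x) %[ae mu].
Proof. exact: scaleE. Qed.

End L0.

Section Lp.
Context d (Omega : measurableType d) (R : realType).
Variable mu : {measure set Omega -> \bar R}.
Local Notation L0 := (L0 mu).

Definition Lp_norm (p : \bar R) (f : L0) : \bar R :=
  ('N[mu]_p[(fun x => (normc (f x))%:E)])%E.

Definition Lp (p : \bar R) : set L0 := [set f | (Lp_norm p f < +oo)%E].

Definition L1_plus_Loo : set L0 :=
  [set f | exists g h, [/\ Lp 1 g, Lp +oo%E h & f = g + h]].

Definition complex_integral (f : Omega -> R[i]) : R[i] :=
  Rintegral mu setT (fun x => Re (f x)) +i*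
  Rintegral mu setT (fun x => Im (f x)).

(* Only meaningful when f * g is integrable, e.g. for f in Loo, g in L1. *)
Definition pairing (f g : L0) : R[i] := complex_integral (fun x => f x * g x).

Definition L1_pairing (f : L0) :
    {ptws {g : L0 | Lp 1 g} -> (R[i] : numFieldType)^o} :=
  fun g => pairing f (sval g).

(* The subspace topology this induces on Loo is sigma(Loo, L1); off Loo it has
   no meaning. *)
Definition weak_star : topologicalType := initial_topology L1_pairing.

(* Operators with domain a subspace D of L0 are represented by total maps whose
   values outside D are irrelevant. *)
Definition linear_on (D : set L0) (T : L0 -> L0) : Prop :=
  forall (a : R[i]) f g, D f -> D g -> T (a *: f + g) = a *: T f + T g.

Definition dunford_schwartz (T : L0 -> L0) : Prop :=
  [/\ linear_on (Lp 1) T,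
      forall f, Lp 1 f -> (Lp_norm 1 (T f) <= Lp_norm 1 f)%E &
      forall f, Lp 1 f -> Lp +oo%E f ->
        (Lp_norm +oo (T f) <= Lp_norm +oo f)%E].

(* TE is the extension of T to L1 + Loo. *)
Definition dunford_schwartz_extension (T TE : L0 -> L0) : Prop :=
  [/\ forall f, Lp 1 f -> TE f = T f,
      linear_on L1_plus_Loo TE,
      forall f, Lp +oo%E f -> (Lp_norm +oo (TE f) <= Lp_norm +oo f)%E &
      {within (Lp +oo%E : set weak_star),
        continuous (TE : weak_star -> weak_star)}].

Definition dunford_schwartz_semigroup (T : R -> L0 -> L0) : Prop :=
  [/\ forall s : R, 0 <= s -> dunford_schwartz (T s),
      forall f, Lp 1 f -> T 0 f = f &
      forall (r s : R) f, 0 <= r -> 0 <= s -> Lp 1 f -> T (r + s) f = T r (T s f)].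

Definition strongly_continuous_L1 (T : R -> L0 -> L0) : Prop :=
  forall f, Lp 1 f -> forall s0 : R, 0 <= s0 ->
    Lp_norm 1 (T s f - T s0 f) @[s --> within [set s | 0 <= s] (nbhs s0)]
      --> 0%E.

Definition cvg_au (I : Type) (F : set_system I) (u : I -> L0) (f : L0) : Prop :=
  forall eps : R, 0 < eps ->
    exists G : set Omega, [/\ measurable G, (mu (~` G) <= eps%:E)%E &
      ('N[mu]_+oo[(fun x => (normc ((f - u i : L0) x * (\1_G x)%:C))%:E)])%E
        @[i --> F] --> 0%E].

End Lp.

(* The Bochner integral over D, for the Lebesgue measure, of functions with
   values in the subspace {v | N v < +oo} seminormed by N. *)
Section Bochner.
Context (R : realType) (V : lmodType R[i]).
Variables (N : V -> \bar R) (D : set R).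

Record step_function := StepFunction {
  step_size : nat;
  step_set : 'I_step_size -> set R;
  step_val : 'I_step_size -> V;
  step_measurable : forall i, measurable (step_set i);
  step_finite_measure : forall i, (lebesgue_measure (step_set i) < +oo)%E;
  step_finite_norm : forall i, (N (step_val i) < +oo)%E }.

Definition step_fun (S : step_function) (r : R) : V :=
  \sum_(i < step_size S) (\1_(step_set i) r : R)%:C *: step_val i.

Definition step_integral (S : step_function) : V :=
  \sum_(i < step_size S)
    (fine (lebesgue_measure (D `&` step_set i)))%:C *: step_val i.

(* By the pointwise convergence, the integrand N (step_fun (S n) r - g r) is
   a.e. equal to a measurable function of r. *)
Definition is_bochner_integral (g : R -> V) (v : V) : Prop :=
  exists S : nat -> step_function,
    [/\ {ae lebesgue_measure, forall r, D r ->
          N (step_fun (S n) r - g r) @[n --> \oo] --> 0%E},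
        (\int[lebesgue_measure]_(r in D) N (step_fun (S n) r - g r))%E
          @[n --> \oo] --> 0%E &
        N (step_integral (S n) - v) @[n --> \oo] --> 0%E].

(* 0 by convention if g is not Bochner integrable. *)
Definition bochner_integral (g : R -> V) : V :=
  xget 0 [set v | is_bochner_integral g v].

End Bochner.

Definition ergodic_average d (Omega : measurableType d) (R : realType)
    (mu : {measure set Omega -> \bar R}) (p : \bar R)
    (T : R -> L0 mu -> L0 mu) (f : L0 mu) (t : R) : L0 mu :=
  (t^-1)%:C *: bochner_integral (@Lp_norm _ _ _ mu p) `[0, t] (fun s => T s f).

(* Main.v *)
(* The argument works with arbitrary, not necessarily positive, complex operators.

   Maximal inequality. For a Dunford-Schwartz operator S and f in L1, Chacon's
   filling scheme yields a set E with lambda * mu E <= |f|_1 outside which all the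
   Cesaro means of f are bounded by lambda. Applied to S = T_(2^-k) and to
   M_(2^-k) f, it controls M_t f for all t in 2^-k N; the limit inferior of the
   exceptional sets works for all dyadic t, hence for all t > 0 since t |-> M_t f
   is continuous in L1.

   Convergence. Let f be in L1 and bounded. The parallelogram law shows that M_t f
   is Cauchy in L2, for which S has to contract L2; this follows from
   int (|S f| - lambda)^+ <= int (|f| - lambda)^+, obtained by truncating f at
   height lambda, and so does the boundedness of S on Lp. As M_u (M_t f) - M_u f
   tends uniformly to 0 when u goes to infinity, the maximal inequality for
   M_t f - M_w f, which is small in L2, makes M_u f almost uniformly Cauchy. The
   maximal inequality extends this to f in L1 by density. For f in Lp, subtract
   from f a function bounded by delta so as to be left with one in L1: the
   averages of the former are bounded by delta. *)

From HB Require Import structures.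
Require Import Defs.
From mathcomp Require Import all_boot all_order all_algebra.
From mathcomp Require Import all_classical all_reals all_analysis.
From mathcomp Require Import measurable_realfun ess_sup_inf complex ring lra.

Set Implicit Arguments.
Unset Strict Implicit.
Unset Printing Implicit Defensive.

Import Order.TTheory GRing.Theory Num.Theory.
Import numFieldNormedType.Exports.
Local Open Scope classical_set_scope.
Local Open Scope ring_scope.

(** * Moduli and Lp norms *)

(** Hopf's maximal lemma needs positivity; the filling scheme needs only the two contraction bounds
    and a truncation for which moduli add up exactly. The same truncation replaces operator
    interpolation: x^2 is twice the integral of (x - lambda)^+ over lambda >= 0, and x^p is
    comparable to a dyadic sum of such terms. The parallelogram argument needs the exact constant 1
    in L2, hence a fine grid there; on Lp a constant depending on p is enough. The limit is never
    identified: no projection onto fixed vectors appears, the averages are shown to be Cauchy and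
    their limit is taken pointwise along the integers. The times are uncountable, so null sets
    cannot be united over them: every almost everywhere bound concerns one time, and only the
    exceptional set of positive measure is common to all times. The Bochner integral is a chosen
    value, meaningful once existence and uniqueness are known. Both follow from uniform continuity
    in time; averages are then reached through Riemann sums, which also show that the L1 and Lp
    averages of one function agree. *)

Section complex_modulus.
Import ComplexField.Normc.
Local Open Scope complex_scope.
Context (R : realType).
Implicit Types z : R[i].

Lemma normcE z : normc z = Num.sqrt (complex.Re z ^+ 2 + complex.Im z ^+ 2).
Proof. by case: z. Qed.

Lemma normc_ge0 z : 0 <= normc z.
Proof. by rewrite normcE sqrtr_ge0. Qed.

Lemma normcR (a : R) : normc a%:C = `|a|.
Proof. by rewrite normcE/= expr0n addr0 sqrtr_sqr. Qed.

Lemma normc_sqr z : normc z ^+ 2 = complex.Re z ^+ 2 + complex.Im z ^+ 2.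
Proof. by rewrite normcE sqr_sqrtr// addr_ge0// sqr_ge0. Qed.

Lemma normc_ge_Re z : `|complex.Re z| <= normc z.
Proof.
by rewrite normcE -sqrtr_sqr ler_wsqrtr// lerDl sqr_ge0.
Qed.

Lemma normc_ge_Im z : `|complex.Im z| <= normc z.
Proof.
by rewrite normcE -sqrtr_sqr ler_wsqrtr// lerDr sqr_ge0.
Qed.

Lemma normc_le_ReIm z : normc z <= `|complex.Re z| + `|complex.Im z|.
Proof.
rewrite -(@ler_pXn2r _ 2) ?nnegrE ?normc_ge0 ?addr_ge0//.
rewrite normc_sqr sqrrD !real_normK ?num_real//.
by rewrite -addrA lerD2l lerDr mulrn_wge0// mulr_ge0.
Qed.

Lemma normc_parallelogram z z' :
  normc (z + z') ^+ 2 + normc (z - z') ^+ 2 =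
  2 * normc z ^+ 2 + 2 * normc z' ^+ 2.
Proof. by rewrite !normc_sqr; case: z => a b; case: z' => a' b' /=; ring. Qed.

End complex_modulus.

Section modulus.
Import ComplexField.Normc.
Local Open Scope complex_scope.
Context d (Omega : measurableType d) (R : realType).
Variable mu : {measure set Omega -> \bar R}.
Local Notation L0 := (L0 mu).
Implicit Types f g : L0.

Definition modulus f : Omega -> R := fun x => normc (f x).

Lemma modulus_ge0 f x : 0 <= modulus f x.
Proof. exact: normc_ge0. Qed.

Lemma measurable_normc (f : Omega -> R[i]) :
  measurable_fun setT f -> measurable_fun setT (fun x => normc (f x)).
Proof.
move=> /measurable_fun_complexP[mR mI].
rewrite (_ : (fun x => _) = (fun x => (complex.Re (f x) ^+ 2 +
    complex.Im (f x) ^+ 2) `^ 2^-1)); last first.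
  by apply/funext => x; rewrite normcE -powR12_sqrt// addr_ge0// sqr_ge0.
apply: (measurableT_comp (measurable_powR _)).
by apply: measurable_funD; apply: measurable_funX.
Qed.

Lemma measurable_modulus f : measurable_fun setT (modulus f).
Proof. exact/measurable_normc/L0_measurable. Qed.

Lemma modulus_le_D f g : \forall x \ae mu, modulus (f + g) x <= modulus f x + modulus g x.
Proof.
move: (L0_DE f g); apply: filterS => x /(_ I) e.
by rewrite /modulus e le_normcD.
Qed.

Lemma modulusZ a f : \forall x \ae mu, modulus (a *: f) x = normc a * modulus f x.
Proof.
move: (L0_ZE a f); apply: filterS => x /(_ I) e.
by rewrite /modulus e normcM.
Qed.

Lemma modulus0 : \forall x \ae mu, modulus 0 x = 0.
Proof.
move: (L0_0E mu); apply: filterS => x /(_ I) e.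
by rewrite /modulus e normc0.
Qed.

Lemma L0_BE f g : (f - g : L0) = (fun x => f x - g x) %[ae mu].
Proof.
rewrite -scaleN1r; move: (L0_DE f (-1 *: g)) (L0_ZE (-1) g).
by apply: filterS2 => x e1 e2 _; rewrite e1// e2// mulN1r.
Qed.

Lemma modulusN f : \forall x \ae mu, modulus (- f) x = modulus f x.
Proof.
rewrite -scaleN1r; move: (modulusZ (-1) f); apply: filterS => x ->.
by rewrite normcN normc1 mul1r.
Qed.

Lemma modulus_le_B f g : \forall x \ae mu, modulus (f - g) x <= modulus f x + modulus g x.
Proof.
by move: (modulus_le_D f (- g)) (modulusN g); apply: filterS2 => x + <-.
Qed.

Lemma modulus_eq0 f : (\forall x \ae mu, modulus f x = 0) -> f = 0.
Proof.
move=> f0; apply/L0P; move: f0 (L0_0E mu).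
by apply: filterS2 => x /eq0_normc -> -> // _.
Qed.

(** The null exceptional set may depend on [f], so a bound valid for all times is asserted time by
    time. With [A = setT] this is a bound on the essential supremum. *)
Definition ae_le (A : set Omega) (c : R) f := \forall x \ae mu, A x -> modulus f x <= c.

Lemma ae_leD A c1 c2 f g : ae_le A c1 f -> ae_le A c2 g -> ae_le A (c1 + c2) (f + g).
Proof.
move=> h1 h2; move: (modulus_le_D f g); move: h1 h2.
apply: filterS3 => x h1 h2 h3 Ax.
by rewrite (le_trans h3)// lerD ?h1 ?h2.
Qed.

Lemma ae_leZ A c a f : ae_le A c f -> ae_le A (normc a * c) (a *: f).
Proof.
move: (modulusZ a f); apply: filterS2 => x -> h Ax.
by rewrite ler_wpM2l ?normc_ge0 ?h.
Qed.

Lemma ae_leN A c f : ae_le A c f -> ae_le A c (- f).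
Proof. by move: (modulusN f); apply: filterS2 => x ->. Qed.

Lemma ae_leB A c1 c2 f g : ae_le A c1 f -> ae_le A c2 g -> ae_le A (c1 + c2) (f - g).
Proof. by move=> h1 h2; apply: ae_leD => //; exact: ae_leN. Qed.

Lemma ae_le0 A c : 0 <= c -> ae_le A c 0.
Proof. by move=> c0; move: modulus0; apply: filterS => x ->. Qed.

Lemma ae_leW A B c c' f : B `<=` A -> c <= c' -> ae_le A c f -> ae_le B c' f.
Proof.
by move=> BA cc; apply: filterS => x h /BA /h /le_trans; exact.
Qed.

Lemma ae_le_sum A n (c : nat -> R) (F : nat -> L0) :
  (forall i, (i < n)%N -> ae_le A (c i) (F i)) ->
  ae_le A (\sum_(i < n) c i) (\sum_(i < n) F i).
Proof.
elim: n => [|n ih] h; first by rewrite !big_ord0; exact: ae_le0.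
rewrite !big_ord_recr/=; apply: ae_leD; last exact: h.
by apply: ih => i ni; apply: h; rewrite ltnS ltnW.
Qed.

End modulus.

Section nonneg_integral.
Context d (Omega : measurableType d) (R : realType).
Variable mu : {measure set Omega -> \bar R}.
Local Open Scope ereal_scope.

Lemma ae_le_integralr (f g : Omega -> R) : measurable_fun setT f ->
  measurable_fun setT g -> (forall x, (0 <= f x)%R) -> (forall x, (0 <= g x)%R) ->
  (\forall x \ae mu, (f x <= g x)%R) ->
  \int[mu]_x (f x)%:E <= \int[mu]_x (g x)%:E.
Proof.
move=> mf mg f0 g0 fg; apply: ae_ge0_le_integral => //.
- by move=> x _; rewrite lee_fin.
- exact/measurable_EFinP.
- by move=> x _; rewrite lee_fin.
- exact/measurable_EFinP.
- by move: fg; apply: filterS => x fgx _; rewrite lee_fin.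
Qed.

Lemma ae_le_integralD (f g h : Omega -> R) : measurable_fun setT f ->
  measurable_fun setT g -> measurable_fun setT h -> (forall x, (0 <= f x)%R) ->
  (forall x, (0 <= g x)%R) -> (forall x, (0 <= h x)%R) ->
  (\forall x \ae mu, (f x <= g x + h x)%R) ->
  \int[mu]_x (f x)%:E <= \int[mu]_x (g x)%:E + \int[mu]_x (h x)%:E.
Proof.
move=> mf mg mh f0 g0 h0 fgh; rewrite -ge0_integralD//; last 4 first.
- by move=> x _; rewrite lee_fin.
- exact/measurable_EFinP.
- by move=> x _; rewrite lee_fin.
- exact/measurable_EFinP.
apply: (@ae_le_integralr f (fun x => (g x + h x)%R)) => //.
- exact: measurable_funD.
- by move=> x; rewrite addr_ge0.
Qed.

Lemma markov_integral (f : Omega -> R) (a : R) : measurable_fun setT f ->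
  (forall x, (0 <= f x)%R) -> (0 <= a)%R ->
  a%:E * mu [set x | (a <= f x)%R] <= \int[mu]_x (f x)%:E.
Proof.
move=> mf f0 a0.
have mA : measurable [set x | (a <= f x)%R].
  by rewrite -[X in measurable X]setTI; exact: measurable_fun_le.
rewrite -integral_cst//= integral_mkcond.
apply: ge0_le_integral => //.
- by move=> x _; rewrite patchE; case: ifP => //; rewrite lee_fin.
- exact/(measurable_restrictT _ _).1.
- exact/measurable_EFinP.
- move=> x _; rewrite patchE; case: ifPn => //; last by rewrite lee_fin.
  by rewrite inE /= lee_fin.
Qed.

End nonneg_integral.

Section Lp_norm_theory.
Import ComplexField.Normc.
Context d (Omega : measurableType d) (R : realType).
Variable mu : {measure set Omega -> \bar R}.
Local Notation L0 := (L0 mu).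
Local Open Scope ereal_scope.
Implicit Types (f g : L0) (p c : R).

Lemma Lp_norm_ge0 (p : \bar R) f : 0 <= Lp_norm p f.
Proof. exact: Lnorm_ge0. Qed.

Lemma Lp_norm1E f : Lp_norm 1 f = \int[mu]_x (modulus f x)%:E.
Proof.
rewrite /Lp_norm Lnorm1; apply: eq_integral => x _.
by rewrite gee0_abs// lee_fin modulus_ge0.
Qed.

Lemma Lp_normE p f :
  Lp_norm p%:E f = (\int[mu]_x ((modulus f x) `^ p)%:E) `^ p^-1.
Proof.
rewrite /Lp_norm unlock; congr (_ `^ _); apply: eq_integral => x _.
by rewrite /= ger0_norm ?modulus_ge0.
Qed.

Lemma measurable_modulus_powR p f : measurable_fun setT (fun x => modulus f x `^ p)%R.
Proof.
by apply: (measurableT_comp (measurable_powR _)); exact: measurable_modulus.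
Qed.

(** Monotonicity of powers moves the root to the other side; most norm bounds below are proved in
    the integral form. *)
Lemma Lp_norm_leP p c f : (0 < p)%R -> (0 <= c)%R ->
  Lp_norm p%:E f <= c%:E <->
  \int[mu]_x ((modulus f x) `^ p)%:E <= (c `^ p)%:E.
Proof.
move=> p0 c0; rewrite Lp_normE.
have i0 : 0 <= \int[mu]_x ((modulus f x) `^ p)%:E.
  by apply: integral_ge0 => x _; rewrite lee_fin powR_ge0.
split=> h.
  rewrite -(poweRe1 i0) -(@mulVf _ p) ?gt_eqF// poweRrM -poweR_EFin.
  by apply: gt0_ler_poweR; rewrite ?(ltW p0)// in_itv/= ?poweR_ge0 ?leey ?lee_fin ?c0.
have -> : c%:E = ((c `^ p)%:E) `^ p^-1.
  by rewrite poweR_EFin -powRrM mulfV ?gt_eqF// powRr1.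
by apply: gt0_ler_poweR; rewrite ?invr_ge0 ?(ltW p0)// in_itv/= ?leey ?andbT// lee_fin powR_ge0.
Qed.

Lemma Lp_norm_eq0 (p : \bar R) f : 0 < p -> Lp_norm p f = 0 -> f = 0%R.
Proof.
move=> p0 /Lnorm_eq0_eq0 h; apply: modulus_eq0.
have /h /(_ p0) : measurable_fun setT (fun x => (normc (f x))%:E).
  exact/measurable_EFinP/measurable_modulus.
by apply: filterS => x /(_ I)[].
Qed.

Lemma le_Lp_norm p f (h : Omega -> R) : (0 < p)%R -> measurable_fun setT h ->
  (forall x, 0 <= h x)%R -> (\forall x \ae mu, (modulus f x <= h x)%R) ->
  Lp_norm p%:E f <= 'N[mu]_p%:E[EFin \o h].
Proof.
move=> p0 mh h0 fh; rewrite Lp_normE unlock.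
have e0 (k : Omega -> R) : 0 <= \int[mu]_x ((k x) `^ p)%:E.
  by apply: integral_ge0 => x _; rewrite lee_fin powR_ge0.
apply: gt0_ler_poweR; rewrite ?invr_ge0 ?(ltW p0)//=.
- by rewrite in_itv/= e0 leey.
- by rewrite in_itv/= leey andbT; apply: integral_ge0 => x _; rewrite lee_fin powR_ge0.
- under [leRHS]eq_integral do rewrite ger0_norm//.
  apply: ae_le_integralr => //.
  + exact: measurable_modulus_powR.
  + exact: (measurableT_comp (measurable_powR _)).
  + by move=> x; rewrite powR_ge0.
  + by move=> x; rewrite powR_ge0.
  + move: fh; apply: filterS => x fh.
    by apply: ge0_ler_powR; rewrite ?(ltW p0)// nnegrE ?modulus_ge0.
Qed.

Lemma Lp_norm_le_ae p f g : (0 < p)%R ->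
  (\forall x \ae mu, (modulus f x <= modulus g x)%R) ->
  Lp_norm p%:E f <= Lp_norm p%:E g.
Proof.
by move=> p0; apply: le_Lp_norm => //; [exact: measurable_modulus|
  move=> x; exact: modulus_ge0].
Qed.

Lemma Lp_normD p f g : (1 <= p)%R ->
  Lp_norm p%:E (f + g)%R <= Lp_norm p%:E f + Lp_norm p%:E g.
Proof.
move=> p1; have p0 : (0 < p)%R by apply: lt_le_trans p1.
have mD : measurable_fun setT (modulus f \+ modulus g)%R.
  by apply: measurable_funD; exact: measurable_modulus.
apply: le_trans; last by apply: minkowski_EFin => //; exact: measurable_modulus.
apply: le_Lp_norm => //; last exact: modulus_le_D.
by move=> x; rewrite addr_ge0 ?modulus_ge0.
Qed.

Lemma Lp_normZ p (a : R[i]) f : (0 < p)%R ->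
  Lp_norm p%:E (a *: f) = (normc a)%:E * Lp_norm p%:E f.
Proof.
move=> p0; rewrite !Lp_normE.
have i0 : 0 <= \int[mu]_x ((modulus f x) `^ p)%:E.
  by apply: integral_ge0 => x _; rewrite lee_fin powR_ge0.
transitivity ((\int[mu]_x (((normc a) `^ p)%:E * (modulus f x `^ p)%:E)) `^ p^-1).
  congr (_ `^ _); apply: ae_eq_integral => //.
  - exact/measurable_EFinP/measurable_modulus_powR.
  - by apply: emeasurable_funM => //; exact/measurable_EFinP/measurable_modulus_powR.
  - move: (modulusZ a f); apply: filterS => x -> _.
    by rewrite powRM ?modulus_ge0 ?normc_ge0.
rewrite ge0_integralZl//; last 3 first.
- exact/measurable_EFinP/measurable_modulus_powR.
- by move=> x _; rewrite lee_fin powR_ge0.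
- by rewrite lee_fin powR_ge0.
rewrite poweRM// ?lee_fin ?powR_ge0// poweR_EFin -powRrM mulfV ?gt_eqF//.
by rewrite powRr1 ?normc_ge0.
Qed.

Lemma Lp_norm0 p : (0 < p)%R -> Lp_norm p%:E (0%R : L0) = 0.
Proof.
by move=> p0; rewrite -(scale0r (0%R : L0)) Lp_normZ// normc0 mul0e.
Qed.

Lemma Lp_normN p f : (0 < p)%R -> Lp_norm p%:E (- f)%R = Lp_norm p%:E f.
Proof. by move=> p0; rewrite -scaleN1r Lp_normZ// normcN normc1 mul1e. Qed.

Lemma Lp_normB p f g : (0 < p)%R ->
  Lp_norm p%:E (f - g)%R = Lp_norm p%:E (g - f)%R.
Proof. by move=> p0; rewrite -[in LHS]opprB Lp_normN. Qed.

(** The norm of exponent [+oo] is 0 by convention on a null space; positivity of [mu setT] makes it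
    the essential supremum. *)
Lemma Lp_norm_ooP c f : 0 < mu setT ->
  Lp_norm +oo f <= c%:E <-> ae_le setT c f.
Proof.
move=> mu0; rewrite /Lp_norm unlock mu0; split.
  move=> /ess_supP; apply: filterS => x/=.
  by rewrite lee_fin ger0_norm ?normc_ge0.
move=> h; apply/ess_supP; move: h; apply: filterS => x /(_ I).
by rewrite /= lee_fin ger0_norm ?normc_ge0.
Qed.

Lemma markov_Lp p c a f : (0 < p)%R -> (0 <= c)%R -> (0 < a)%R ->
  Lp_norm p%:E f <= c%:E ->
  mu [set x | (a <= modulus f x)%R] <= ((c / a) `^ p)%:E.
Proof.
move=> p0 c0 a0 /Lp_norm_leP h.
have := @markov_integral _ _ _ mu _ (a `^ p)%R (measurable_modulus_powR p f)
  (fun x => powR_ge0 _ _) (powR_ge0 _ _).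
rewrite [X in mu X](_ : _ = [set x | (a <= modulus f x)%R]); last first.
  apply/seteqP; split => x /= ax.
    rewrite leNgt; apply/negP => xa.
    have := @gt0_ltr_powR _ p p0 (modulus f x) a.
    rewrite !nnegrE modulus_ge0 (ltW a0) => /(_ isT isT xa).
    by rewrite ltNge ax.
  by apply: ge0_ler_powR; rewrite ?(ltW p0)// nnegrE ?modulus_ge0// ltW.
move=> /le_trans /(_ (h p0 c0)).
have ap : (0 < a `^ p)%R by rewrite powR_gt0.
rewrite powRM ?invr_ge0 ?(ltW a0)// -powR_inv1 ?(ltW a0)// -powRrM mulN1r powRN.
by rewrite EFinM lee_pdivlMr// muleC.
Qed.

End Lp_norm_theory.

(** * Almost everywhere limits and completeness of Lp *)

Lemma half_exp_small (R : realType) (e : R) : 0 < e -> exists n, 2^-1 ^+ n <= e.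
Proof.
move=> e0; exists (Num.truncn e^-1).+1.
have lt2 (n : nat) : (n%:R : R) <= 2 ^+ n by rewrite -natrX ler_nat ltnW// ltn_expl.
rewrite exprVn -[leRHS]invrK lef_pV2 ?posrE ?exprn_gt0 ?invr_gt0//.
by apply: le_trans (lt2 _); apply/ltW/truncnS_gt.
Qed.

Lemma half_exp_le (R : realType) (m n : nat) : (m <= n)%N -> (2^-1 : R) ^+ n <= 2^-1 ^+ m.
Proof. by move=> mn; apply: ler_wiXn2l => //; lra. Qed.

Section ae_convergence.
Import ComplexField.Normc.
Local Open Scope complex_scope.
Context d (Omega : measurableType d) (R : realType).
Variable mu : {measure set Omega -> \bar R}.
Local Notation L0 := (L0 mu).
Implicit Types (u : nat -> L0) (v : L0) (p c : R).

(** Stated with [normc] and explicit ranks, so that topological limits are only taken of real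
    quantities. *)
Definition ae_cvg u v := \forall x \ae mu, forall e : R, 0 < e ->
  exists n, forall m, (n <= m)%N -> normc (u m x - v x) <= e.

(** Real and imaginary parts are set to 0 on a measurable null set containing the bad points. They
    then converge everywhere, and their pointwise limits are measurable. *)
Lemma ae_cauchy_cvg u :
  (\forall x \ae mu, forall e : R, 0 < e ->
    exists n, forall m, (n <= m)%N -> normc (u m x - u n x) <= e) ->
  exists v, ae_cvg u v.
Proof.
move=> [N [mN N0 subN]].
have good x : ~ N x -> forall e : R, 0 < e ->
    exists n, forall m, (n <= m)%N -> normc (u m x - u n x) <= e.
  by move=> Nx; apply: contrapT => h; apply: Nx; apply: subN.
pose part (F : R[i] -> R) n x := if x \in N then 0 else F (u n x).
have mpart (F : R[i] -> R) : (forall n, measurable_fun setT (fun x => F (u n x))) ->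
    forall n, measurable_fun setT (part F n).
  move=> mF n; apply: measurable_fun_ifT => //.
  apply: (measurable_fun_bool true); rewrite setTI (_ : _ @^-1` _ = N)//.
  by apply/seteqP; split => y /=; [move=> /set_mem|move=> /mem_set ->].
have limpart (F : R[i] -> R) : (forall z z', `|F z - F z'| <= normc (z - z')) ->
    forall x, part F ^~ x @ \oo --> lim (part F ^~ x @ \oo).
  move=> FF x; rewrite /part; have [xN|] := boolP (x \in N); first exact: is_cvg_cst.
  rewrite notin_setE => /good h.
  apply/cauchy_cvgP/cauchy_exP => e /= e0.
  have [|n hn] := h (e / 2); first by rewrite divr_gt0.
  exists (F (u n x)); exists n => // m /= nm; rewrite /ball/= distrC.
  apply: le_lt_trans (FF _ _) _; apply: le_lt_trans (hn _ nm) _.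
  by rewrite ltr_pdivrMr// mulr2n mulrDr mulr1 ltrDl.
pose limF (F : R[i] -> R) x := lim (part F ^~ x @ \oo).
have mlim (F : R[i] -> R) : (forall n, measurable_fun setT (fun x => F (u n x))) ->
    (forall z z', `|F z - F z'| <= normc (z - z')) ->
    measurable_fun setT (limF F).
  by move=> mF FF; apply: (measurable_fun_cvg (mpart _ mF)) => x _; exact: limpart.
have mRe n : measurable_fun setT (fun x => complex.Re (u n x)).
  by have /measurable_fun_complexP[] := L0_measurable (u n).
have mIm n : measurable_fun setT (fun x => complex.Im (u n x)).
  by have /measurable_fun_complexP[] := L0_measurable (u n).
have ReB (z z' : R[i]) : `|complex.Re z - complex.Re z'| <= normc (z - z').
  by case: z z' => a b [a' b']; exact: (normc_ge_Re ((a +i* b) - (a' +i* b'))).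
have ImB (z z' : R[i]) : `|complex.Im z - complex.Im z'| <= normc (z - z').
  by case: z z' => a b [a' b']; exact: (normc_ge_Im ((a +i* b) - (a' +i* b'))).
have mv : measurable_fun setT
    (fun x => limF (@complex.Re R) x +i* limF (@complex.Im R) x).
  by apply/measurable_fun_complexP; split; exact: mlim.
exists (L0_class mu mv).
have aeN : \forall x \ae mu, ~ N x.
  by exists N; split => // x /=; apply: contrapT.
move: aeN (L0_classE mu mv); apply: filterS2 => x Nx /(_ I) -> e e0.
have xN : (x \in N) = false by apply/negbTE; rewrite notin_setE.
have e20 : 0 < e / 2 by rewrite divr_gt0.
have /cvgrPdist_le/(_ _ e20)[n1 _ h1] := limpart _ ReB x.
have /cvgrPdist_le/(_ _ e20)[n2 _ h2] := limpart _ ImB x.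
have partE F k : part F k x = F (u k x) by rewrite /part xN.
exists (maxn n1 n2) => m; rewrite geq_max => /andP[nm1 nm2].
apply: le_trans (normc_le_ReIm _) _; rewrite (splitr e) lerD//.
  by move: (h1 m nm1); rewrite /= partE distrC; case: (u m x).
by move: (h2 m nm2); rewrite /= partE distrC; case: (u m x).
Qed.

Lemma ae_cvg_modulus u v : ae_cvg u v -> \forall x \ae mu,
  (fun n => modulus (u n) x) @ \oo --> modulus v x.
Proof.
apply: filterS => x h; apply/cvgrPdist_le => e /h[n hn].
exists n => // m /= /hn; apply: le_trans; rewrite /modulus ler_norml.
have h1 := le_normcD (u m x - v x) (v x); rewrite subrK in h1.
have h2 := le_normcD (v x - u m x) (u m x).
rewrite subrK -opprB normcN in h2.
by apply/andP; split; lra.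
Qed.

Lemma Lp_norm_fatou p c u v : 0 < p -> 0 <= c ->
  (forall n, (Lp_norm p%:E (u n) <= c%:E)%E) -> ae_cvg u v ->
  (Lp_norm p%:E v <= c%:E)%E.
Proof.
move=> p0 c0 uc uv; apply/Lp_norm_leP => //.
pose f n x := (modulus (u n) x `^ p)%:E.
have mf n : measurable_fun setT (f n).
  exact/measurable_EFinP/measurable_modulus_powR.
have f0 n x : setT x -> (0 <= f n x)%E by rewrite lee_fin powR_ge0.
apply: (@le_trans _ _ (\int[mu]_x limn_einf (f ^~ x))%E).
  have li0 x : (0 <= limn_einf (f ^~ x))%E.
    rewrite limn_einf_lim; apply: lime_ge; first exact: is_cvg_einfs.
    by apply: nearW => n; apply: le_ereal_inf_tmp => _ [m _ <-]; exact: f0.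
  apply: ae_ge0_le_integral => //.
  - by move=> x _; rewrite lee_fin powR_ge0.
  - exact/measurable_EFinP/measurable_modulus_powR.
  - rewrite (_ : (fun x => _) = (fun x => - limn_esup (fun n => - f n x))%E); last first.
      by apply/funext => x; rewrite [limn_esup _](limn_esupN (f ^~ x)) oppeK.
    apply: measurableT_comp => //; apply: measurable_fun_limn_esup => n.
    exact: measurableT_comp.
  - move/ae_cvg_modulus : uv; apply: filterS => x uvx _.
    (* Continuity of the power is used at positive points only; where [v] vanishes, the left side is
       0 and nonnegativity of the limit inferior suffices. *)
    have [vx0|vx0] := eqVneq (modulus v x) 0.
      by rewrite vx0 powR0 ?gt_eqF// li0.
    have vx : 0 < modulus v x by rewrite lt_neqAle eq_sym vx0 modulus_ge0.
    rewrite (_ : limn_einf _ = (modulus v x `^ p)%:E)//.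
    apply: (cvg_limn_einf_sup _).1; apply/fine_cvgP; split; first exact: nearW.
    have cp : {for modulus v x, continuous (fun t : R => t `^ p)}.
      apply/differentiable_continuous/derivable1_diffP.
      by apply: derivable_powR; rewrite in_itv/= vx.
    exact: (cvg_comp _ _ uvx cp).
apply: le_trans (fatou _ measurableT mf f0) _.
rewrite limn_einf_lim; apply: lime_le; first exact: is_cvg_einfs.
apply: nearW => n; apply: (@le_trans _ _ (\int[mu]_x f n x)%E).
  by apply: ereal_inf_lbound; exists n => /=.
by apply/Lp_norm_leP.
Qed.

(** Markov's inequality at height 2^-n bounds the measure of the bad set by (2^-(n+1))^p, at most
    2^-(n+1) because p >= 1. These bounds are summable and the Borel-Cantelli lemma concludes. *)
Lemma Lp_norm_fast p (w : nat -> L0) : 1 <= p ->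
  (forall n, (Lp_norm p%:E (w n) <= (2^-1 ^+ n * 2^-1 ^+ n.+1)%:E)%E) ->
  \forall x \ae mu, exists n0, forall n, (n0 <= n)%N -> modulus (w n) x <= 2^-1 ^+ n.
Proof.
move=> p1 hw; have p0 : 0 < p by apply: lt_le_trans p1.
pose F n := [set x | 2^-1 ^+ n <= modulus (w n) x].
have mF n : measurable (F n).
  rewrite -[X in measurable X]setTI; apply: measurable_fun_le => //.
  exact: measurable_modulus.
have half0 n : 0 < (2^-1 : R) ^+ n by rewrite exprn_gt0.
have muF n : (mu (F n) <= (1 / (2 ^ n.+1)%:R)%:E)%E.
  have c0 : 0 <= (2^-1 : R) ^+ n * 2^-1 ^+ n.+1 by rewrite mulr_ge0 ?ltW.
  apply: le_trans (markov_Lp p0 c0 (half0 n) (hw n)) _.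
  rewrite lee_fin mulrAC mulfV ?gt_eqF// !mul1r.
  apply: le_trans (ge1r_powR _ _) _ => //; last by rewrite natrX exprVn.
  by rewrite half0 exprn_ile1 ?invf_le1 ?ler1n.
have sumF : (\sum_(n <oo) mu (F n) < +oo)%E.
  apply: (@le_lt_trans _ _ (\sum_(n <oo) (1 / (2 ^ n.+1)%:R)%:E)%E).
    by apply: lee_nneseries.
  by apply: le_lt_trans (epsilon_trick0 _ _) _ => //; exact: ltry.
have := lim_sup_set_cvg0 mF sumF.
have mlF : measurable (lim_sup_set F).
  by apply: bigcap_measurable => // k _; exact: bigcup_measurable.
move=> /(negligibleP _ mlF); apply: negligibleS => x /= nx n _.
apply: contrapT => h; apply: nx; exists n => k nk.
rewrite leNgt; apply/negP => kx; apply: h; exists k => //.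
exact: ltW.
Qed.

End ae_convergence.

Section Lp_limits.
Import ComplexField.Normc.
Local Open Scope complex_scope.
Context d (Omega : measurableType d) (R : realType).
Variable mu : {measure set Omega -> \bar R}.
Local Notation L0 := (L0 mu).
Implicit Types (u : nat -> L0) (v w : L0) (p c : R).

Let eps n : R := 2^-1 ^+ n * 2^-1 ^+ n.+1.
Let eps_gt0 n : 0 < eps n. Proof. by rewrite mulr_gt0// exprn_gt0. Qed.

(** Approximants chosen with fast decreasing errors converge almost everywhere, so a pointwise bound
    survives a limit in norm. *)
Lemma ae_le_closed p (A : set Omega) c v : 1 <= p ->
  (forall e, 0 < e -> exists2 u : L0, (Lp_norm p%:E (u - v)%R <= e%:E)%E & ae_le A c u) ->
  ae_le A c v.
Proof.
move=> p1 h.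
have /choice[u hu] n : exists u : L0, (Lp_norm p%:E (u - v)%R <= (eps n)%:E)%E /\ ae_le A c u.
  by have [u] := h _ (eps_gt0 n); exists u.
have : \forall x \ae mu, forall n, modulus v x <= modulus (u n) x + modulus (u n - v) x.
  apply/ae_foralln => n; move: (modulus_le_B (u n) (u n - v)).
  by rewrite subKr.
have : \forall x \ae mu, forall n, A x -> modulus (u n) x <= c.
  by apply/ae_foralln => n; have [] := hu n.
move: (Lp_norm_fast p1 (fun n => (hu n).1)).
apply: filterS3 => x [n0 h1] h2 h3 Ax.
apply/ler_addgt0Pr => e /half_exp_small[n hn].
apply: le_trans (h3 (maxn n n0)) _; rewrite lerD ?h2//.
apply: le_trans (h1 _ (leq_maxr _ _)) _; apply: le_trans hn.
by apply: half_exp_le; exact: leq_maxl.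
Qed.

(** Limits of one sequence in two norms agree, since both are almost everywhere limits along fast
    approximants. With p different from q this identifies L1 and Lp averages; with p = q it proves
    identities through Riemann sums. *)
Lemma L0_eq_approx p q v w : 1 <= p -> 1 <= q ->
  (forall e, 0 < e -> exists u : L0, (Lp_norm p%:E (u - v)%R <= e%:E)%E /\
    (Lp_norm q%:E (u - w)%R <= e%:E)%E) -> v = w.
Proof.
move=> p1 q1 h; apply/eqP; rewrite -subr_eq0; apply/eqP/modulus_eq0.
have /choice[u hu] n : exists u : L0, (Lp_norm p%:E (u - v)%R <= (eps n)%:E)%E /\
    (Lp_norm q%:E (u - w)%R <= (eps n)%:E)%E by exact: h.
have : \forall x \ae mu, forall n,
    modulus (v - w) x <= modulus (u n - w) x + modulus (u n - v) x.
  apply/ae_foralln => n; move: (modulus_le_B (u n - w) (u n - v)).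
  by rewrite opprB addrC addrA subrK.
move: (Lp_norm_fast p1 (fun n => (hu n).1)) (Lp_norm_fast q1 (fun n => (hu n).2)).
apply: filterS3 => x [n1 h1] [n2 h2] h3.
apply/eqP; rewrite eq_le modulus_ge0 andbT; apply/ler_addgt0Pr => e e0; rewrite add0r.
have [|n hn] := @half_exp_small _ (e / 2); first by rewrite divr_gt0.
pose m := maxn n (maxn n1 n2).
apply: le_trans (h3 m) _; rewrite (splitr e).
by apply: lerD; [apply: le_trans (h2 m _) _|apply: le_trans (h1 m _) _];
  rewrite ?(le_trans _ hn) ?half_exp_le// /m ?leq_max ?leqnn ?orbT.
Qed.

Lemma Lp_complete p u : 1 <= p ->
  (forall e, 0 < e -> exists n, forall m, (n <= m)%N ->
    (Lp_norm p%:E (u m - u n)%R <= e%:E)%E) ->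
  exists v, forall e, 0 < e -> exists n, forall m, (n <= m)%N ->
    (Lp_norm p%:E (u m - v)%R <= e%:E)%E.
Proof.
move=> p1 h; have p0 : 0 < p by apply: lt_le_trans p1.
have trip (f g k : L0) : (Lp_norm p%:E (f - g)%R <= Lp_norm p%:E (f - k)%R + Lp_norm p%:E (g - k)%R)%E.
  by rewrite (Lp_normB g)//; apply: (le_trans _ (Lp_normD _ _ p1)); rewrite addrA subrK.
have /choice[k hk] j : exists n, forall m, (n <= m)%N ->
    (Lp_norm p%:E (u m - u n)%R <= (eps j / 2)%:E)%E.
  by apply: h; rewrite divr_gt0.
have trik j m m' : (k j <= m)%N -> (k j <= m')%N ->
    (Lp_norm p%:E (u m - u m')%R <= (eps j)%:E)%E.
  move=> jm jm'; apply: le_trans (trip (u m) (u m') (u (k j))) _.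
  by rewrite [in leRHS](splitr (eps j)) EFinD leeD// hk.
(* Summing the ranks is a cheap way to dominate every [k i] with i <= j. *)
pose K j := (\sum_(i < j.+1) k i)%N.
have kK i j : (i <= j)%N -> (k i <= K j)%N.
  by move=> ij; rewrite /K (bigD1 (Ordinal (ij : (i < j.+1)%N)))//= leq_addr.
have := Lp_norm_fast p1 (fun j => trik j (K j.+1) (K j) (kK _ _ (leqnSn _)) (kK _ _ (leqnn _))).
have : \forall x \ae mu, forall j, normc (u (K j.+1) x - u (K j) x) = modulus (u (K j.+1) - u (K j)) x.
  apply/ae_foralln => j; move: (L0_BE (u (K j.+1)) (u (K j))).
  by apply: filterS => x /(_ I) e; rewrite /modulus e.
move=> aeB aefast.
have [v hv] : exists v, ae_cvg (u \o K) v.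
  apply: ae_cauchy_cvg; move: aeB aefast; apply: filterS2 => x hB [n0 hn0] e e0.
  have [|n1 hn1] := @half_exp_small _ (e / 2); first by rewrite divr_gt0.
  pose n := maxn n0 n1; exists n => m /subnK <-.
  set i := (m - n)%N.
  (* The factor 2 - 2 * 2^-i is the partial sum of 2^-l for l < i, so the increments add up to at
     most 2 * 2^-n. *)
  suff : normc (u (K (i + n)%N) x - u (K n) x) <= (2 - 2 * 2^-1 ^+ i) * 2^-1 ^+ n.
    move/le_trans; apply; apply: (@le_trans _ _ (2 * 2^-1 ^+ n)).
      rewrite ler_wpM2r ?exprn_ge0// gerDl oppr_le0 mulr_ge0// exprn_ge0//.
    rewrite mulrC -ler_pdivlMr//; apply: le_trans hn1; apply: half_exp_le.
    exact: leq_maxr.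
  elim: i => [|i ih].
    by rewrite add0n subrr normc0 expr0 mulr1 subrr mul0r.
  have -> : u (K (i.+1 + n)%N) x - u (K n) x =
      (u (K (i + n).+1) x - u (K (i + n)%N) x) + (u (K (i + n)%N) x - u (K n) x).
    by rewrite addrA subrK addSn.
  apply: le_trans (le_normcD _ _) _.
  have h1 : normc (u (K (i + n).+1) x - u (K (i + n)%N) x) <= 2^-1 ^+ i * 2^-1 ^+ n.
    rewrite hB -exprD; apply: hn0; rewrite (leq_trans (leq_maxl n0 n1))//.
    exact: leq_addl.
  apply: le_trans (lerD h1 ih) _; rewrite -mulrDl ler_wpM2r ?exprn_ge0//.
  by rewrite exprS; lra.
exists v => e /half_exp_small[j hj]; exists (k j) => m jm.
apply: (@le_trans _ _ (eps j)%:E); last first.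
  rewrite lee_fin; apply: le_trans hj; rewrite /eps ler_piMr ?exprn_ge0//.
  by rewrite exprn_ile1 ?invf_le1 ?ler1n.
(* With [m] fixed, Fatou's lemma along the subsequence bounds [u m - v], which gives convergence of
   the whole sequence. The shift by [j] keeps the ranks above [k j]. *)
have cvgs : ae_cvg (fun i => u m - u (K (i + j)%N)) (u m - v).
  have : \forall x \ae mu, forall i, (u m - u (K (i + j)%N) : L0) x = u m x - u (K (i + j)%N) x.
    apply/ae_foralln => i; move: (L0_BE (u m) (u (K (i + j)%N))).
    by apply: filterS => x /(_ I).
  move: (L0_BE (u m) v) hv; apply: filterS3 => x /(_ I) e1 h1 e2 e' /h1[n hn].
  exists n => i ni; rewrite e1 e2.
  have -> : u m x - u (K (i + j)%N) x - (u m x - v x) = - (u (K (i + j)%N) x - v x).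
    by rewrite !opprB addrC addrA subrK.
  by rewrite normcN; apply: hn; rewrite (leq_trans ni)// leq_addr.
apply: Lp_norm_fatou cvgs => //; first exact: ltW.
by move=> i; apply: trik => //; apply: kK; exact: leq_addl.
Qed.

End Lp_limits.

(** * Filling scheme and discrete maximal inequality *)

Section truncation.
Import ComplexField.Normc.
Local Open Scope complex_scope.
Context d (Omega : measurableType d) (R : realType).
Variable mu : {measure set Omega -> \bar R}.
Local Notation L0 := (L0 mu).
Implicit Types (f g h : L0) (w : Omega -> R).

(** Multiplying [f] by min(1, w / |f|) keeps its phase, so that the moduli of the two pieces add up
    to that of [f]. The height [w] is a function because in the filling scheme the room left varies
    from point to point. *)
Lemma truncation f w : measurable_fun setT w -> (forall x, 0 <= w x) ->
  exists g h, [/\ f = g + h,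
    \forall x \ae mu, modulus g x = Num.min (modulus f x) (w x) &
    \forall x \ae mu, modulus h x = Num.max (modulus f x - w x) 0].
Proof.
move=> mw w0.
(* At a zero of [f] the quotient is 0 by convention, which is harmless since [a] only multiplies
   [f]. *)
pose a x := Num.min 1 (w x / modulus f x).
have ma : measurable_fun setT a.
  apply: measurable_minr => //; apply: measurable_funM => //.
  rewrite (_ : (fun x => _) = (fun x => modulus f x `^ (-1))); last first.
    by apply/funext => x; rewrite powR_inv1 ?modulus_ge0.
  by apply: (measurableT_comp (measurable_powR _)); exact: measurable_modulus.
have mg : measurable_fun setT (fun x => (a x)%:C * f x).
  apply: measurable_complexM; last exact: L0_measurable.
  by apply/measurable_fun_complexP; split.
have a0 x : 0 <= a x by rewrite le_min ler01 divr_ge0 ?modulus_ge0.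
have a1 x : a x <= 1 by rewrite ge_min lexx.
have am x : a x * modulus f x = Num.min (modulus f x) (w x).
  have [f0|f0] := eqVneq (modulus f x) 0; first by rewrite f0 mulr0 min_l.
  rewrite /a minr_pMl ?modulus_ge0// mul1r divfK//.
exists (L0_class mu mg), (f - L0_class mu mg); split.
- by rewrite addrC subrK.
- move: (L0_classE mu mg); apply: filterS => x /(_ I) e.
  by rewrite /modulus e normcM normcR ger0_norm// am.
- move: (L0_classE mu mg) (L0_BE f (L0_class mu mg)).
  apply: filterS2 => x /(_ I) e /(_ I) eB.
  have -> : modulus (f - L0_class mu mg) x = (1 - a x) * modulus f x.
    rewrite /modulus eB e -[X in X - _]mul1r -mulrBl normcM.
    rewrite (_ : 1 - (a x)%:C = (1 - a x)%:C); last by rewrite rmorphB.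
    by rewrite normcR ger0_norm// subr_ge0.
  rewrite mulrBl mul1r am; case: (leP (modulus f x) (w x)) => fw.
    by rewrite subrr max_r// subr_le0.
  by rewrite max_l// subr_ge0 ltW.
Qed.

End truncation.

Section measure_liminf.
Context d (Omega : measurableType d) (R : realType).
Variable mu : {measure set Omega -> \bar R}.
Local Open Scope ereal_scope.

(** The limit inferior keeps a common measure bound without any summability, because the tail
    intersections increase. A point outside it avoids infinitely many of the sets, which is all that
    is asked of an exceptional set for a family of times. *)
Definition liminf_set (F : (set Omega)^nat) := \bigcup_n \bigcap_(k >= n) F k.

Lemma measurable_liminf_set F : (forall k, measurable (F k)) ->
  measurable (liminf_set F).
Proof.
move=> mF; apply: bigcup_measurable => n _.
by apply: bigcap_measurableType => k _.
Qed.

Lemma measure_liminf_set_le F c : (forall k, measurable (F k)) ->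
  (forall k, mu (F k) <= c) -> mu (liminf_set F) <= c.
Proof.
move=> mF Fc; pose G n := \bigcap_(k >= n) F k.
have mG n : measurable (G n) by apply: bigcap_measurableType.
have := @nondecreasing_cvg_mu _ _ _ mu G mG.
have mUG : measurable (\bigcup_n G n) by exact: bigcup_measurable.
have ndG : nondecreasing_seq G.
  by move=> m n mn; apply/subsetPset => x Gx k /= nk; apply: Gx => /=; exact: leq_trans nk.
move=> /(_ mUG ndG) cG; rewrite /liminf_set -(cvg_lim _ cG)//.
apply: lime_le; first by apply/cvg_ex; eexists; exact: cG.
apply: nearW => n; apply: le_trans (Fc n); apply: le_measure; rewrite ?inE//.
by move=> x /(_ n); apply => /=.
Qed.

Lemma notin_liminf_set F x : ~ liminf_set F x -> forall n, exists2 k, (n <= k)%N & ~ F k x.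
Proof.
move=> h n; apply: contrapT => h2; apply: h; exists n => // k /= nk.
by apply: contrapT => Fk; apply: h2; exists k.
Qed.

End measure_liminf.

Section Lp_space.
Import ComplexField.Normc.
Local Open Scope complex_scope.
Context d (Omega : measurableType d) (R : realType).
Variable mu : {measure set Omega -> \bar R}.
Local Notation L0 := (L0 mu).
Implicit Types (f g : L0) (p c : R).

Lemma LpP (p : \bar R) f : Lp p f <-> exists2 c, 0 <= c & (Lp_norm p f <= c%:E)%E.
Proof.
split; last by move=> [c _ h]; apply: le_lt_trans h _; exact: ltry.
rewrite /Lp/= => h; exists (fine (Lp_norm p f)).
  by rewrite fine_ge0// Lp_norm_ge0.
by rewrite fineK// ge0_fin_numE// Lp_norm_ge0.
Qed.

Lemma LpW (p : \bar R) f c : (Lp_norm p f <= c%:E)%E -> Lp p f.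
Proof. by move=> h; apply: le_lt_trans h _; exact: ltry. Qed.

Lemma LpD p f g : 1 <= p -> Lp p%:E f -> Lp p%:E g -> Lp p%:E (f + g).
Proof.
by move=> p1 pf pg; apply: le_lt_trans (Lp_normD _ _ p1) _; exact: lte_add_pinfty.
Qed.

Lemma LpZ p a f : 0 < p -> Lp p%:E f -> Lp p%:E (a *: f).
Proof.
move=> p0 pf; rewrite /Lp/= Lp_normZ// lte_mul_pinfty// lee_fin; exact: normc_ge0.
Qed.

Lemma LpN p f : 0 < p -> Lp p%:E f -> Lp p%:E (- f).
Proof. by rewrite /Lp/= => p0; rewrite Lp_normN. Qed.

Lemma LpB p f g : 1 <= p -> Lp p%:E f -> Lp p%:E g -> Lp p%:E (f - g).
Proof.
move=> p1 pf pg; apply: LpD => //; apply: LpN => //.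
exact: lt_le_trans p1.
Qed.

Lemma Lp0 p : 0 < p -> Lp p%:E (0 : L0).
Proof. by move=> p0; rewrite /Lp/= Lp_norm0. Qed.

Lemma Lp_sum p n (F : nat -> L0) : 1 <= p ->
  (forall i, (i < n)%N -> Lp p%:E (F i)) -> Lp p%:E (\sum_(i < n) F i).
Proof.
move=> p1; elim: n => [|n ih] h.
  by rewrite big_ord0; apply: Lp0; exact: lt_le_trans p1.
rewrite big_ord_recr/=; apply: LpD => //; last exact: h.
by apply: ih => i ni; apply: h; rewrite ltnS ltnW.
Qed.

Lemma Lp_le_ae p f g : 0 < p ->
  (\forall x \ae mu, modulus f x <= modulus g x) -> Lp p%:E g -> Lp p%:E f.
Proof. by move=> p0 fg; apply: le_lt_trans; exact: Lp_norm_le_ae. Qed.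

Lemma Lp_norm_triangle p f g h : 1 <= p ->
  (Lp_norm p%:E (f - h)%R <= Lp_norm p%:E (f - g)%R + Lp_norm p%:E (g - h)%R)%E.
Proof.
by move=> p1; apply: (le_trans _ (Lp_normD _ _ p1)); rewrite addrA subrK.
Qed.

End Lp_space.

Section dunford_schwartz_theory.
Import ComplexField.Normc.
Local Open Scope complex_scope.
Context d (Omega : measurableType d) (R : realType).
Variable mu : {measure set Omega -> \bar R}.
Hypothesis mu_gt0 : (0 < mu setT)%E.
Local Notation L0 := (L0 mu).
Variable T : L0 -> L0.
Hypothesis dsT : dunford_schwartz T.
Implicit Types (f g : L0).

Lemma ds_norm1 f : Lp 1 f -> (Lp_norm 1 (T f) <= Lp_norm 1 f)%E.
Proof. by case: dsT => _ + _; exact. Qed.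

Lemma ds_L1 f : Lp 1 f -> Lp 1 (T f).
Proof. by move=> f1; apply: le_lt_trans (ds_norm1 f1) _. Qed.

Lemma ds_ae_le c f : Lp 1 f -> ae_le setT c f -> ae_le setT c (T f).
Proof.
move=> f1 /(Lp_norm_ooP _ _ mu_gt0) h; apply/(Lp_norm_ooP _ _ mu_gt0).
have foo : Lp +oo%E f by exact: LpW h.
by apply: le_trans h; case: dsT => _ _; exact.
Qed.

Lemma ds0 : T 0 = 0.
Proof.
case: dsT => lin _ _; have L10 : Lp 1 (0 : L0) by exact: Lp0.
have := lin 1 0 0 L10 L10; rewrite !scale1r addr0 => /eqP.
by rewrite -[X in X == _]addr0 (inj_eq (addrI _)) => /eqP <-.
Qed.

Lemma dsD f g : Lp 1 f -> Lp 1 g -> T (f + g) = T f + T g.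
Proof.
by move=> f1 g1; case: dsT => /(_ 1 f g f1 g1); rewrite !scale1r.
Qed.

Lemma dsZ a f : Lp 1 f -> T (a *: f) = a *: T f.
Proof.
move=> f1; case: dsT => /(_ a f 0 f1); rewrite ds0 !addr0 => -> //.
exact: Lp0.
Qed.

Lemma dsB f g : Lp 1 f -> Lp 1 g -> T (f - g) = T f - T g.
Proof.
move=> f1 g1; rewrite -scaleN1r dsD//; last exact: LpZ.
by rewrite dsZ// scaleN1r.
Qed.

Lemma ds_sum n (F : nat -> L0) : (forall i, (i < n)%N -> Lp 1 (F i)) ->
  T (\sum_(i < n) F i) = \sum_(i < n) T (F i).
Proof.
elim: n => [|n ih] h; first by rewrite !big_ord0 ds0.
rewrite !big_ord_recr/= dsD//; last 2 first.
- by apply: Lp_sum => // i ni; apply: h; rewrite ltnS ltnW.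
- exact: h.
by rewrite ih// => i ni; apply: h; rewrite ltnS ltnW.
Qed.

Lemma ds_iter_L1 k f : Lp 1 f -> Lp 1 (iter k T f).
Proof. by move=> f1; elim: k => // k ih; exact: ds_L1. Qed.

Section filling_scheme.
Variables (f : L0) (c lambda : R).
Hypothesis f1 : (Lp_norm 1 f <= c%:E)%E.
Hypothesis lambda_gt0 : 0 < lambda.

(* [s] is the part of the mass already settled, [t] its filling height (at most
   [lambda]), and [r] the surplus, carried only by full points. *)
Definition filling (X : L0 * (Omega -> R) * L0) := let: (s, t, r) := X in
  [/\ measurable_fun setT t, forall x, 0 <= t x,
      \forall x \ae mu, modulus s x <= t x /\ t x <= lambda,
      \forall x \ae mu, t x < lambda -> modulus r x = 0 &
      (\int[mu]_x (t x)%:E + Lp_norm 1 r <= c%:E)%E].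

Lemma filling_L1 s t r : filling (s, t, r) -> Lp 1 s /\ Lp 1 r.
Proof.
move=> [mt t0 st _ tr]; split.
  apply: (@LpW _ _ _ _ 1%E _ c); apply: le_trans tr.
  apply: (@le_trans _ _ (\int[mu]_x (t x)%:E)%E); last by rewrite leeDl// Lp_norm_ge0.
  rewrite Lp_norm1E; apply: ae_le_integralr => //; first exact: measurable_modulus.
    by move=> x; exact: modulus_ge0.
  by move: st; apply: filterS => x [].
apply: (@LpW _ _ _ _ 1%E _ c); apply: le_trans tr; rewrite leeDr//.
by apply: integral_ge0 => x _; rewrite lee_fin.
Qed.

(** [T r] is truncated at the room left under [lambda]: what fits is settled, and a surplus remains
    only where the room is exhausted. The height [t] adds the moduli of the settled pieces, whose
    phases may cancel in [s]; hence it is monotone, and total mass does not grow because [T]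
    contracts L1. *)
Lemma filling_step s t r : filling (s, t, r) -> exists s' t' r',
  [/\ filling (s', t', r'), T r = (s' - s) + r' & forall x, t x <= t' x].
Proof.
move=> ftr; have [mt t0 st tr int] := ftr; have [s1 r1] := filling_L1 ftr.
(* The height is at most [lambda] only almost everywhere; the maximum makes [w] nonnegative at every
   point. *)
pose w x := Num.max (lambda - t x) 0.
have mw : measurable_fun setT w.
  by apply: measurable_maxr => //; exact: measurable_funB.
have w0 x : 0 <= w x by rewrite le_max lexx orbT.
have [g [h [gh hg hh]]] := truncation (T r) mw w0.
have mg := measurable_modulus g.
exists (s + g), (fun x => t x + modulus g x), h; split; last 2 first.
- by rewrite [s + g]addrC addrK.
- by move=> x; rewrite lerDl modulus_ge0.
split.
- exact: measurable_funD.
- by move=> x; rewrite addr_ge0 ?modulus_ge0.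
- move: st (modulus_le_D s g) hg; apply: filterS3 => x [st tl] sg gm; split.
    by rewrite (le_trans sg)// lerD2r.
  rewrite gm -lerBrDl; apply: (@le_trans _ _ (w x)); first by rewrite ge_min lexx orbT.
  by rewrite /w max_l// subr_ge0.
- move: hg hh; apply: filterS2 => x gm hm; rewrite gm hm.
  have [tl|tl] := leP lambda (t x).
    move=> H; have : t x + 0 < lambda by apply: le_lt_trans H; rewrite lerD2l le_min modulus_ge0 w0.
    by rewrite addr0 ltNge tl.
  rewrite /w max_l; last by rewrite subr_ge0 ltW.
  case: (leP (modulus (T r) x) (lambda - t x)) => h1 h2.
    by apply/max_r; rewrite subr_le0.
  by move: h2; rewrite addrC subrK ltxx.
- under eq_integral do rewrite EFinD.
  rewrite ge0_integralD//; last 4 first.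
  + by move=> x _; rewrite lee_fin.
  + exact/measurable_EFinP.
  + by move=> x _; rewrite lee_fin modulus_ge0.
  + exact/measurable_EFinP.
  apply: le_trans int; rewrite -addeA leeD2l//.
  apply: le_trans (ds_norm1 r1); rewrite !Lp_norm1E -ge0_integralD//; last 4 first.
  + by move=> x _; rewrite lee_fin modulus_ge0.
  + exact/measurable_EFinP.
  + by move=> x _; rewrite lee_fin modulus_ge0.
  + exact/measurable_EFinP/measurable_modulus.
  apply: (@ae_le_integralr _ _ _ _ (fun x => modulus g x + modulus h x)).
  + by apply: measurable_funD => //; exact: measurable_modulus.
  + exact: measurable_modulus.
  + by move=> x; rewrite addr_ge0 ?modulus_ge0.
  + by move=> x; rewrite modulus_ge0.
  + move: hg hh; apply: filterS2 => x -> ->.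
    case: (leP (modulus (T r) x) (w x)) => h1.
      by rewrite max_r ?addr0// subr_le0.
    by rewrite max_l ?subr_ge0 ?(ltW h1)// addrC subrK.
Qed.

Lemma filling_init : exists s t r, filling (s, t, r) /\ f = s + r.
Proof.
have l0 := ltW lambda_gt0.
have [g [h [gh hg hh]]] := @truncation _ _ _ _ f (cst lambda)
  (measurable_cst _) (fun=> l0).
exists g, (fun x => Num.min (modulus f x) lambda), h; split => //.
have mt : measurable_fun setT (fun x => Num.min (modulus f x) lambda).
  by apply: measurable_minr => //; exact: measurable_modulus.
have t0 x : 0 <= Num.min (modulus f x) lambda by rewrite le_min modulus_ge0.
split => //.
- move: hg; apply: filterS => x ->; split=> //=.
  by rewrite ge_min lexx orbT.
- move: hh; apply: filterS => x ->; rewrite /cst gt_min ltxx orbF => fl.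
  by apply/max_r; rewrite subr_le0 ltW.
- apply: le_trans f1; rewrite !Lp_norm1E -ge0_integralD//; last 4 first.
  + by move=> x _; rewrite lee_fin.
  + exact/measurable_EFinP.
  + by move=> x _; rewrite lee_fin modulus_ge0.
  + exact/measurable_EFinP/measurable_modulus.
  apply: (@ae_le_integralr _ _ _ _ (fun x => Num.min (modulus f x) lambda + modulus h x)).
  + by apply: measurable_funD => //; exact: measurable_modulus.
  + exact: measurable_modulus.
  + by move=> x; rewrite addr_ge0 ?modulus_ge0.
  + by move=> x; rewrite modulus_ge0.
  + move: hh; apply: filterS => x -> /=.
    case: (leP (modulus f x) lambda) => h1.
      by rewrite max_r ?addr0// subr_le0.
    by rewrite max_l ?subr_ge0 ?(ltW h1)// addrC subrK.
Qed.

(* Chacon's filling scheme: spread the surplus of [f] over [lambda] by iterating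
   [T], absorbing at each step what fits under the height [lambda]. Then
   [sum_(k < n) T^k f = sum_(i < n) T^i s_(n-1-i) + sum_(k < n) r_k], where the
   first sum is at most [n * lambda] and the second lives on full points. *)
Lemma discrete_maximal_inequality :
  exists E, [/\ measurable E, (mu E <= (c / lambda)%:E)%E &
    forall n, ae_le (~` E) (n%:R * lambda) (\sum_(k < n) iter k T f)].
Proof.
have [s0 [t0 [r0 [fill0 fE]]]] := filling_init.
have /choice[next hnext] (X : L0 * (Omega -> R) * L0) : exists Y, filling X ->
    [/\ filling Y, T X.2 = (Y.1.1 - X.1.1) + Y.2 & forall x, X.1.2 x <= Y.1.2 x].
  case: (pselect (filling X)) => [|nX]; last by exists X.
  case: X => -[s t] r /filling_step[s' [t' [r' h]]].
  by exists (s', t', r').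
pose X k := iter k next (s0, t0, r0).
have fX k : filling (X k).
  by elim: k => // k ih; have [] := hnext _ ih.
pose s k := (X k).1.1; pose t k := (X k).1.2; pose r k := (X k).2.
have fill k : filling (s k, t k, r k).
  by move: (fX k); rewrite /s /t /r; case: (X k) => [[]].
have Tr k : T (r k) = (s k.+1 - s k) + r k.+1 by have [] := hnext _ (fX k).
have tS k x : t k x <= t k.+1 x by have [_ _ h] := hnext _ (fX k); exact: h.
have s1 k : Lp 1 (s k) by have [] := filling_L1 (fill k).
have r1 k : Lp 1 (r k) by have [] := filling_L1 (fill k).
have f1' : Lp 1 f by rewrite fE; apply: LpD; [exact: lexx|exact: (s1 0%N)|exact: (r1 0%N)].
pose B := fix B n := if n is m.+1 then s m + T (B m) else 0.
have B1 n : Lp 1 (B n).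
  by elim: n => [|n ih]; [exact: Lp0|apply: LpD => //; exact: ds_L1].
have SE n : \sum_(k < n) iter k T f = B n + \sum_(k < n) r k.
  elim: n => [|n ih]; first by rewrite !big_ord0 addr0.
  rewrite big_ord_recl /=.
  rewrite (_ : \sum_(i < n) _ = T (\sum_(k < n) iter k T f)); last first.
    by rewrite (@ds_sum _ (fun k => iter k T f))// => i _; exact: ds_iter_L1.
  rewrite ih dsD//; last exact: Lp_sum.
  (* Each [T (r k)] is [s k.+1 - s k] plus the next surplus, so the settled parts telescope to
     [s n - s 0], and [s 0] cancels against the decomposition of [f]. *)
  rewrite ds_sum//; under [X in _ + (_ + X)]eq_bigr do rewrite Tr.
  rewrite big_split/= -(big_mkord xpredT (fun k => s k.+1 - s k)) telescope_sumr//.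
  rewrite [in RHS]big_ord_recl/= fE.
  have zE (a b c' d' e : L0) : a + b + (c' + ((d' - a) + e)) = (d' + c') + (b + e).
    by rewrite addrACA [b + (_ + _)]addrCA addrA; congr (_ + _); rewrite addrC addrA subrK.
  exact: zE.
have Bn n : ae_le setT (n%:R * lambda) (B n).
  elim: n => [|n ih]; first by rewrite mul0r; exact: ae_le0.
  rewrite -[X in X%:R]addn1 natrD mulrDl mul1r addrC; apply: ae_leD; last exact: ds_ae_le.
  have [_ _ h _ _] := fill n; move: h; apply: filterS => x [h1 h2] _.
  exact: le_trans h2.
pose F k := [set x | lambda <= t k x].
have mt k : measurable_fun setT (t k) by have [] := fill k.
have mF k : measurable (F k).
  by rewrite -[X in measurable X]setTI; apply: measurable_fun_le.
(* Heights increase with [k], so this set is the increasing union of the [F k]: off it no point is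
   ever full, and every surplus vanishes. *)
exists (liminf_set F); split.
- exact: measurable_liminf_set.
- apply: measure_liminf_set_le => // k; have [_ t0k _ _ intk] := fill k.
  have := markov_integral mu (mt k) t0k (ltW lambda_gt0).
  rewrite EFinM lee_pdivlMr// muleC => /le_trans; apply.
  by apply: le_trans intk; rewrite leeDl// Lp_norm_ge0.
- move=> n; rewrite SE -[X in ae_le _ X]addr0; apply: ae_leD.
    by move: (Bn n); exact: ae_leW.
  have -> : (0 : R) = \sum_(k < n) 0 by rewrite big1_eq.
  apply: (@ae_le_sum _ _ _ _ _ n (fun=> 0)) => k _; have [_ _ _ h _] := fill k.
  move: h; apply: filterS => x h nx; rewrite h//.
  rewrite ltNge; apply/negP => lt; apply: nx; exists k => // m /= km.
  rewrite /F /=; apply: le_trans lt _; move/subnK : km => <-.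
  by elim: (m - k)%N => // i ih; apply: le_trans ih (tS _ _).
Qed.

End filling_scheme.
End dunford_schwartz_theory.

(** * Bochner integrals of uniformly continuous functions *)

Section nonmeasurable_integral.
Local Open Scope ereal_scope.
Context d (T : measurableType d) (R : realType).
Variable mu : {measure set T -> \bar R}.

(* [integral] is defined for all functions, as a supremum over the simple
   functions below when the integrand is nonnegative. *)
Lemma ge0_le_lower_integral (D : set T) (f g : T -> \bar R) :
  (forall x, D x -> 0 <= f x) -> (forall x, D x -> f x <= g x) ->
  \int[mu]_(x in D) f x <= \int[mu]_(x in D) g x.
Proof.
move=> f0 fg.
have g0 x : D x -> 0 <= g x by move=> Dx; exact: le_trans (f0 _ Dx) (fg _ Dx).
rewrite ge0_integralE// ge0_integralE//.
apply: ereal_sup_le => _ [h hf <-]; exists h => // x.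
by apply: le_trans (hf x) _; exact: lee_restrict.
Qed.

(** As [g] need not be measurable, its integral is not additive. The measurable function (f - e)^+
    lies below [g] and carries the additivity instead. *)
Lemma lower_integral_le_addr (D : set T) (f g : T -> \bar R) (e : R) :
  measurable D -> measurable_fun D f -> (0 <= e)%R ->
  (forall x, D x -> 0 <= g x) -> (forall x, D x -> f x <= g x + e%:E) ->
  (forall x, D x -> 0 <= f x) ->
  \int[mu]_(x in D) f x <= \int[mu]_(x in D) g x + e%:E * mu D.
Proof.
move=> mD mf e0 g0 fg f0.
pose h x := maxe (f x - e%:E) 0.
have mh : measurable_fun D h.
  apply: measurable_maxe => //; exact: emeasurable_funB.
have h0 x : 0 <= h x by rewrite le_max lexx orbT.
apply: (@le_trans _ _ (\int[mu]_(x in D) (h x + e%:E))).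
  apply: ge0_le_lower_integral => // x Dx.
  by rewrite -leeBlDr// le_max lexx.
rewrite ge0_integralD//.
rewrite integral_cst// leeD2r//; apply: ge0_le_lower_integral => // x Dx.
by rewrite ge_max g0// andbT leeBlDr// fg.
Qed.

End nonmeasurable_integral.

Section ereal_limit0.
Context (R : realType) (I : Type) (F : set_system I).
Context {FF : Filter F}.

Lemma cvge0P (u : I -> \bar R) : (forall i, (0 <= u i)%E) ->
  (forall e, 0 < e -> \forall i \near F, (u i <= e%:E)%E) <-> u i @[i --> F] --> 0%E.
Proof.
move=> u0; split=> [h|/fine_cvgP[fu cu] e e0].
  apply/fine_cvgP; split.
    by move: (h _ ltr01); apply: filterS => i ui; rewrite ge0_fin_numE// (le_lt_trans ui)// ltry.
  apply/cvgrPdist_le => e /h; apply: filterS => i ui /=.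
  have ufin : u i \is a fin_num by rewrite ge0_fin_numE// (le_lt_trans ui)// ltry.
  by rewrite sub0r normrN ger0_norm ?fine_ge0// -lee_fin fineK.
have /cvgrPdist_le/(_ _ e0) := cu; move: fu; apply: filterS2 => i ufin /=.
by rewrite sub0r normrN ger0_norm ?fine_ge0// -lee_fin fineK.
Qed.

End ereal_limit0.

(** The value [+oo] marks vectors outside the normed subspace, so that Lp can be used inside L0
    without a type of its own. *)
Record complete_norm (R : realType) (V : lmodType R[i]) (N : V -> \bar R) : Prop :=
  CompleteNorm {
    complete_norm_ge0 : forall v, (0 <= N v)%E ;
    complete_norm_D : forall v w, (N (v + w)%R <= N v + N w)%E ;
    complete_norm_Z : forall (a : R[i]) v,
      N (a *: v) = ((ComplexField.Normc.normc a)%:E * N v)%E ;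
    complete_norm_eq0 : forall v, N v = 0%E -> v = 0 ;
    complete_norm_complete : forall u : nat -> V,
      (forall e, 0 < e -> exists n, forall m, (n <= m)%N ->
        (N (u m - u n)%R <= e%:E)%E) ->
      exists v, forall e, 0 < e -> exists n, forall m, (n <= m)%N ->
        (N (u m - v)%R <= e%:E)%E }.

Section bochner_integral.
Import ComplexField.Normc.
Local Open Scope complex_scope.
Context (R : realType) (V : lmodType R[i]).
Variable N : V -> \bar R.
Hypothesis normN : complete_norm N.
Local Notation lambda := (@lebesgue_measure R).
Implicit Types (D A : set R) (s : seq (set R * V)) (v w : V).

Let N_ge0 := complete_norm_ge0 normN.
Let N_D := complete_norm_D normN.
Let N_Z := complete_norm_Z normN.
Let N_eq0 := complete_norm_eq0 normN.

Let N_sub v w : N (v - w) = N (w - v).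
Proof. by rewrite -[v - w]opprB -[- (w - v)]scaleN1r N_Z normcN normc1 mul1e. Qed.

Let N_trip v w u : (N (v - w)%R <= N (v - u)%R + N (w - u)%R)%E.
Proof. by rewrite (N_sub w) (le_trans _ (N_D _ _))// addrA subrK. Qed.

(** With lists of pieces, which may overlap, sums of step functions are concatenations and proofs go
    by induction on the pieces. *)
Definition pieces_fun s (r : R) : V :=
  \sum_(x <- s) ((\1_(x.1) r : R)%:C *: x.2).

Definition pieces_integral D s : V :=
  \sum_(x <- s) ((fine (lambda (D `&` x.1)))%:C *: x.2).

Definition pieces_ok s := forall x, x \in s ->
  [/\ measurable x.1, (lambda x.1 < +oo)%E & (N x.2 < +oo)%E].

Lemma pieces_fun_cat s s' r :
  pieces_fun (s ++ s') r = pieces_fun s r + pieces_fun s' r.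
Proof. exact: big_cat. Qed.

Lemma pieces_integral_cat D s s' :
  pieces_integral D (s ++ s') = pieces_integral D s + pieces_integral D s'.
Proof. exact: big_cat. Qed.

Definition pieces_opp s := [seq (x.1, - x.2) | x <- s].

Lemma pieces_fun_opp s r : pieces_fun (pieces_opp s) r = - pieces_fun s r.
Proof.
by rewrite /pieces_fun big_map/= -sumrN; apply: eq_bigr => x _; rewrite scalerN.
Qed.

Lemma pieces_integral_opp D s :
  pieces_integral D (pieces_opp s) = - pieces_integral D s.
Proof.
by rewrite /pieces_integral big_map/= -sumrN; apply: eq_bigr => x _; rewrite scalerN.
Qed.

Lemma pieces_ok_cat s s' : pieces_ok s -> pieces_ok s' -> pieces_ok (s ++ s').
Proof. by move=> h h' x; rewrite mem_cat => /orP[/h|/h']. Qed.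

Lemma pieces_ok_opp s : pieces_ok s -> pieces_ok (pieces_opp s).
Proof.
move=> h x /mapP[y /h[? ? ?] ->]; split => //=.
by rewrite -scaleN1r N_Z normcN normc1 mul1e.
Qed.

(* Splitting [D] along the first piece, where the partial sum is constant,
   reduces the claim to one piece fewer. *)
Lemma pieces_integral_le s : pieces_ok s -> forall D w, measurable D ->
  (lambda D < +oo)%E ->
  measurable_fun D (fun r => N (w + pieces_fun s r)) /\
  (N ((fine (lambda D))%:C *: w + pieces_integral D s)%R <=
     \int[lambda]_(r in D) N (w + pieces_fun s r)%R)%E.
Proof.
elim: s => [_ D w mD Doo|[A v] s ih sok D w mD Doo].
  have fE : (fun r => N (w + pieces_fun [::] r)) = cst (N w).
    by apply/funext => r; rewrite /pieces_fun big_nil addr0.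
  rewrite fE; split; first exact: measurable_cst.
  rewrite integral_cst// /pieces_integral big_nil addr0 N_Z normcR ger0_norm ?fine_ge0//.
  by rewrite fineK ?ge0_fin_numE// muleC.
have sok' : pieces_ok s by move=> x xs; apply: sok; rewrite inE xs orbT.
have [/= mA _ _] := sok (A, v) (mem_head _ _).
pose D1 := D `&` A; pose D2 := D `\` A.
have mD1 : measurable D1 by exact: measurableI.
have mD2 : measurable D2 by exact: measurableD.
have DE : D = D1 `|` D2 by rewrite setUIDK.
have D12 : [disjoint D1 & D2] by apply/disj_setPS => x [[_ ?] [_ ?]].
have D1oo : (lambda D1 < +oo)%E by apply: le_lt_trans Doo; apply: le_measure; rewrite ?inE// => x [].
have D2oo : (lambda D2 < +oo)%E by apply: le_lt_trans Doo; apply: le_measure; rewrite ?inE// => x [].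
have [mf1 int1] := ih sok' D1 (w + v) mD1 D1oo.
have [mf2 int2] := ih sok' D2 w mD2 D2oo.
pose f r := N (w + pieces_fun ((A, v) :: s) r).
have f1 r : D1 r -> f r = N (w + v + pieces_fun s r).
  by move=> [_ Ar]; rewrite /f /pieces_fun big_cons/= indicE mem_set// scale1r addrA.
have f2 r : D2 r -> f r = N (w + pieces_fun s r).
  by move=> [_ Ar]; rewrite /f /pieces_fun big_cons/= indicE memNset// scale0r add0r.
have mf1' : measurable_fun D1 f.
  by apply: (eq_measurable_fun _ _ mf1) => r; rewrite inE => /f1.
have mf2' : measurable_fun D2 f.
  by apply: (eq_measurable_fun _ _ mf2) => r; rewrite inE => /f2.
have mf : measurable_fun D f by rewrite DE; apply/measurable_funU.
split; first exact: mf.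
rewrite -/f DE ge0_integral_setU//; last by rewrite -DE.
have -> : (\int[lambda]_(r in D1) f r = \int[lambda]_(r in D1) N (w + v + pieces_fun s r)%R)%E.
  by apply: eq_integral => r; rewrite inE => /f1.
have -> : (\int[lambda]_(r in D2) f r = \int[lambda]_(r in D2) N (w + pieces_fun s r)%R)%E.
  by apply: eq_integral => r; rewrite inE => /f2.
apply: le_trans (leeD int1 int2); apply: le_trans (N_D _ _).
have fineU (B : set R) : measurable B ->
    fine (lambda (D `&` B)) = fine (lambda (D1 `&` B)) + fine (lambda (D2 `&` B)).
  move=> mB; have mDB1 : measurable (D1 `&` B) by exact: measurableI.
  have mDB2 : measurable (D2 `&` B) by exact: measurableI.
  rewrite DE setIUl measureU//; last first.
    by apply/seteqP; split => // x [[[_ ?] _] [[_ ?] _]].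
  have fin (E : set R) : measurable E -> (lambda E < +oo)%E ->
      lambda (E `&` B) \is a fin_num.
    move=> mE Eoo; rewrite ge0_fin_numE//; apply: le_lt_trans Eoo.
    by apply: le_measure; rewrite ?inE//; exact: measurableI.
  by rewrite fineD// fin.
have intU : forall s', pieces_ok s' ->
    pieces_integral D s' = pieces_integral D1 s' + pieces_integral D2 s'.
  elim=> [_|x s' ih' ok']; first by rewrite /pieces_integral !big_nil addr0.
  have mx : measurable x.1 by have [] := ok' x (mem_head _ _).
  rewrite /pieces_integral !big_cons -!/(pieces_integral _ _) fineU//.
  rewrite ih'; last by move=> y ys; apply: ok'; rewrite inE ys orbT.
  by rewrite rmorphD/= scalerDl addrACA.
rewrite -DE {1}/pieces_integral big_cons/= -/(pieces_integral _ _) intU// -/D1.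
have -> : fine (lambda D) = fine (lambda D1) + fine (lambda D2).
  by have := fineU _ (measurableT); rewrite !setIT.
rewrite rmorphD/= scalerDl scalerDr le_eqVlt; apply/orP; left; apply/eqP; congr N.
set a := _ *: w; set b := _ *: w; set c := _ *: v.
by rewrite -!addrA [b + (c + _)]addrCA [b + (_ + _)]addrCA.
Qed.

Section fixed_domain.
Variable D : set R.
Hypotheses (mD : measurable D) (Doo : (lambda D < +oo)%E).
Let L := fine (lambda D).

Let L_ge0 : 0 <= L. Proof. exact: fine_ge0. Qed.

Let LE : lambda D = L%:E.
Proof. by rewrite fineK// ge0_fin_numE. Qed.

Definition approximates s (e : R) (g : R -> V) :=
  pieces_ok s /\ forall r, D r -> (N (pieces_fun s r - g r)%R <= e%:E)%E.

Lemma pieces_integral_sub_le s s' : pieces_ok s -> pieces_ok s' ->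
  measurable_fun D (fun r => N (pieces_fun s r - pieces_fun s' r)) /\
  (N (pieces_integral D s - pieces_integral D s')%R <=
    \int[lambda]_(r in D) N (pieces_fun s r - pieces_fun s' r)%R)%E.
Proof.
move=> ok ok'.
have := pieces_integral_le (pieces_ok_cat ok (pieces_ok_opp ok')) 0 mD Doo.
rewrite scaler0 add0r pieces_integral_cat pieces_integral_opp.
have -> : (fun r => N (0 + pieces_fun (s ++ pieces_opp s') r)) =
    (fun r => N (pieces_fun s r - pieces_fun s' r)).
  by apply/funext => r; rewrite add0r pieces_fun_cat pieces_fun_opp.
by [].
Qed.

Lemma approximates_close s e s' e' g : approximates s e g -> approximates s' e' g ->
  (N (pieces_integral D s - pieces_integral D s')%R <= ((e + e') * L)%:E)%E.
Proof.
move=> [ok h] [ok' h']; apply: le_trans (pieces_integral_sub_le ok ok').2 _.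
apply: (@le_trans _ _ (\int[lambda]_(r in D) cst (e + e')%:E r)%E).
  apply: ge0_le_lower_integral => // r Dr.
  by apply: le_trans (N_trip _ _ (g r)) _; rewrite EFinD leeD// ?h ?h'.
by rewrite integral_cst// [X in (_ * X)%E]LE.
Qed.

Definition pieces_of (S : step_function N) :=
  [seq (@step_set _ _ _ S i, @step_val _ _ _ S i) | i <- enum 'I_(step_size S)].

Lemma pieces_ofE S r : pieces_fun (pieces_of S) r = step_fun S r.
Proof. by rewrite /pieces_fun big_map big_enum. Qed.

Lemma pieces_of_integral S : pieces_integral D (pieces_of S) = step_integral D S.
Proof. by rewrite /pieces_integral big_map big_enum. Qed.

Lemma pieces_of_ok S : pieces_ok (pieces_of S).
Proof.
move=> x /mapP[i _ ->]; split; [exact: step_measurable|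
  exact: step_finite_measure|exact: step_finite_norm].
Qed.

Lemma step_of_pieces s : pieces_ok s -> exists S : step_function N,
  (forall r, step_fun S r = pieces_fun s r) /\
  step_integral D S = pieces_integral D s.
Proof.
move=> ok; have h i := ok _ (mem_tnth i (in_tuple s)).
pose S := @StepFunction R V N (size s) (fun i => (tnth (in_tuple s) i).1)
  (fun i => (tnth (in_tuple s) i).2)
  (fun i => let: And3 a _ _ := h i in a)
  (fun i => let: And3 _ a _ := h i in a)
  (fun i => let: And3 _ _ a := h i in a).
by exists S; split => [r|]; rewrite /step_fun /step_integral
  /pieces_fun /pieces_integral [RHS]big_tnth.
Qed.

(** Uniform approximants have Cauchy integrals, whose limit [v] is a Bochner integral of [g]. Any
    other one comes from step functions whose distance to [g] may fail to be measurable; comparing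
    these with a uniform approximant instead only requires a lower integral. *)
Lemma bochner_integral_approx g :
  (forall e, 0 < e -> exists s, approximates s e g) ->
  forall s e, approximates s e g ->
  (N (pieces_integral D s - bochner_integral N D g)%R <= (e * L)%:E)%E.
Proof.
move=> happ; pose a n : R := 2^-1 ^+ n.
have a0 n : 0 < a n by rewrite exprn_gt0.
have asmall e : 0 < e -> exists n, forall m, (n <= m)%N -> a m * L <= e.
  move=> e0; have L1 : 0 < L + 1 by rewrite ltr_wpDl.
  have [|n hn] := @half_exp_small _ (e / (L + 1)); first by rewrite divr_gt0.
  exists n => m nm; apply: (@le_trans _ _ (a n * (L + 1))); last by rewrite -ler_pdivlMr.
  by apply: ler_pM; rewrite ?(ltW (a0 _)) ?lerDl//; exact: half_exp_le.
have /choice[s hs] n : exists s, approximates s (a n) g by exact: happ.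
have [v hv] : exists v, forall e, 0 < e -> exists n, forall m, (n <= m)%N ->
    (N (pieces_integral D (s m) - v)%R <= e%:E)%E.
  apply: (complete_norm_complete normN) => e e0; have [|n hn] := asmall (e / 2); first by rewrite divr_gt0.
  exists n => m nm; apply: le_trans (approximates_close (hs m) (hs n)) _.
  by rewrite lee_fin mulrDl (splitr e) lerD// hn.
have close t e : approximates t e g ->
    (N (pieces_integral D t - v)%R <= (e * L)%:E)%E.
  move=> ht; apply/lee_addgt0Pr => b b0.
  have b20 : 0 < b / 2 by rewrite divr_gt0.
  have [n hn] := asmall _ b20; have [n' hn'] := hv _ b20.
  pose m := maxn n n'.
  have := N_trip (pieces_integral D t) v (pieces_integral D (s m)).
  move/le_trans; apply; rewrite (N_sub v).
  apply: le_trans (leeD (approximates_close ht (hs m)) (hn' m (leq_maxr _ _))) _.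
  by rewrite -!EFinD lee_fin mulrDl -addrA lerD2l [leRHS]splitr lerD2r hn// leq_maxl.
suff -> : bochner_integral N D g = v by exact: close.
(* The choice operator returns [v] once [v] is shown to be an integral, and then the only one. *)
apply: xget_unique => [|v' [S' [_ S'g S'v]]].
  have /choice[S hS] n := step_of_pieces (hs n).1.
  have SE n : step_fun (S n) = pieces_fun (s n) by apply/funext => r; rewrite (hS n).1.
  exists S; split.
  - apply: aeW => r Dr; apply/cvge0P => // e /half_exp_small[n hn].
    exists n => // m /= nm; rewrite SE; apply: le_trans ((hs m).2 _ Dr) _.
    by rewrite lee_fin (le_trans _ hn)//; exact: half_exp_le.
  - apply/cvge0P; first by move=> n; exact: integral_ge0.
    move=> e /asmall[n hn]; exists n => // m /= nm.
    apply: (@le_trans _ _ (\int[lambda]_(r in D) cst (a m)%:E r)%E).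
      by apply: ge0_le_lower_integral => // r Dr; rewrite SE; exact: (hs m).2.
    by rewrite integral_cst// [X in (_ * X)%E]LE lee_fin; exact: hn.
  - apply/cvge0P => // e /hv[n hn]; exists n => // m /= nm.
    by rewrite (hS m).2; exact: hn.
apply/eqP; rewrite -subr_eq0; apply/eqP/N_eq0/eqP; rewrite eq_le N_ge0 andbT.
apply/lee_addgt0Pr => e e0; rewrite add0e.
(* One quarter each for: [v'] against the integral of [S' n], the lower integral of the error of
   [S' n], the uniform error of [s n3], and the integral of [s n3] against [v]. *)
have e40 : 0 < e / 4 by rewrite divr_gt0.
have /cvge0P -/(_ _)/(_ _ e40)[|n1 _ h1] := S'g.
  by move=> n; exact: integral_ge0.
have /cvge0P -/(_ _)/(_ _ e40)[//|n2 _ h2] := S'v.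
have [n3 h3] := asmall _ e40.
pose n := maxn n1 n2.
have {}h1 := h1 n (leq_maxl _ _); have {}h2 := h2 n (leq_maxr _ _).
have {}h3 := h3 n3 (leqnn _).
have := N_trip v' v (step_integral D (S' n)); rewrite (N_sub v' (step_integral _ _)) => /le_trans; apply.
rewrite /= in h1 h2.
have := N_trip v (step_integral D (S' n)) (pieces_integral D (s n3)).
rewrite (N_sub v (pieces_integral _ _)) => hv1.
have := pieces_integral_sub_le (@pieces_of_ok (S' n)) (hs n3).1.
rewrite pieces_of_integral => -[mh hint].
have hlow := @lower_integral_le_addr _ _ _ lambda D _
  (fun r => N (step_fun (S' n) r - g r)) (a n3) mD mh (ltW (a0 _)).
have {}hint := le_trans hint (hlow (fun _ _ => N_ge0 _) _ (fun _ _ => N_ge0 _)).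
have {}hint : (N (step_integral D (S' n) - pieces_integral D (s n3)) <= (e / 4 + e / 4)%:E)%E.
  apply: le_trans (hint _) _ => [r Dr|].
    apply: le_trans (N_trip _ _ (g r)) _; rewrite pieces_ofE leeD2l//.
    exact: (hs n3).2.
  by rewrite [X in (_ * X)%E]LE EFinD leeD// lee_fin.
have {}hv1 : (N (v - step_integral D (S' n)) <= (e / 4 + (e / 4 + e / 4))%:E)%E.
  apply: le_trans hv1 _; rewrite EFinD leeD//.
  by apply: le_trans (close _ _ (hs n3)) _; rewrite lee_fin.
apply: le_trans (leeD h2 hv1) _; rewrite -EFinD lee_fin; lra.
Qed.

End fixed_domain.
End bochner_integral.

(** * Riemann sums of uniformly continuous functions *)

Section riemann_sums.
Import ComplexField.Normc.
Local Open Scope complex_scope.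
Context (R : realType) (V : lmodType R[i]).
Variable N : V -> \bar R.
Hypothesis normN : complete_norm N.
Local Notation lambda := (@lebesgue_measure R).
Implicit Types (a h r t s : R) (n k : nat) (phi : nat -> V).

(** Half-open cells are disjoint; the right end of the whole grid belongs to none of them. *)
Definition grid_pieces a h n phi : seq (set R * V) :=
  [seq (`[a + k%:R * h, a + k.+1%:R * h[%classic, phi k) | k <- iota 0 n].

Lemma pieces_fun1 (x : set R * V) r : pieces_fun [:: x] r = (\1_(x.1) r : R)%:C *: x.2.
Proof. by rewrite /pieces_fun big_seq1. Qed.

Lemma pieces_integral1 D (x : set R * V) :
  pieces_integral D [:: x] = (fine (lambda (D `&` x.1)))%:C *: x.2.
Proof. by rewrite /pieces_integral big_seq1. Qed.

Lemma grid_piecesS a h n phi : grid_pieces a h n.+1 phi =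
  grid_pieces a h n phi ++ [:: (`[a + n%:R * h, a + n.+1%:R * h[%classic, phi n)].
Proof.
by rewrite /grid_pieces [iota 0 n.+1](_ : _ = iota 0 n ++ [:: n]) ?map_cat// -addn1 iotaD.
Qed.

Lemma grid_pieces_fun0 a h n phi r : 0 <= h -> r < a \/ a + n%:R * h <= r ->
  pieces_fun (grid_pieces a h n phi) r = 0.
Proof.
move=> h0; elim: n => [|n ih] rn; first by rewrite /pieces_fun big_nil.
rewrite grid_piecesS pieces_fun_cat ih; last first.
  case: rn => [|rn]; [by left|right]; apply: le_trans rn.
  by rewrite lerD2l ler_wpM2r// ler_nat.
rewrite add0r pieces_fun1/= indicE memNset ?scale0r//=.
rewrite in_itv/= => /andP[r1 r2]; case: rn => rn; last by move: r2; rewrite ltNge rn.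
have : a < a by apply: le_lt_trans rn; apply: le_trans r1; rewrite lerDl mulr_ge0.
by rewrite ltxx.
Qed.

Lemma grid_pieces_fun a h n phi r : 0 <= h -> a <= r -> r < a + n%:R * h ->
  exists k, [/\ (k < n)%N, a + k%:R * h <= r, r < a + k.+1%:R * h &
    pieces_fun (grid_pieces a h n phi) r = phi k].
Proof.
move=> h0 ar; elim: n => [|n ih] rn.
  by move: rn; rewrite mul0r addr0 ltNge ar.
rewrite grid_piecesS pieces_fun_cat.
have [rn'|rn'] := ltP r (a + n%:R * h).
  have [k [kn k1 k2 ->]] := ih rn'; exists k; split => //; first exact: ltnW.
  rewrite pieces_fun1/= indicE memNset ?scale0r ?addr0//=.
  by rewrite in_itv/= leNgt rn'.
exists n; split => //; rewrite grid_pieces_fun0//; last by right.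
rewrite add0r pieces_fun1/= indicE mem_set ?scale1r//=.
by rewrite in_itv/= rn' rn.
Qed.

Lemma grid_pieces_integral a h n phi t : 0 <= h -> 0 <= a -> a + n%:R * h <= t ->
  pieces_integral `[0, t] (grid_pieces a h n phi) = \sum_(k < n) (h%:C *: phi k).
Proof.
move=> h0 a0; elim: n => [|n ih] nt; first by rewrite /pieces_integral big_nil big_ord0.
rewrite grid_piecesS pieces_integral_cat ih; last first.
  by apply: le_trans nt; rewrite lerD2l ler_wpM2r// ler_nat.
rewrite big_ord_recr/=; congr (_ + _); rewrite pieces_integral1/=.
congr (_%:C *: _); rewrite setIidr; last first.
  move=> r /=; rewrite !in_itv/= => /andP[r1 r2]; apply/andP; split.
    by apply: le_trans r1; rewrite addr_ge0// mulr_ge0.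
  by apply: le_trans nt; exact: ltW.
rewrite lebesgue_measure_itv/= lte_fin.
have e : a + n.+1%:R * h - (a + n%:R * h) = h.
  by rewrite -natr1 mulrDl mul1r; ring.
case: ifPn => [_|]; first by rewrite -EFinD e.
rewrite -leNgt => le; apply/esym/eqP; rewrite eq_le h0 andbT.
by rewrite -e subr_le0.
Qed.

Lemma grid_pieces_ok a h n phi : (forall k, (k < n)%N -> (N (phi k) < +oo)%E) ->
  pieces_ok N (grid_pieces a h n phi).
Proof.
move=> hp x /mapP[k]; rewrite mem_iota add0n => /andP[_ kn] ->; split => //=.
  by rewrite lebesgue_measure_itv/=; case: ifP => // _; rewrite -EFinD ltry.
exact: hp.
Qed.

Variable g : R -> V.
Hypothesis g_fin : forall r, 0 <= r -> (N (g r) < +oo)%E.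
Hypothesis g_cont : forall e, 0 < e -> exists2 delta, 0 < delta &
  forall r s, 0 <= r -> 0 <= s -> `|r - s| <= delta -> (N (g r - g s)%R <= e%:E)%E.

Lemma small_step t delta : 0 < delta -> exists n0, forall n, (n0 < n)%N -> t / n%:R <= delta.
Proof.
move=> d0; exists (Num.truncn (t / delta)) => n hn.
have n0 : 0 < n%:R :> R by rewrite ltr0n (leq_ltn_trans _ hn).
rewrite ler_pdivrMr// mulrC -ler_pdivrMr//.
by apply: le_trans (ltW (truncnS_gt _)) _; rewrite ler_nat.
Qed.

(** The break at [t] makes the Riemann sums match the splitting of an integral over [0, t + s], for
    any ratio of [t] to [s]. The last piece, of measure 0, covers the end point missed by the
    half-open cells. *)
Definition two_grids t s n :=
  grid_pieces 0 (t / n%:R) n (fun k => g (k%:R * (t / n%:R))) ++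
  (grid_pieces t (s / n%:R) n (fun k => g (t + k%:R * (s / n%:R))) ++
   [:: ([set t + s], g (t + s))]).

Lemma two_grids_approximates t s e : 0 <= t -> 0 <= s -> 0 < e ->
  exists n0, forall n, (n0 < n)%N -> approximates N `[0, t + s] (two_grids t s n) e g.
Proof.
move=> t0 s0 /g_cont[delta d0 hd].
have [n1 hn1] := small_step t d0; have [n2 hn2] := small_step s d0.
exists (maxn n1 n2) => n; rewrite gtn_max => /andP[n1n n2n].
have tn := hn1 _ n1n; have sn := hn2 _ n2n.
have nR : n%:R != 0 :> R by rewrite pnatr_eq0 -lt0n (leq_ltn_trans _ n1n).
have tn0 : 0 <= t / n%:R by rewrite divr_ge0.
have sn0 : 0 <= s / n%:R by rewrite divr_ge0.
split.
  apply: pieces_ok_cat; [|apply: pieces_ok_cat].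
  - by apply: grid_pieces_ok => k _; rewrite g_fin// mulr_ge0.
  - by apply: grid_pieces_ok => k _; rewrite g_fin// addr_ge0// mulr_ge0.
  - move=> x; rewrite inE => /eqP ->; split => //=.
      by rewrite lebesgue_measure_set1.
    by rewrite g_fin// addr_ge0.
move=> r /=; rewrite in_itv/= => /andP[r0 rts].
have mtn : n%:R * (t / n%:R) = t by rewrite mulrCA mulfV ?mulr1.
have msn : n%:R * (s / n%:R) = s by rewrite mulrCA mulfV ?mulr1.
rewrite /two_grids !pieces_fun_cat.
have [rt|tr] := ltP r t.
  rewrite (@grid_pieces_fun0 t)//; last by left.
  rewrite pieces_fun1/= indicE memNset ?scale0r ?addr0; last first.
    by move=> /= rE; move: rt; rewrite rE ltNge lerDl s0.
  have [|k [kn k1 k2 ->]] := @grid_pieces_fun 0 (t / n%:R) n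
    (fun k => g (k%:R * (t / n%:R))) r tn0 r0; first by rewrite mtn add0r.
  rewrite !add0r in k1 k2; apply: hd => //; first by rewrite mulr_ge0.
  rewrite distrC ger0_norm ?subr_ge0//; apply: le_trans tn.
  by rewrite lerBlDl ltW//; move: k2; rewrite -natr1 mulrDl mul1r.
rewrite (@grid_pieces_fun0 0)//; last by right; rewrite mtn add0r.
rewrite add0r; have [rs|sr] := ltP r (t + s).
  rewrite [pieces_fun [:: _] _](_ : _ = 0) ?addr0; last first.
    rewrite pieces_fun1/= indicE memNset ?scale0r//=.
    by move=> rE; move: rs; rewrite rE ltxx.
  have [|k [kn k1 k2 ->]] := @grid_pieces_fun t (s / n%:R) n
    (fun k => g (t + k%:R * (s / n%:R))) r sn0 tr; first by rewrite msn.
  apply: hd => //; first by rewrite addr_ge0// mulr_ge0.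
  rewrite distrC ger0_norm ?subr_ge0//; apply: le_trans sn.
  by rewrite lerBlDl ltW//; move: k2; rewrite -natr1 mulrDl mul1r addrA.
have -> : r = t + s by apply/eqP; rewrite eq_le rts sr.
rewrite grid_pieces_fun0//; last by right; rewrite msn.
rewrite add0r pieces_fun1/= indicE mem_set// scale1r.
apply: hd; rewrite ?addr_ge0//.
by rewrite subrr normr0 ltW.
Qed.

Lemma bochner_integral_riemann2 t s e : 0 <= t -> 0 <= s -> 0 < e ->
  exists n0, forall n, (n0 < n)%N ->
  (N (\sum_(k < n) (t / n%:R)%:C *: g (k%:R * (t / n%:R)) +
      \sum_(k < n) (s / n%:R)%:C *: g (t + k%:R * (s / n%:R)) -
      bochner_integral N `[0, (t + s)%R] g)%R <= e%:E)%E.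
Proof.
move=> t0 s0 e0; have ts0 : 0 <= t + s by rewrite addr_ge0.
have ts1 : 0 < t + s + 1 by rewrite ltr_wpDl.
pose D : set R := `[0, t + s]%classic.
have LD : lambda D = (t + s)%:E.
  rewrite lebesgue_measure_itv/= lte_fin; case: ifPn => [_|]; first by rewrite -EFinD subr0.
  by rewrite -leNgt => h; congr EFin; apply/eqP; rewrite eq_le ts0 h.
have Doo : (lambda D < +oo)%E by rewrite LD ltry.
have happ e' : 0 < e' -> exists p, approximates N D p e' g.
  move=> /(two_grids_approximates t0 s0)[n0 h].
  by exists (two_grids t s n0.+1); exact: h.
(* Dividing by t + s + 1 rather than by the length t + s covers the case where the interval is a
   point. *)
have [n0 hn0] := two_grids_approximates t0 s0 (divr_gt0 e0 ts1).
exists n0 => n n0n; have nR : n%:R != 0 :> R by rewrite pnatr_eq0 -lt0n (leq_ltn_trans _ n0n).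
have := bochner_integral_approx normN (measurable_itv _) Doo happ (hn0 n n0n).
have tn0 : 0 <= t / n%:R by rewrite divr_ge0.
have sn0 : 0 <= s / n%:R by rewrite divr_ge0.
have mtn : 0 + n%:R * (t / n%:R) <= t + s by rewrite add0r mulrCA mulfV// mulr1 lerDl.
have msn : t + n%:R * (s / n%:R) <= t + s by rewrite mulrCA mulfV// mulr1.
rewrite LD/= /two_grids !pieces_integral_cat.
rewrite (grid_pieces_integral _ tn0 (lexx 0) mtn) (grid_pieces_integral _ sn0 t0 msn).
rewrite [pieces_integral _ [:: _]](_ : _ = 0); last first.
  rewrite pieces_integral1/=.
  rewrite [lambda _](_ : _ = 0%E) ?scale0r//.
  apply/eqP; rewrite eq_le measure_ge0 andbT -(lebesgue_measure_set1 (t + s)).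
  by apply: le_measure; rewrite ?inE//; apply: measurableI => //; exact: measurable_itv.
rewrite addr0 => /le_trans; apply; rewrite lee_fin mulrAC ler_pdivrMr//.
by rewrite ler_wpM2l ?(ltW e0)// lerDl.
Qed.

Lemma bochner_integral_riemann t e : 0 <= t -> 0 < e ->
  exists n0, forall n, (n0 < n)%N ->
  (N (\sum_(k < n) (t / n%:R)%:C *: g (k%:R * (t / n%:R)) -
      bochner_integral N `[0, t] g)%R <= e%:E)%E.
Proof.
move=> t0 e0; have [n0 h] := bochner_integral_riemann2 t0 (lexx 0) e0.
exists n0 => n /h.
have -> : \sum_(k < n) (0 / n%:R)%:C *: g (t + k%:R * (0 / n%:R)) = 0.
  by apply: big1 => k _; rewrite mul0r scale0r.
by rewrite !addr0.
Qed.

End riemann_sums.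

(** * Averages over an interval, with values in Lp *)

Section averages.
Import ComplexField.Normc.
Local Open Scope complex_scope.
Context d (Omega : measurableType d) (R : realType).
Variable mu : {measure set Omega -> \bar R}.
Local Notation L0 := (L0 mu).
Implicit Types (g : R -> L0) (p t e : R).

Lemma complete_norm_Lp p : 1 <= p -> complete_norm (@Lp_norm _ _ _ mu p%:E).
Proof.
move=> p1; have p0 : 0 < p by apply: lt_le_trans p1.
split.
- exact: Lp_norm_ge0.
- by move=> f h; exact: Lp_normD.
- by move=> a f; exact: Lp_normZ.
- by move=> f; apply: Lp_norm_eq0; rewrite lte_fin.
- by move=> u; exact: Lp_complete.
Qed.

Definition uniform_in_Lp p g :=
  (forall r, 0 <= r -> Lp p%:E (g r)) /\
  (forall e, 0 < e -> exists2 delta, 0 < delta &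
    forall r s, 0 <= r -> 0 <= s -> `|r - s| <= delta ->
      (Lp_norm p%:E (g r - g s)%R <= e%:E)%E).

Definition average p g t : L0 :=
  (t^-1)%:C *: bochner_integral (@Lp_norm _ _ _ mu p%:E) `[0, t] g.

Definition riemann_average n g t : L0 :=
  (n%:R^-1)%:C *: \sum_(k < n) g (k%:R * (t / n%:R)).

(** Most properties of averages below are transferred from Riemann averages, which are convex
    combinations of values, through this approximation. *)
Lemma average_riemann p g t e : 1 <= p -> uniform_in_Lp p g -> 0 < t -> 0 < e ->
  exists n0, forall n, (n0 < n)%N ->
  (Lp_norm p%:E (riemann_average n g t - average p g t)%R <= e%:E)%E.
Proof.
move=> p1 [gfin gcont] t0 e0; have p0 : 0 < p by apply: lt_le_trans p1.
have [n0 h] := bochner_integral_riemann (complete_norm_Lp p1) gfin gcont (ltW t0) (mulr_gt0 e0 t0).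
exists n0 => n n0n; have {}h := h n n0n.
have -> : riemann_average n g t - average p g t = (t^-1)%:C *:
    (\sum_(k < n) (t / n%:R)%:C *: g (k%:R * (t / n%:R)) -
     bochner_integral (@Lp_norm _ _ _ mu p%:E) `[0, t] g).
  rewrite scalerBr; congr (_ - _); rewrite -scaler_sumr scalerA -rmorphM/=.
  by rewrite mulrA mulVf ?gt_eqF// mul1r.
rewrite Lp_normZ// normcR ger0_norm ?invr_ge0 ?(ltW t0)//.
by rewrite muleC lee_pdivrMr.
Qed.

Lemma Lp_norm_sum_le p n c (F : nat -> L0) : 1 <= p ->
  (forall i, (i < n)%N -> (Lp_norm p%:E (F i) <= c%:E)%E) ->
  (Lp_norm p%:E (\sum_(i < n) F i)%R <= (n%:R * c)%:E)%E.
Proof.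
move=> p1; elim: n => [|n ih] h.
  by rewrite big_ord0 Lp_norm0 ?mul0r// (lt_le_trans _ p1).
rewrite big_ord_recr/=; apply: le_trans (Lp_normD _ _ p1) _.
rewrite -natr1 mulrDl mul1r EFinD leeD ?h//.
by apply: ih => i ni; apply: h; rewrite ltnS ltnW.
Qed.

Lemma riemann_average_norm p g t c n : 1 <= p -> 0 < t -> (0 < n)%N ->
  (forall r, 0 <= r -> r <= t -> (Lp_norm p%:E (g r) <= c%:E)%E) ->
  (Lp_norm p%:E (riemann_average n g t) <= c%:E)%E.
Proof.
move=> p1 t0 n0 h; have nR : 0 < n%:R :> R by rewrite ltr0n.
rewrite /riemann_average Lp_normZ ?(lt_le_trans _ p1)//.
rewrite normcR ger0_norm ?invr_ge0 ?(ltW nR)// muleC lee_pdivrMr// muleC.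
apply: (@Lp_norm_sum_le _ _ _ (fun k => g (k%:R * (t / n%:R)))) => // k kn.
apply: h; first by rewrite mulr_ge0// divr_ge0// ltW.
by rewrite mulrCA ler_piMr ?(ltW t0)// ler_pdivrMr// mul1r ler_nat ltnW.
Qed.

Lemma riemann_average_ae_le A g t c n : 0 < t -> (0 < n)%N ->
  (forall r, 0 <= r -> r <= t -> ae_le A c (g r)) ->
  ae_le A c (riemann_average n g t).
Proof.
move=> t0 n0 h; have nR : 0 < n%:R :> R by rewrite ltr0n.
have -> : c = normc (n%:R^-1)%:C * (\sum_(k < n) c).
  rewrite normcR ger0_norm ?invr_ge0 ?(ltW nR)// sumr_const card_ord.
  by rewrite -[c *+ n]mulr_natl mulrA mulVf ?mul1r// gt_eqF.
apply: ae_leZ; apply: (@ae_le_sum _ _ _ _ _ n (fun=> c) (fun k => g (k%:R * (t / n%:R)))) => // k kn.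
apply: h; first by rewrite mulr_ge0// divr_ge0// ltW.
by rewrite mulrCA ler_piMr ?(ltW t0)// ler_pdivrMr// mul1r ler_nat ltnW.
Qed.

Lemma average_norm p g t c : 1 <= p -> uniform_in_Lp p g -> 0 < t ->
  (forall r, 0 <= r -> r <= t -> (Lp_norm p%:E (g r) <= c%:E)%E) ->
  (Lp_norm p%:E (average p g t) <= c%:E)%E.
Proof.
move=> p1 gu t0 h; apply/lee_addgt0Pr => e e0.
have [n0 hn] := average_riemann p1 gu t0 e0.
rewrite -[average p g t](subKr (riemann_average n0.+1 g t)).
apply: le_trans (Lp_normD _ _ p1) _; rewrite Lp_normN ?(lt_le_trans _ p1)//.
by apply: leeD; [exact: riemann_average_norm|exact: hn].
Qed.

Lemma average_Lp p g t : 1 <= p -> uniform_in_Lp p g -> 0 < t -> Lp p%:E (average p g t).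
Proof.
move=> p1 gu t0; have [n0 hn] := average_riemann p1 gu t0 ltr01.
rewrite -[average p g t](subKr (riemann_average n0.+1 g t)).
apply: LpB => //; last by apply: LpW; exact: hn.
apply: LpZ; first exact: lt_le_trans p1.
apply: (@Lp_sum _ _ _ _ _ _ (fun k => g (k%:R * (t / n0.+1%:R)))) => // k _.
by apply: gu.1; rewrite mulr_ge0// divr_ge0// ltW.
Qed.

Lemma average_ae_le p A g t c : 1 <= p -> uniform_in_Lp p g -> 0 < t ->
  (forall r, 0 <= r -> r <= t -> ae_le A c (g r)) -> ae_le A c (average p g t).
Proof.
move=> p1 gu t0 h; apply: (ae_le_closed p1) => e e0.
have [n0 hn] := average_riemann p1 gu t0 e0.
by exists (riemann_average n0.+1 g t); [exact: hn|exact: riemann_average_ae_le].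
Qed.

(** The same Riemann averages approximate both sides. This links the Lp-valued integral of the
    theorem to the L1 averages, for which the maximal inequality holds. *)
Lemma average_consistent p q g t : 1 <= p -> 1 <= q -> uniform_in_Lp p g ->
  uniform_in_Lp q g -> 0 < t -> average p g t = average q g t.
Proof.
move=> p1 q1 gp gq t0; apply: (L0_eq_approx p1 q1) => e e0.
have [n0 hn] := average_riemann p1 gp t0 e0.
have [n1 hn'] := average_riemann q1 gq t0 e0.
exists (riemann_average (maxn n0 n1).+1 g t); split.
  by apply: hn; rewrite ltnS leq_maxl.
by apply: hn'; rewrite ltnS leq_maxr.
Qed.

Lemma uniform_in_LpD p g g' : 1 <= p -> uniform_in_Lp p g -> uniform_in_Lp p g' ->
  uniform_in_Lp p (fun r => g r + g' r).
Proof.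
move=> p1 [gf gc] [gf' gc']; split=> [r r0|e e0].
  by apply: LpD => //; [exact: gf|exact: gf'].
have e20 : 0 < e / 2 by rewrite divr_gt0.
have [d1 d10 h1] := gc _ e20; have [d2 d20 h2] := gc' _ e20.
exists (Num.min d1 d2) => [|r s r0 s0]; first by rewrite lt_min d10.
rewrite le_min => /andP[rs1 rs2].
rewrite opprD addrACA; apply: le_trans (Lp_normD _ _ p1) _.
by rewrite [in leRHS](splitr e) EFinD leeD// ?h1 ?h2.
Qed.

Lemma averageD p g g' t : 1 <= p -> uniform_in_Lp p g -> uniform_in_Lp p g' -> 0 < t ->
  average p (fun r => g r + g' r) t = average p g t + average p g' t.
Proof.
move=> p1 gu gu' t0; have gg := uniform_in_LpD p1 gu gu'.
apply: (L0_eq_approx p1 p1) => e e0; have e20 : 0 < e / 2 by rewrite divr_gt0.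
have [n0 h0] := average_riemann p1 gg t0 e0.
have [n1 h1] := average_riemann p1 gu t0 e20.
have [n2 h2] := average_riemann p1 gu' t0 e20.
pose n := (maxn n0 (maxn n1 n2)).+1.
exists (riemann_average n (fun r => g r + g' r) t); split.
  by apply: h0; rewrite ltnS leq_maxl.
rewrite {1}/riemann_average big_split scalerDr opprD addrACA.
apply: le_trans (Lp_normD _ _ p1) _; rewrite [in leRHS](splitr e) EFinD leeD//.
  by apply: h1; rewrite ltnS !leq_max leqnn orbT.
by apply: h2; rewrite ltnS !leq_max leqnn !orbT.
Qed.

Lemma uniform_in_LpN p g : 1 <= p -> uniform_in_Lp p g -> uniform_in_Lp p (fun r => - g r).
Proof.
move=> p1 [gf gc]; have p0 : 0 < p by apply: lt_le_trans p1.
split=> [r r0|e e0]; first by apply: LpN => //; exact: gf.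
have [d0 d00 h] := gc _ e0; exists d0 => // r s r0 s0 rs.
by rewrite -opprD Lp_normN// h.
Qed.

Lemma averageN p g t : 1 <= p -> uniform_in_Lp p g -> 0 < t ->
  average p (fun r => - g r) t = - average p g t.
Proof.
move=> p1 gu t0; apply/eqP; rewrite -subr_eq0 opprK; apply/eqP.
rewrite -averageD//; last exact: uniform_in_LpN.
apply: (@Lp_norm_eq0 _ _ _ _ p%:E); first by rewrite lte_fin (lt_le_trans _ p1).
apply/eqP; rewrite eq_le Lp_norm_ge0 andbT; apply: average_norm => //.
  by apply: uniform_in_LpD => //; exact: uniform_in_LpN.
by move=> r _ _; rewrite addNr Lp_norm0// (lt_le_trans _ p1).
Qed.

Lemma averageB p g g' t : 1 <= p -> uniform_in_Lp p g -> uniform_in_Lp p g' -> 0 < t ->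
  average p (fun r => g r - g' r) t = average p g t - average p g' t.
Proof.
move=> p1 gu gu' t0; rewrite averageD ?averageN//; exact: uniform_in_LpN.
Qed.

Lemma eq_average p g g' t : (forall r, 0 <= r -> g r = g' r) -> 1 <= p ->
  uniform_in_Lp p g -> uniform_in_Lp p g' -> 0 < t -> average p g t = average p g' t.
Proof.
move=> gg' p1 gu gu' t0; apply/eqP; rewrite -subr_eq0 -averageB//; apply/eqP.
apply: (@Lp_norm_eq0 _ _ _ _ p%:E); first by rewrite lte_fin (lt_le_trans _ p1).
apply/eqP; rewrite eq_le Lp_norm_ge0 andbT; apply: average_norm => //.
  by apply: uniform_in_LpD => //; exact: uniform_in_LpN.
by move=> r r0 _; rewrite gg'// subrr Lp_norm0// (lt_le_trans _ p1).
Qed.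

Lemma uniform_in_LpZ p (a : R[i]) g : 1 <= p -> uniform_in_Lp p g ->
  uniform_in_Lp p (fun r => a *: g r).
Proof.
move=> p1 [gf gc]; have p0 : 0 < p by apply: lt_le_trans p1.
split=> [r r0|e e0]; first by apply: LpZ => //; exact: gf.
have na : 0 < normc a + 1 by rewrite ltr_wpDl// normc_ge0.
have [d0 d00 h] := gc _ (divr_gt0 e0 na); exists d0 => // r s r0 s0 rs.
rewrite -scalerBr Lp_normZ//.
apply: (@le_trans _ _ ((normc a)%:E * (e / (normc a + 1))%:E)%E).
  by rewrite lee_wpmul2l ?h// lee_fin normc_ge0.
rewrite -EFinM lee_fin mulrA ler_pdivrMr// mulrC ler_wpM2l ?(ltW e0)//.
by rewrite lerDl.
Qed.

Lemma averageZ p (a : R[i]) g t : 1 <= p -> uniform_in_Lp p g -> 0 < t ->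
  average p (fun r => a *: g r) t = a *: average p g t.
Proof.
move=> p1 gu t0; have p0 : 0 < p by apply: lt_le_trans p1.
have ag := uniform_in_LpZ a p1 gu.
apply: (L0_eq_approx p1 p1) => e e0.
have na : 0 < normc a + 1 by rewrite ltr_wpDl// normc_ge0.
have [n0 h0] := average_riemann p1 ag t0 e0.
have [n1 h1] := average_riemann p1 gu t0 (divr_gt0 e0 na).
exists (riemann_average (maxn n0 n1).+1 (fun r => a *: g r) t); split.
  by apply: h0; rewrite ltnS leq_maxl.
have raZ n : riemann_average n (fun r => a *: g r) t = a *: riemann_average n g t.
  by rewrite /riemann_average -[X in _ *: X]scaler_sumr !scalerA mulrC.
rewrite raZ -scalerBr Lp_normZ//.
apply: (@le_trans _ _ ((normc a)%:E * (e / (normc a + 1))%:E)%E).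
  rewrite lee_wpmul2l ?lee_fin ?normc_ge0//.
  by apply: h1; rewrite ltnS leq_maxr.
rewrite -EFinM lee_fin mulrA ler_pdivrMr// mulrC ler_wpM2l ?(ltW e0)//.
by rewrite lerDl.
Qed.

Lemma uniform_in_Lp_cst p (f : L0) : 1 <= p -> Lp p%:E f -> uniform_in_Lp p (fun=> f).
Proof.
move=> p1 fp; have p0 : 0 < p by apply: lt_le_trans p1.
split=> // e e0; exists 1 => // r s _ _ _.
by rewrite subrr Lp_norm0// lee_fin ltW.
Qed.

Lemma average_cst p (f : L0) t : 1 <= p -> Lp p%:E f -> 0 < t ->
  average p (fun=> f) t = f.
Proof.
move=> p1 fp t0; have p0 : 0 < p by apply: lt_le_trans p1.
have gu := uniform_in_Lp_cst p1 fp.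
apply: (L0_eq_approx p1 p1) => e e0.
have [n0 h0] := average_riemann p1 gu t0 e0.
exists (riemann_average n0.+1 (fun=> f) t); split; first exact: h0.
rewrite /riemann_average sumr_const card_ord -[f *+ _]scaler_nat scalerA.
rewrite (_ : _ * _ = 1) ?scale1r ?subrr ?Lp_norm0 ?lee_fin ?(ltW e0)//.
by rewrite -(rmorph_nat (real_complex R)) -rmorphM/= mulVf// pnatr_eq0.
Qed.

End averages.

(** * Averages of a continuous semigroup *)

Section semigroup.
Import ComplexField.Normc.
Local Open Scope complex_scope.
Context d (Omega : measurableType d) (R : realType).
Variable mu : {measure set Omega -> \bar R}.
Hypothesis mu_gt0 : (0 < mu setT)%E.
Local Notation L0 := (L0 mu).
Variable T : R -> L0 -> L0.
Hypothesis T_semigroup : dunford_schwartz_semigroup T.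
Hypothesis T_continuous : strongly_continuous_L1 T.
Implicit Types (f g : L0) (r s t u c e : R).

Lemma sg_ds s : 0 <= s -> dunford_schwartz (T s).
Proof. by case: T_semigroup => h _ _; exact: h. Qed.

Lemma sg0 f : Lp 1 f -> T 0 f = f.
Proof. by case: T_semigroup => _ h _; exact: h. Qed.

Lemma sgD r s f : 0 <= r -> 0 <= s -> Lp 1 f -> T (r + s) f = T r (T s f).
Proof. by case: T_semigroup => _ _ h; exact: h. Qed.

Lemma sg_L1 s f : 0 <= s -> Lp 1 f -> Lp 1 (T s f).
Proof. by move=> s0; apply: ds_L1; exact: sg_ds. Qed.

Lemma sgC r s f : 0 <= r -> 0 <= s -> Lp 1 f -> T r (T s f) = T s (T r f).
Proof. by move=> r0 s0 f1; rewrite -!sgD// addrC. Qed.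

Lemma sg_iter h k f : 0 <= h -> Lp 1 f -> iter k (T h) f = T (k%:R * h) f.
Proof.
move=> h0 f1; elim: k => [|k ih]; first by rewrite mul0r sg0.
by rewrite iterS ih -sgD ?mulr_ge0// -natr1 mulrDl mul1r addrC.
Qed.

(** Continuity at 0 is enough: for s <= r, the difference [T r f - T s f] is the image under the
    contraction [T s] of [T (r - s) f - f]. *)
Lemma sg_uniform f : Lp 1 f -> uniform_in_Lp 1 (T ^~ f).
Proof.
move=> f1; split=> [r r0|e e0]; first exact: sg_L1.
have /cvge0P : Lp_norm 1 (T s f - T 0 f) @[s --> within [set s : R | 0 <= s] (nbhs (0 : R))] --> 0%E.
  exact: T_continuous.
move=> /(_ _)/(_ _ e0)[|delta /= delta0 hd]; first by move=> s; exact: Lp_norm_ge0.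
exists (delta / 2); first by rewrite divr_gt0.
suff main r s : 0 <= s -> s <= r -> `|r - s| <= delta / 2 ->
    (Lp_norm 1 (T r f - T s f)%R <= e%:E)%E.
  move=> r s r0 s0 rs; have [sr|/ltW sr] := leP s r; first exact: main.
  by rewrite Lp_normB//; apply: main => //; rewrite distrC.
move=> s0 sr rs; have r0 : 0 <= r - s by rewrite subr_ge0.
have -> : T r f = T s (T (r - s) f) by rewrite -sgD// addrC subrK.
rewrite -(dsB (sg_ds s0))//; last exact: sg_L1.
apply: le_trans (ds_norm1 (sg_ds s0) _) _; first by apply: LpB => //; exact: sg_L1.
rewrite -{2}(sg0 f1); apply: hd => //=.
rewrite sub0r normrN (le_lt_trans rs)// ltr_pdivrMr// mulr2n mulrDr mulr1 ltrDl//.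
Qed.

End semigroup.

(* Sealed: unification must not unfold one average to compare it with another. *)
HB.lock Definition sg_average d (Omega : measurableType d) (R : realType)
    (mu : {measure set Omega -> \bar R}) (T : R -> L0 mu -> L0 mu) (t : R) (f : L0 mu) : L0 mu :=
  average 1 (T ^~ f) t.

Section semigroup_averages.
Import ComplexField.Normc.
Local Open Scope complex_scope.
Context d (Omega : measurableType d) (R : realType).
Variable mu : {measure set Omega -> \bar R}.
Hypothesis mu_gt0 : (0 < mu setT)%E.
Local Notation L0 := (L0 mu).
Variable T : R -> L0 -> L0.
Hypothesis T_semigroup : dunford_schwartz_semigroup T.
Hypothesis T_continuous : strongly_continuous_L1 T.
Implicit Types (f g : L0) (r s t u c e : R).

Let le11 : 1 <= (1 : R). Proof. exact: lexx. Qed.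
Local Notation M := (sg_average T).
Let sgds := sg_ds T_semigroup.
Let sguniform := sg_uniform T_semigroup T_continuous.
Let sgL1 := sg_L1 T_semigroup.

Lemma sg_averageE t f : M t f = average 1 (T ^~ f) t.
Proof. by rewrite sg_average.unlock. Qed.

Lemma sg_average_riemann t f e : 0 < t -> Lp 1 f -> 0 < e ->
  exists n0, forall n, (n0 < n)%N ->
  (Lp_norm 1 (riemann_average n (T ^~ f) t - M t f)%R <= e%:E)%E.
Proof.
by move=> t0 f1 e0; rewrite sg_averageE; exact: average_riemann le11 (sguniform f1) t0 e0.
Qed.

Lemma sg_average_norm1 t f c : 0 < t -> Lp 1 f -> (Lp_norm 1 f <= c%:E)%E ->
  (Lp_norm 1 (M t f) <= c%:E)%E.
Proof.
move=> t0 f1 fc; rewrite sg_averageE; apply: average_norm => //; first exact: sguniform.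
by move=> r r0 _; apply: le_trans fc; apply: ds_norm1 => //; exact: sgds.
Qed.

Lemma sg_average_L1 t f : 0 < t -> Lp 1 f -> Lp 1 (M t f).
Proof. by move=> t0 f1; rewrite sg_averageE; apply: average_Lp => //; exact: sguniform. Qed.

Lemma sg_average_ae_le t f c : 0 < t -> Lp 1 f -> ae_le setT c f -> ae_le setT c (M t f).
Proof.
move=> t0 f1 fc; rewrite sg_averageE; apply: average_ae_le => //; first exact: sguniform.
by move=> r r0 _; apply: ds_ae_le => //; exact: sgds.
Qed.

(** Everything proved for a single Dunford-Schwartz operator, such as the hinge inequality and hence
    the contraction of L2, thus applies to the averages. *)
Lemma sg_average_ds t : 0 < t -> dunford_schwartz (M t).
Proof.
move=> t0; split.
- move=> a f g f1 g1.
  have uf := sguniform f1; have ug := sguniform g1.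
  have uaf := @uniform_in_LpZ _ _ _ _ _ a (T ^~ f) le11 uf.
  rewrite !sg_averageE -(@averageZ _ _ _ _ _ a (T ^~ f) _ le11 uf t0).
  rewrite -(@averageD _ _ _ _ _ (fun r => a *: T r f) (T ^~ g) _ le11 uaf ug t0).
  apply: (@eq_average _ _ _ _ 1) => //.
  + by move=> r r0; case: (sgds r0) => lin _ _; exact: lin.
  + by apply: sguniform; apply: LpD => //; exact: LpZ.
  + exact: (@uniform_in_LpD _ _ _ _ _ (fun r => a *: T r f) (T ^~ g)).
- move=> f f1; have /LpP[c c0 fc] := f1.
  rewrite -(@fineK _ (Lp_norm 1 f)); last by rewrite ge0_fin_numE ?Lp_norm_ge0.
  apply: sg_average_norm1 => //.
  by rewrite fineK// ge0_fin_numE ?Lp_norm_ge0.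
- move=> f f1 foo.
  rewrite -(@fineK _ (Lp_norm +oo f)); last by rewrite ge0_fin_numE ?Lp_norm_ge0.
  apply/Lp_norm_ooP => //; apply: sg_average_ae_le => //.
  apply/Lp_norm_ooP => //.
  by rewrite fineK// ge0_fin_numE ?Lp_norm_ge0.
Qed.

(** [S] passes through Riemann averages by linearity and through their L1 limits by contraction. It
    is used with [S] one of the [T s], then with [S] another average. *)
Lemma sg_average_comm S t f : dunford_schwartz S -> 0 < t -> Lp 1 f ->
  (forall r g, 0 <= r -> Lp 1 g -> S (T r g) = T r (S g)) ->
  S (M t f) = M t (S f).
Proof.
move=> dS t0 f1 ST; have Sf1 := ds_L1 dS f1.
apply: (L0_eq_approx le11 le11) => e e0.
have [n0 h0] := sg_average_riemann t0 f1 e0.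
have [n1 h1] := sg_average_riemann t0 Sf1 e0.
pose n := (maxn n0 n1).+1.
have nt0 (k : nat) : 0 <= k%:R * (t / n%:R) by rewrite mulr_ge0// divr_ge0// ltW.
have ra1 : Lp 1 (riemann_average n (T ^~ f) t).
  apply: LpZ => //; apply: (@Lp_sum _ _ _ _ _ _ (fun k => T (k%:R * (t / n%:R)) f)) => // k _.
  exact: sgL1.
have raS : S (riemann_average n (T ^~ f) t) = riemann_average n (T ^~ (S f)) t.
  rewrite /riemann_average dsZ//; last first.
    apply: (@Lp_sum _ _ _ _ _ _ (fun k => T (k%:R * (t / n%:R)) f)) => // k _.
    exact: sgL1.
  congr (_ *: _); rewrite (@ds_sum _ _ _ _ _ dS _ (fun k => T (k%:R * (t / n%:R)) f)).
    by apply: eq_bigr => k _; rewrite ST.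
  by move=> k _; exact: sgL1.
exists (riemann_average n (T ^~ (S f)) t); split; last first.
  by apply: h1; rewrite ltnS leq_maxr.
have M1 := sg_average_L1 t0 f1.
rewrite -raS -dsB//; apply: le_trans (ds_norm1 dS _) _; first exact: LpB.
by apply: h0; rewrite ltnS leq_maxl.
Qed.

Lemma sg_averageC s t f : 0 <= s -> 0 < t -> Lp 1 f -> T s (M t f) = M t (T s f).
Proof.
move=> s0 t0 f1; apply: sg_average_comm => //; first exact: sgds.
by move=> r g r0 g1; exact: (sgC T_semigroup).
Qed.

Lemma sg_average_averageC u t f : 0 < u -> 0 < t -> Lp 1 f -> M u (M t f) = M t (M u f).
Proof.
move=> u0 t0 f1; apply: sg_average_comm => //; first exact: sg_average_ds.
by move=> r g r0 g1; rewrite sg_averageC.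
Qed.

(** The integral over [0, t + s] is split at [t]: on the second grid, each node value is the image
    under [T t] of a node value for [0, s]. *)
Lemma sg_average_add t s f : 0 < t -> 0 < s -> Lp 1 f ->
  (t + s)%:C *: M (t + s) f = t%:C *: M t f + s%:C *: T t (M s f).
Proof.
move=> t0 s0 f1; have ts0 : 0 < t + s by rewrite addr_gt0.
have cancel (x : R) v : 0 < x -> x%:C *: ((x^-1)%:C *: v) = v :> L0.
  by move=> x0; rewrite scalerA -rmorphM/= mulfV ?gt_eqF// scale1r.
have [gf gc] := sguniform f1.
have M1 := sg_average_L1 s0 f1.
apply: (L0_eq_approx le11 le11) => e e0.
have [n0 h0] := bochner_integral_riemann2 (complete_norm_Lp mu le11) gf gc (ltW t0) (ltW s0) e0.
have e2 : 0 < e / 2 by rewrite divr_gt0.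
have [n1 h1] := sg_average_riemann t0 f1 (divr_gt0 e2 t0).
have [n2 h2] := sg_average_riemann s0 f1 (divr_gt0 e2 s0).
pose n := (maxn n0 (maxn n1 n2)).+1.
have nt (k : nat) : 0 <= k%:R * (t / n%:R) by rewrite mulr_ge0// divr_ge0// ltW.
have ns (k : nat) : 0 <= k%:R * (s / n%:R) by rewrite mulr_ge0// divr_ge0// ltW.
pose A := riemann_average n (T ^~ f) t; pose B := riemann_average n (T ^~ f) s.
have sum1 : Lp 1 (\sum_(k < n) T (k%:R * (s / n%:R)) f).
  by apply: (@Lp_sum _ _ _ _ _ _ (fun k => T (k%:R * (s / n%:R)) f)) => // k _; exact: sgL1.
have B1 : Lp 1 B by exact: LpZ.
have AE : t%:C *: A = \sum_(k < n) (t / n%:R)%:C *: T (k%:R * (t / n%:R)) f.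
  by rewrite -scaler_sumr /A /riemann_average scalerA -rmorphM.
have BE : s%:C *: T t B = \sum_(k < n) (s / n%:R)%:C *: T (t + k%:R * (s / n%:R)) f.
  rewrite -scaler_sumr /B /riemann_average dsZ//; last exact: sgds (ltW t0).
  rewrite scalerA -rmorphM/=; congr (_ *: _).
  rewrite (@ds_sum _ _ _ _ _ (sgds (ltW t0)) _ (fun k => T (k%:R * (s / n%:R)) f)).
    by apply: eq_bigr => k _; rewrite (sgD T_semigroup)// ltW.
  by move=> k _; exact: sgL1.
exists (t%:C *: A + s%:C *: T t B); split.
  rewrite AE BE sg_averageE /average cancel//.
  by apply: h0; rewrite ltnS leq_maxl.
rewrite opprD addrACA -!scalerBr; apply: le_trans (Lp_normD _ _ le11) _.
rewrite [in leRHS](splitr e) EFinD leeD//.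
  rewrite Lp_normZ// normcR gtr0_norm// muleC -lee_pdivlMr//.
  by rewrite -EFinM; apply: h1; rewrite ltnS !leq_max leqnn orbT.
rewrite Lp_normZ// normcR gtr0_norm// muleC -lee_pdivlMr// -EFinM -dsB//; last first.
  exact: sgds (ltW t0).
apply: le_trans (ds_norm1 (sgds (ltW t0)) _) _; first exact: LpB.
by apply: h2; rewrite ltnS !leq_max leqnn !orbT.
Qed.

(** The link between continuous and discrete time: averages at multiples of [h] are Cesaro means of
    [T h] started from [M h f]. *)
Lemma sg_average_iter h k f : 0 < h -> Lp 1 f ->
  k.+1%:R%:C *: M (k.+1%:R * h) f = \sum_(i < k.+1) iter i (T h) (M h f).
Proof.
move=> h0 f1; have M1 := sg_average_L1 h0 f1.
elim: k => [|k ih]; first by rewrite big_ord1/= mul1r scale1r.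
rewrite big_ord_recr/= -ih -[in RHS]iterS (sg_iter T_semigroup)//; last exact: ltW.
have kh : 0 < k.+1%:R * h by rewrite mulr_gt0.
have := sg_average_add kh h0 f1.
have -> : k.+1%:R * h + h = k.+2%:R * h by rewrite -[in RHS]natr1 mulrDl mul1r.
rewrite !rmorphM/= ![_ * h%:C]mulrC -!scalerA -scalerDr => /(congr1 (fun v => (h^-1)%:C *: v)).
have cancel v : (h^-1)%:C *: (h%:C *: v) = v :> L0.
  by rewrite scalerA -rmorphM/= mulVf ?gt_eqF// scale1r.
by rewrite !cancel.
Qed.

(** After rescaling to [0, 1], [M t f] is the mean of the values at times t x, and t x differs from
    s x by at most |t - s|. No loss occurs near time 0. *)
Lemma sg_average_uniform f e : Lp 1 f -> 0 < e -> exists2 delta, 0 < delta &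
  forall t s, 0 < t -> 0 < s -> `|t - s| <= delta ->
    (Lp_norm 1 (M t f - M s f)%R <= e%:E)%E.
Proof.
move=> f1 e0; have e30 : 0 < e / 3 by rewrite divr_gt0.
have [delta d0 hd] := (sguniform f1).2 _ e30.
exists delta => // t s t0 s0 ts.
have [n0 h0] := sg_average_riemann t0 f1 e30.
have [n1 h1] := sg_average_riemann s0 f1 e30.
pose n := (maxn n0 n1).+1.
have nR : 0 < n%:R :> R by rewrite ltr0n.
pose A := riemann_average n (T ^~ f) t; pose B := riemann_average n (T ^~ f) s.
have hA : (Lp_norm 1 (A - M t f)%R <= (e / 3)%:E)%E by apply: h0; rewrite ltnS leq_maxl.
have hB : (Lp_norm 1 (B - M s f)%R <= (e / 3)%:E)%E by apply: h1; rewrite ltnS leq_maxr.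
have hAB : (Lp_norm 1 (A - B)%R <= (e / 3)%:E)%E.
  (* The two Riemann averages have equally many nodes, so they are compared node by node. *)
  rewrite /A /B /riemann_average -scalerBr -sumrB Lp_normZ//.
  rewrite normcR gtr0_norm ?invr_gt0// muleC lee_pdivrMr// -EFinM [e / 3 * _]mulrC.
  apply: (@Lp_norm_sum_le _ _ _ _ _ _ _ (fun k => T (k%:R * (t / n%:R)) f - T (k%:R * (s / n%:R)) f)) => // k kn.
  apply: hd; rewrite ?mulr_ge0 ?divr_ge0 ?(ltW t0) ?(ltW s0)//.
  rewrite -mulrBr -mulrBl mulrCA normrM (le_trans _ ts)// ler_piMr//.
  by rewrite ger0_norm ?divr_ge0// ler_pdivrMr// mul1r ler_nat ltnW.
apply: le_trans (Lp_norm_triangle (M t f) A (M s f) le11) _.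
have hA2 := le_trans (Lp_norm_triangle A B (M s f) le11) (leeD hAB hB).
rewrite Lp_normB//; apply: le_trans (leeD hA hA2) _.
by rewrite -!EFinD lee_fin; lra.
Qed.

End semigroup_averages.

(** * Maximal inequality for the semigroup *)

Section maximal_inequality.
Import ComplexField.Normc.
Local Open Scope complex_scope.
Context d (Omega : measurableType d) (R : realType).
Variable mu : {measure set Omega -> \bar R}.
Hypothesis mu_gt0 : (0 < mu setT)%E.
Local Notation L0 := (L0 mu).
Variable T : R -> L0 -> L0.
Hypothesis T_semigroup : dunford_schwartz_semigroup T.
Hypothesis T_continuous : strongly_continuous_L1 T.
Implicit Types (f g : L0) (r s t u c e : R).
Local Notation M := (sg_average T).

Let le11 : 1 <= (1 : R). Proof. exact: lexx. Qed.
Let sgds := sg_ds T_semigroup.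
Let ML1 := sg_average_L1 T_semigroup T_continuous.
Let Mae_le := sg_average_ae_le mu_gt0 T_semigroup T_continuous.
Let MC := sg_average_averageC mu_gt0 T_semigroup T_continuous.
Let sguniform := sg_uniform T_semigroup T_continuous.

(** Splitting the integral over [0, r + u] at [r] and at [u] shows that both sides, multiplied by
    [u], are the integral over [u, u + r] minus that over [0, r]. *)
Lemma sg_average_coboundary r u f : 0 < r -> 0 < u -> Lp 1 f ->
  T r (M u f) - M u f = (r / u)%:C *: (T u (M r f) - M r f).
Proof.
move=> r0 u0 f1.
have E1 := sg_average_add T_semigroup T_continuous u0 r0 f1.
have E2 := sg_average_add T_semigroup T_continuous r0 u0 f1.
rewrite addrC E2 in E1.
have zE (A A' B B' : L0) : B + A' = A + B' -> A' - A = B' - B.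
  move=> E; have -> : A' = A + B' - B by rewrite -E addrC addKr.
  by rewrite addrAC [A + B']addrC addrK.
have {}E1 : u%:C *: (T r (M u f) - M u f) = r%:C *: (T u (M r f) - M r f).
  by rewrite !scalerBr; exact: zE.
have -> : (r / u)%:C = (u^-1)%:C * r%:C by rewrite -rmorphM mulrC.
rewrite -scalerA -E1 scalerA.
have -> : (u^-1)%:C * u%:C = 1 by rewrite -rmorphM mulVf ?gt_eqF.
by rewrite scale1r.
Qed.

Lemma sg_coboundary_uniform f : Lp 1 f -> uniform_in_Lp 1 (fun r => T r f - f).
Proof.
move=> f1; have gcst := uniform_in_Lp_cst le11 f1.
exact: (uniform_in_LpD le11 (sguniform f1) (uniform_in_LpN le11 gcst)).
Qed.

Lemma sg_average_averageB t u f : 0 < t -> 0 < u -> Lp 1 f ->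
  M u (M t f) - M u f = average 1 (fun r => T r (M u f) - M u f) t.
Proof.
move=> t0 u0 f1; have Mu1 := ML1 u0 f1; have guM := sguniform Mu1.
have gcst := uniform_in_Lp_cst le11 Mu1.
by rewrite (MC u0 t0 f1) [M t _]sg_averageE (averageB le11 guM gcst t0)
  (average_cst le11 Mu1 t0).
Qed.

(** The difference is the average over r in [0, t] of [T r (M u f) - M u f], each being r / u times
    a difference of two functions bounded by [c]. *)
Lemma sg_average_average_ae_le t u f c : 0 <= c -> 0 < t -> 0 < u -> Lp 1 f ->
  ae_le setT c f -> ae_le setT (2 * c * t / u) (M u (M t f) - M u f).
Proof.
move=> c0 t0 u0 f1 fc; have Mu1 := ML1 u0 f1.
rewrite (sg_average_averageB t0 u0 f1).
apply: (average_ae_le le11 (sg_coboundary_uniform Mu1) t0) => r r0 rt.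
have ctu : 0 <= 2 * c * t / u by rewrite divr_ge0 ?(ltW u0)// mulr_ge0 ?(ltW t0)// mulr_ge0.
have [->|rN0] := eqVneq r 0.
  by rewrite (sg0 T_semigroup Mu1) subrr; exact: ae_le0.
have {}r0 : 0 < r by rewrite lt_neqAle eq_sym rN0.
rewrite sg_average_coboundary//.
have Mr := Mae_le r0 f1 fc.
have := ae_leZ ((r / u)%:C) (ae_leB (ds_ae_le mu_gt0 (sgds (ltW u0)) (ML1 r0 f1) Mr) Mr).
apply: ae_leW => //; rewrite normcR ger0_norm ?divr_ge0 ?(ltW r0) ?(ltW u0)//.
rewrite mulrAC ler_pM2r ?invr_gt0// mulrC (_ : c + c = 2 * c); last by ring.
by rewrite ler_wpM2l// mulr_ge0.
Qed.

Lemma sg_average_average_norm1 t u f c : 0 < t -> 0 < u ->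
  (Lp_norm 1 f <= c%:E)%E ->
  (Lp_norm 1 (M u (M t f) - M u f)%R <= (2 * c * t / u)%:E)%E.
Proof.
move=> t0 u0 fc; have f1 : Lp 1 f by exact: LpW fc.
have Mu1 := ML1 u0 f1.
have c0 : 0 <= c by rewrite -lee_fin; apply: le_trans fc; exact: Lp_norm_ge0.
rewrite (sg_average_averageB t0 u0 f1).
apply: (average_norm le11 (sg_coboundary_uniform Mu1) t0) => r r0 rt.
have ctu : 0 <= 2 * c * t / u by rewrite divr_ge0 ?(ltW u0)// mulr_ge0 ?(ltW t0)// mulr_ge0.
have [->|rN0] := eqVneq r 0.
  by rewrite (sg0 T_semigroup Mu1) subrr Lp_norm0// lee_fin.
have {}r0 : 0 < r by rewrite lt_neqAle eq_sym rN0.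
rewrite sg_average_coboundary// Lp_normZ// normcR ger0_norm ?divr_ge0 ?(ltW r0) ?(ltW u0)//.
have Mr := sg_average_norm1 T_semigroup T_continuous r0 f1 fc.
have TMr := le_trans (ds_norm1 (sgds (ltW u0)) (ML1 r0 f1)) Mr.
have h : (Lp_norm 1 (T u (M r f) - M r f)%R <= c%:E + c%:E)%E.
  apply: le_trans (Lp_normD _ _ le11) _; rewrite Lp_normN//.
  exact: (leeD TMr Mr).
apply: (@le_trans _ _ ((r / u)%:E * (c%:E + c%:E))%E).
  by apply: lee_wpmul2l h; rewrite lee_fin divr_ge0// ltW.
rewrite -EFinD -EFinM lee_fin.
rewrite mulrAC ler_pM2r ?invr_gt0// mulrC (_ : c + c = 2 * c); last by ring.
by rewrite ler_wpM2l// mulr_ge0.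
Qed.

Lemma dyadic_approx t delta : 0 < t -> 0 < delta -> exists j k0 : nat,
  `|j.+1%:R * 2^-1 ^+ k0 - t| <= delta.
Proof.
move=> t0 d0; have m0 : 0 < Num.min t delta by rewrite lt_min t0.
have [k hk] := half_exp_small m0; set h := 2^-1 ^+ k in hk.
have h0 : 0 < h by rewrite exprn_gt0.
move: hk; rewrite le_min => /andP[ht hd].
have th : 1 <= t / h by rewrite ler_pdivlMr// mul1r.
have := truncn_itv (le_trans ler01 th); set j := Num.truncn _ => /andP[j1 j2].
have : (0 < j)%N by rewrite truncn_gt0.
case: j j1 j2 => // j j1 j2 _; exists j, k; rewrite -/h.
rewrite ler_pdivlMr// in j1; rewrite ltr_pdivrMr// -natr1 mulrDl mul1r in j2.
by rewrite ler_distlC; apply/andP; split; lra.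
Qed.

Lemma continuous_maximal_inequality f c lambda : (Lp_norm 1 f <= c%:E)%E ->
  0 < lambda -> exists E, [/\ measurable E, (mu E <= (c / lambda)%:E)%E &
    forall t, 0 < t -> ae_le (~` E) lambda (M t f)].
Proof.
move=> fc l0; have f1 : Lp 1 f by exact: LpW fc.
pose h k : R := 2^-1 ^+ k.
have h0 k : 0 < h k by rewrite exprn_gt0.
have /choice[E hE] k : exists E, [/\ measurable E, (mu E <= (c / lambda)%:E)%E &
    forall n, ae_le (~` E) (n%:R * lambda) (\sum_(i < n) iter i (T (h k)) (M (h k) f))].
  apply: discrete_maximal_inequality => //; first exact: sgds (ltW (h0 k)).
  exact: (sg_average_norm1 T_semigroup T_continuous (h0 k) f1 fc).
have mE k : measurable (E k) by have [] := hE k.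
exists (liminf_set E); split; first exact: measurable_liminf_set.
  by apply: measure_liminf_set_le => // k; have [] := hE k.
have grid k j : ae_le (~` E k) lambda (M (j.+1%:R * h k) f).
  have [_ _ hk] := hE k.
  have jR : 0 < j.+1%:R :> R by rewrite ltr0n.
  have e := sg_average_iter T_semigroup T_continuous j (h0 k) f1.
  have := ae_leZ ((j.+1%:R^-1)%:C) (hk j.+1).
  rewrite normcR gtr0_norm ?invr_gt0// mulrA mulVf ?gt_eqF// mul1r.
  rewrite -e scalerA (_ : _ * _ = 1) ?scale1r//.
  by rewrite -rmorphM mulVf ?gt_eqF.
(* A dyadic time of level [k0] lies on all finer grids, and a point outside the limit inferior
   avoids some [E k] with k >= k0. The grids are countable, so one null set serves them all. *)
have dyadic k0 j : ae_le (~` liminf_set E) lambda (M (j.+1%:R * h k0) f).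
  have : \forall x \ae mu, forall i, (~` E (k0 + i)%N) x -> modulus (M (j.+1%:R * h k0) f) x <= lambda.
    apply/ae_foralln => i.
    have eM : (j.+1 * 2 ^ i).-1.+1%:R * h (k0 + i)%N = j.+1%:R * h k0.
      rewrite prednK ?muln_gt0 ?expn_gt0// natrM natrX /h exprD.
      rewrite mulrACA -[RHS]mulr1; congr (_ * _).
      by rewrite -exprMn mulfV// expr1n.
    by have := grid (k0 + i)%N (j.+1 * 2 ^ i).-1; rewrite eM.
  apply: filterS => x hx /notin_liminf_set/(_ k0)[k k0k nEk].
  by apply: (hx (k - k0)%N); rewrite /= subnKC.
move=> t t0; apply: (ae_le_closed le11) => e e0.
have [delta d0 hd] := sg_average_uniform T_semigroup T_continuous f1 e0.
have [j [k0 jk]] := dyadic_approx t0 d0.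
exists (M (j.+1%:R * h k0) f); last exact: dyadic.
by apply: hd => //; rewrite mulr_gt0.
Qed.

End maximal_inequality.

(** * Contraction of L2, boundedness on Lp *)

Section hinge.
Import ComplexField.Normc.
Local Open Scope complex_scope.
Context d (Omega : measurableType d) (R : realType).
Variable mu : {measure set Omega -> \bar R}.
Local Notation L0 := (L0 mu).
Implicit Types (f g h u : L0) (p c lambda : R).

(** Comparing these integrals for all [lambda] is the increasing convex order on moduli; increasing
    convex functions such as powers are mixtures of such hinges. *)
Definition hinge f lambda := (\int[mu]_x (Num.max (modulus f x - lambda) 0)%:E)%E.

Lemma measurable_hinge f lambda :
  measurable_fun setT (fun x => Num.max (modulus f x - lambda) 0).
Proof.
by apply: measurable_maxr => //; apply: measurable_funB => //; exact: measurable_modulus.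
Qed.

(** Where |b| <= lambda, the excess of |a + b| over [lambda] is at most |a|. The images [a] and [b]
    are left abstract to serve both an operator on L1 and its extension. *)
Lemma hinge_le f g u a b lambda : 0 <= lambda ->
  (\forall x \ae mu, modulus g x = Num.max (modulus f x - lambda) 0) ->
  u = a + b -> (Lp_norm 1 a <= Lp_norm 1 g)%E -> ae_le setT lambda b ->
  (hinge u lambda <= hinge f lambda)%E.
Proof.
move=> l0 gE uE ag bl.
have -> : hinge f lambda = Lp_norm 1 g.
  rewrite Lp_norm1E; apply: ae_eq_integral => //.
  - exact/measurable_EFinP/measurable_hinge.
  - exact/measurable_EFinP/measurable_modulus.
  - by move: gE; apply: filterS => x -> _.
apply: le_trans ag; rewrite Lp_norm1E; apply: ae_le_integralr.
- exact: measurable_hinge.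
- exact: measurable_modulus.
- by move=> x; rewrite le_max lexx orbT.
- exact: modulus_ge0.
- move: bl (modulus_le_D a b); apply: filterS2 => x /(_ I) bx abx.
  rewrite ge_max modulus_ge0 andbT uE lerBlDr (le_trans abx)// lerD2l//.
Qed.

Lemma ds_hinge (S : L0 -> L0) f lambda : (0 < mu setT)%E -> dunford_schwartz S ->
  0 <= lambda -> Lp 1 f -> (hinge (S f) lambda <= hinge f lambda)%E.
Proof.
move=> mu0 dS l0 f1.
have [h [g [fE hE gE]]] := truncation f (measurable_cst lambda) (fun=> l0).
have g1 : Lp 1 g.
  apply: Lp_le_ae f1 => //; move: gE; apply: filterS => x ->.
  by rewrite ge_max modulus_ge0 andbT gerDl oppr_le0.
have h1 : Lp 1 h.
  apply: Lp_le_ae f1 => //; move: hE; apply: filterS => x ->.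
  by rewrite ge_min lexx.
apply: (hinge_le l0 gE (a := S g) (b := S h)).
- by rewrite fE addrC dsD.
- exact: ds_norm1.
- apply: ds_ae_le => //; move: hE; apply: filterS => x -> _.
  by rewrite ge_min lexx orbT.
Qed.

Lemma hinge_sum_le u f n (w theta : nat -> R) : (forall k, 0 <= w k) ->
  (forall k, (hinge u (theta k) <= hinge f (theta k))%E) ->
  (\int[mu]_x (\sum_(k < n) w k * Num.max (modulus u x - theta k) 0)%:E <=
   \int[mu]_x (\sum_(k < n) w k * Num.max (modulus f x - theta k) 0)%:E)%E.
Proof.
move=> w0 hw.
have intE v : (\int[mu]_x (\sum_(k < n) w k * Num.max (modulus v x - theta k) 0)%:E =
    \sum_(k < n) (w k)%:E * hinge v (theta k))%E.
  under eq_integral do rewrite -sumEFin.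
  rewrite ge0_integral_sum//; last 2 first.
  - move=> k; apply/measurable_EFinP; apply: measurable_funM => //.
    exact: measurable_hinge.
  - by move=> k x _; rewrite lee_fin mulr_ge0// le_max lexx orbT.
  apply: eq_bigr => k _; under eq_integral do rewrite EFinM.
  rewrite ge0_integralZl//.
  - exact/measurable_EFinP/measurable_hinge.
  - by move=> x _; rewrite lee_fin le_max lexx orbT.
  - by rewrite lee_fin.
by rewrite !intE; apply: lee_sum => k _; rewrite lee_wpmul2l ?lee_fin.
Qed.

End hinge.

(** * Powers as sums of hinge functions *)

Section hinge_scalar.
Context (R : realType).
Implicit Types (x e s theta : R).

(** Left Riemann sums, of mesh [e], of the formula for x^2 as twice the integral of (x - theta)^+.
    The integrand decreases, so they overestimate, by at most the first term. Replacing x by x - e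
    removes that term, whence the induction. *)
Lemma grid_hinge_bounds e x n : 0 < e -> 0 <= x -> 
  (x <= n%:R * e -> x ^+ 2 <= \sum_(k < n) 2 * e * Num.max (x - k%:R * e) 0) /\
  \sum_(k < n) 2 * e * Num.max (x - k%:R * e) 0 <= x ^+ 2 + 2 * e * x.
Proof.
move=> e0; elim: n x => [|n ih] x x0.
  rewrite big_ord0 mul0r; split; last by rewrite addr_ge0 ?sqr_ge0// mulr_ge0// mulr_ge0// ltW.
  move=> x0'; have -> : x = 0 by apply/eqP; rewrite eq_le x0' x0.
  by rewrite expr0n.
rewrite big_ord_recl/= mul0r subr0 max_l//.
have [xe|ex] := leP x e.
  rewrite big1 ?addr0 => [|k _]; last first.
    rewrite max_r ?mulr0// subr_le0 (le_trans xe)// ler_peMl ?(ltW e0)//.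
    by rewrite ler1n.
  split=> [_|]; last by rewrite lerDr sqr_ge0.
  rewrite expr2; apply: ler_wpM2r => //; lra.
have -> : \sum_(i < n) 2 * e * Num.max (x - (lift ord0 i)%:R * e) 0 =
    \sum_(k < n) 2 * e * Num.max ((x - e) - k%:R * e) 0.
  apply: eq_bigr => k _; congr (_ * Num.max _ 0).
  by rewrite lift0 -natr1 mulrDl mul1r; ring.
have xe0 : 0 <= x - e by rewrite subr_ge0 ltW.
have [h1 h2] := ih _ xe0; split.
  rewrite -natr1 mulrDl mul1r -lerBlDr => /h1 {}h1.
  nra.
nra.
Qed.

Let weight s theta k := (theta * 2 ^+ k) `^ s.

(** Terms with theta * 2^k >= x vanish, and below x the weights grow geometrically with ratio b =
    2^s, so they sum to at most b / (b - 1) times the last one. The induction carries along the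
    geometric bound in terms of the next weight. *)
Lemma dyadic_hinge_upper s theta x n : 0 < s -> 0 < theta -> 0 <= x ->
  let b := 2 `^ s in
  \sum_(k < n) (theta * 2 ^+ k) `^ s * Num.max (x - theta * 2 ^+ k) 0 <=
  b / (b - 1) * (x * x `^ s).
Proof.
move=> s0 t0 x0 /=; set b := 2 `^ s.
have b1 : 1 < b.
  have := @gt0_ltr_powR _ s s0 1 2; rewrite powR1 !nnegrE; apply => //.
  by rewrite ltr1n.
have b10 : 0 < b - 1 by rewrite subr_gt0.
have W0 k : 0 <= weight s theta k by exact: powR_ge0.
have WS k : weight s theta k.+1 = weight s theta k * b.
  rewrite /weight exprSr mulrA powRM//; first by rewrite mulr_ge0 ?exprn_ge0// ltW.
suff : \sum_(k < n) weight s theta k * Num.max (x - theta * 2 ^+ k) 0 <=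
      x * weight s theta n / (b - 1) /\
    \sum_(k < n) weight s theta k * Num.max (x - theta * 2 ^+ k) 0 <=
      b / (b - 1) * (x * x `^ s) by case.
elim: n => [|n [ih1 ih2]].
  rewrite big_ord0; split; first by rewrite divr_ge0 ?(ltW b10)// mulr_ge0.
  by rewrite mulr_ge0 ?divr_ge0 ?(ltW b10)// ?(le_trans ler01 (ltW b1))// mulr_ge0// powR_ge0.
rewrite big_ord_recr/=.
have term : weight s theta n * Num.max (x - theta * 2 ^+ n) 0 <= weight s theta n * x.
  by rewrite ler_wpM2l// ge_max x0 andbT gerDl oppr_le0 mulr_ge0 ?exprn_ge0 ?(ltW t0).
have step : x * weight s theta n / (b - 1) + weight s theta n * x =
    x * weight s theta n.+1 / (b - 1).
  by rewrite WS; field; rewrite gt_eqF.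
split; first by rewrite -step lerD.
have [xt|tx] := leP x (theta * 2 ^+ n).
  by rewrite max_r ?subr_le0// mulr0 addr0.
apply: le_trans (lerD ih1 term) _; rewrite step WS.
rewrite [leRHS]mulrC -!mulrA ler_wpM2l//.
rewrite ler_wpM2r ?mulr_ge0 ?invr_ge0 ?(ltW b10)// ?(le_trans ler01 (ltW b1))//.
apply: ge0_ler_powR; rewrite ?(ltW s0) ?nnegrE ?(ltW tx)//.
by rewrite mulr_ge0 ?exprn_ge0// ltW.
Qed.

(** One term is enough: if v <= x / 2 < 2 v for a dyadic v, its weight is at least (x / 4)^s and its
    hinge at least x / 2, which gives the constant. Such a v lies between 2^-n and 2^n once n is
    large. *)
Lemma dyadic_hinge_lower s x : 0 < s -> 0 < x -> exists n0, forall n, (n0 <= n)%N ->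
  4 `^ (- s) / 2 * (x * x `^ s) <= \sum_(k < n + n) (2^-1 ^+ n * 2 ^+ k) `^ s * Num.max (x - 2^-1 ^+ n * 2 ^+ k) 0.
Proof.
move=> s0 x0.
have x20 : 0 < x / 2 by rewrite divr_gt0.
have xi : 0 < x^-1 by rewrite invr_gt0.
have [n1 hn1] := half_exp_small x20; have [n2 hn2] := half_exp_small xi.
exists (maxn n1 n2) => n; rewrite geq_max => /andP[n1n n2n].
set theta := 2^-1 ^+ n.
have t0 : 0 < theta by rewrite exprn_gt0.
have tx : 2 * theta <= x.
  by rewrite mulrC -ler_pdivlMr//; apply: le_trans hn1; exact: half_exp_le.
have xt : x <= 2 ^+ n.
  rewrite -[leLHS]invrK -[leRHS]invrK lef_pV2 ?posrE ?invr_gt0 ?exprn_gt0//.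
  by rewrite -exprVn; apply: le_trans hn2; exact: half_exp_le.
have thetaM : theta * 2 ^+ n = 1 by rewrite /theta -exprMn mulVf// expr1n.
have ex : exists k, x < theta * 2 ^+ k.
  exists (n + n).+1; rewrite exprS exprD mulrCA [theta * _]mulrA thetaM mul1r.
  by apply: le_lt_trans xt _; rewrite mulr_natl mulr2n ltrDl exprn_gt0.
case: (ex_minnP ex) => k xk kmin.
have k2 : (1 < k)%N.
  rewrite ltnNge; apply/negP => k1; move: xk; apply/negP; rewrite -leNgt.
  apply: le_trans tx; rewrite mulrC ler_wpM2r ?(ltW t0)//.
  by case: k k1 {kmin} => [|[|]]//; rewrite ?expr0 ?expr1 ?ler1n.
case: k k2 xk kmin => [|[|k]]// _ xk kmin.
have kx : theta * 2 ^+ k.+1 <= x.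
  by rewrite leNgt; apply/negP => /kmin; rewrite ltnn.
have kn : (k < n + n)%N.
  rewrite ltnNge; apply/negP => nk.
  have : theta * 2 ^+ (n + n).+1 <= 2 ^+ n.
    apply: le_trans xt; apply: le_trans kx.
    by rewrite ler_wpM2l ?(ltW t0)// ler_eXn2l ?ltr1n.
  rewrite exprS exprD mulrCA [theta * _]mulrA thetaM mul1r leNgt.
  by rewrite mulr_natl mulr2n ltrDl exprn_gt0.
rewrite (bigD1 (Ordinal kn))//=; apply: ler_wpDr.
  by apply: sumr_ge0 => i _; rewrite mulr_ge0 ?powR_ge0// le_max lexx orbT.
set v := theta * 2 ^+ k.
have v0 : 0 < v by rewrite mulr_gt0// exprn_gt0.
have vx : 2 * v <= x by move: kx; rewrite exprS mulrCA.
have xv : x < 4 * v.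
  by move: xk; rewrite (_ : theta * _ = 4 * v)// /v !exprS; ring.
rewrite max_l; last by lra.
have -> : 4 `^ (- s) / 2 * (x * x `^ s) = (x / 4) `^ s * (x / 2).
  have e4 : (4^-1 : R) `^ s = 4 `^ (- s).
    by rewrite -[4^-1]powR_inv1// -powRrM mulN1r.
  by rewrite powRM ?(ltW x0)// e4; field.
apply: ler_pM; rewrite ?powR_ge0 ?divr_ge0 ?(ltW x0)//; last by lra.
by apply: ge0_ler_powR; rewrite ?(ltW s0) ?nnegrE ?divr_ge0 ?(ltW x0) ?(ltW v0)//; lra.
Qed.

End hinge_scalar.

Section hinge_contraction.
Import ComplexField.Normc.
Local Open Scope complex_scope.
Context d (Omega : measurableType d) (R : realType).
Variable mu : {measure set Omega -> \bar R}.
Local Notation L0 := (L0 mu).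
Implicit Types (f u : L0) (p c : R).

Lemma measurable_hinge_sum f n (w theta : nat -> R) : measurable_fun setT
  (fun x => \sum_(k < n) w k * Num.max (modulus f x - theta k) 0).
Proof.
apply: measurable_sum => k; apply: measurable_funM => //; exact: measurable_hinge.
Qed.

Lemma hinge_sum_ge0 f n (w theta : nat -> R) x : (forall k, 0 <= w k) ->
  0 <= \sum_(k < n) w k * Num.max (modulus f x - theta k) 0.
Proof. by move=> w0; apply: sumr_ge0 => k _; rewrite mulr_ge0// le_max lexx orbT. Qed.

Lemma integral_modulus2 f :
  (\int[mu]_x ((modulus f x) `^ 2)%:E = \int[mu]_x ((modulus f x) ^+ 2)%:E)%E.
Proof. by apply: eq_integral => x _; rewrite powR_mulrn// modulus_ge0. Qed.

(** Grid sums turn the hinge inequalities into one for squares with constant 1. The bound on [u]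
    makes a finite grid sufficient, and integrability of [f] makes the overestimate, linear in the
    modulus, tend to 0 with the mesh. *)
Lemma hinge_L2 u f c : 0 <= c -> Lp 1 f -> ae_le setT c u ->
  (forall lambda, 0 <= lambda -> (hinge u lambda <= hinge f lambda)%E) ->
  (Lp_norm 2%:E u <= Lp_norm 2%:E f)%E.
Proof.
move=> c0 f1 uc huf; have /LpP[a a0 fa] := f1.
rewrite !Lp_normE !integral_modulus2.
have q0 (v : L0) : (0 <= \int[mu]_x (modulus v x ^+ 2)%:E)%E.
  by apply: integral_ge0 => x _; rewrite lee_fin sqr_ge0.
apply: gt0_ler_poweR; rewrite ?in_itv/= ?q0 ?leey//.
apply/lee_addgt0Pr => e e0.
have a1 : 0 < a + 1 by rewrite ltr_wpDl.
(* This mesh makes the overestimate 2 b times the L1 norm of [f] at most [e]. *)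
pose b := e / (2 * (a + 1)); have b0 : 0 < b by rewrite divr_gt0// mulr_gt0.
pose n := (Num.truncn (c / b)).+1.
have cn : c <= n%:R * b by rewrite -ler_pdivrMr//; apply/ltW/truncnS_gt.
have mm (v : L0) : measurable_fun setT (fun x => modulus v x ^+ 2).
  by apply: measurable_funX; exact: measurable_modulus.
pose S (v : L0) x := \sum_(k < n) 2 * b * Num.max (modulus v x - k%:R * b) 0.
have mS v : measurable_fun setT (S v) by exact: (measurable_hinge_sum _ _ (fun=> 2 * b) (fun k => k%:R * b)).
have S0 v x : 0 <= S v x.
  by apply: (@hinge_sum_ge0 v n (fun=> 2 * b) (fun k => k%:R * b) x) => k; rewrite mulr_ge0// ltW.
apply: (@le_trans _ _ (\int[mu]_x (S u x)%:E)%E).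
  apply: ae_le_integralr => //; first by move=> x; rewrite sqr_ge0.
  move: uc; apply: filterS => x /(_ I) ux.
  apply: (grid_hinge_bounds n b0 (modulus_ge0 u x)).1; exact: le_trans cn.
apply: le_trans (hinge_sum_le n (w := fun=> 2 * b) (theta := fun k => k%:R * b) _ _) _.
- by move=> _; rewrite mulr_ge0// ltW.
- by move=> k; apply: huf; rewrite mulr_ge0// ltW.
apply: (@le_trans _ _ (\int[mu]_x (modulus f x ^+ 2)%:E + \int[mu]_x (2 * b * modulus f x)%:E)%E).
  apply: (@ae_le_integralD _ _ _ _ (S f)) => //.
  - by apply: measurable_funM => //; exact: measurable_modulus.
  - by move=> x; rewrite sqr_ge0.
  - by move=> x; rewrite mulr_ge0 ?modulus_ge0// mulr_ge0// ltW.
  - by apply: nearW => x; exact: (grid_hinge_bounds n b0 (modulus_ge0 f x)).2.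
rewrite leeD2l//; under eq_integral do rewrite EFinM.
rewrite ge0_integralZl//; last 3 first.
- exact/measurable_EFinP/measurable_modulus.
- by move=> x _; rewrite lee_fin modulus_ge0.
- by rewrite lee_fin mulr_ge0// ltW.
rewrite -Lp_norm1E; apply: (@le_trans _ _ ((2 * b)%:E * a%:E)%E).
  by rewrite lee_wpmul2l// lee_fin mulr_ge0// ltW.
rewrite -EFinM lee_fin /b (_ : 2 * (e / (2 * (a + 1))) * a = e * (a / (a + 1))).
  by rewrite ler_piMr ?(ltW e0)// ler_pdivrMr// mul1r lerDl.
by field; rewrite gt_eqF.
Qed.

(** Both p-th powers are compared with the same dyadic sums of hinges, from below for [u] and from
    above for [f]; the constant is the quotient of the two comparison constants. *)
Lemma hinge_Lp_integral p : 1 < p -> exists2 C, 0 < C & forall u f,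
  (forall lambda, 0 < lambda -> (hinge u lambda <= hinge f lambda)%E) ->
  (\int[mu]_x ((modulus u x) `^ p)%:E <= C%:E * \int[mu]_x ((modulus f x) `^ p)%:E)%E.
Proof.
move=> p1; have s0 : 0 < p - 1 by rewrite subr_gt0.
have p0 : 0 < p by apply: lt_trans p1.
pose b : R := 2 `^ (p - 1); pose C1 := b / (b - 1); pose c2 : R := 4 `^ (- (p - 1)) / 2.
have b1 : 1 < b.
  have := @gt0_ltr_powR _ (p - 1) s0 1 2; rewrite powR1 !nnegrE; apply => //.
  by rewrite ltr1n.
have C10 : 0 < C1 by rewrite divr_gt0 ?subr_gt0// (lt_trans ltr01 b1).
have c20 : 0 < c2 by rewrite divr_gt0 ?powR_gt0.
exists (C1 / c2); first by rewrite divr_gt0.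
move=> u f huf.
pose theta n k : R := 2^-1 ^+ n * 2 ^+ k.
have theta0 n k : 0 < theta n k by rewrite mulr_gt0// exprn_gt0.
pose w n k := theta n k `^ (p - 1).
have w0 n k : 0 <= w n k by exact: powR_ge0.
pose S n (v : L0) x := \sum_(k < n + n) w n k * Num.max (modulus v x - theta n k) 0.
have mS n v : measurable_fun setT (S n v) by exact: measurable_hinge_sum.
have S0 n v x : 0 <= S n v x by exact: hinge_sum_ge0.
have xp (v : L0) x : modulus v x * modulus v x `^ (p - 1) = modulus v x `^ p.
  by rewrite mulr_powRB1// modulus_ge0.
have mp (v : L0) : measurable_fun setT (fun x => modulus v x `^ p) by exact: measurable_modulus_powR.
have upper n : (\int[mu]_x (S n u x)%:E <= C1%:E * \int[mu]_x (modulus f x `^ p)%:E)%E.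
  apply: le_trans (hinge_sum_le _ (w0 n) (fun k => huf _ (theta0 n k))) _.
  rewrite -ge0_integralZl//; last 3 first.
  - exact/measurable_EFinP.
  - by move=> x _; rewrite lee_fin powR_ge0.
  - by rewrite lee_fin ltW.
  apply: (@ae_le_integralr _ _ _ _ (S n f) (fun x => C1 * modulus f x `^ p)) => //.
  - exact: measurable_funM.
  - by move=> x; rewrite mulr_ge0 ?powR_ge0 ?(ltW C10).
  - apply: nearW => x; rewrite -xp.
    by apply: dyadic_hinge_upper; rewrite ?exprn_gt0 ?modulus_ge0.
(* The lower comparison holds from a rank that depends on the point, so it is recovered in the limit
   inferior. *)
have fatouS : (\int[mu]_x limn_einf (fun n => (S n u x)%:E) <=
    C1%:E * \int[mu]_x (modulus f x `^ p)%:E)%E.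
  have mSE n : measurable_fun setT (fun x => (S n u x)%:E) by exact/measurable_EFinP.
  have := fatou mu measurableT mSE (fun n x _ => S0 n u x : (0 <= (S n u x)%:E)%E).
  move/le_trans; apply; rewrite limn_einf_lim; apply: lime_le; first exact: is_cvg_einfs.
  apply: nearW => n; apply: le_trans (upper n).
  by apply: ereal_inf_lbound; exists n => /=.
have -> : (C1 / c2)%:E = ((c2^-1)%:E * C1%:E)%E by rewrite -EFinM; congr EFin; exact: mulrC.
rewrite -muleA (lee_pdivlMl _ _ c20); apply: le_trans fatouS.
rewrite -ge0_integralZl//; last 3 first.
- exact/measurable_EFinP.
- by move=> x _; rewrite lee_fin powR_ge0.
- by rewrite lee_fin ltW.
have li x : (c2%:E * (modulus u x `^ p)%:E <= limn_einf (fun n => (S n u x)%:E))%E.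
  have liE n0 r : (forall n, (n0 <= n)%N -> r <= S n u x) ->
      (r%:E <= limn_einf (fun n => (S n u x)%:E))%E.
    move=> h; rewrite limn_einf_lim; apply: lime_ge; first exact: is_cvg_einfs.
    exists n0 => // n /= n0n; apply: le_ereal_inf_tmp => _ [m /= nm <-].
    by rewrite lee_fin h// (leq_trans n0n).
  rewrite -EFinM; have [ux0|ux0] := eqVneq (modulus u x) 0.
    by apply: (liE 0%N) => n _; rewrite ux0 powR0 ?gt_eqF// mulr0.
  have {}ux0 : 0 < modulus u x by rewrite lt_neqAle eq_sym ux0 modulus_ge0.
  have [n0 hn0] := dyadic_hinge_lower s0 ux0.
  by apply: (liE n0) => n /hn0; rewrite xp.
apply: ge0_le_integral => //.
- by move=> x _; rewrite -EFinM lee_fin mulr_ge0 ?powR_ge0// ltW.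
- by apply: emeasurable_funM => //; exact/measurable_EFinP.
- rewrite (_ : (fun x => _) = (fun x => - limn_esup (fun n => - (S n u x)%:E))%E); last first.
    by apply/funext => x; rewrite [limn_esup _](limn_esupN (fun n => (S n u x)%:E)) oppeK.
  apply: measurableT_comp => //; apply: measurable_fun_limn_esup => n.
  by apply: measurableT_comp => //; exact/measurable_EFinP.
Qed.

Lemma hinge_Lp p : 1 < p -> exists2 C, 0 < C & forall u f c, 0 <= c ->
  (forall lambda, 0 < lambda -> (hinge u lambda <= hinge f lambda)%E) ->
  (Lp_norm p%:E f <= c%:E)%E -> (Lp_norm p%:E u <= (C * c)%:E)%E.
Proof.
move=> p1; have p0 : 0 < p by apply: lt_trans p1.
have [C C0 hC] := hinge_Lp_integral p1.
exists (C `^ p^-1); first exact: powR_gt0.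
move=> u f c c0 huf /(Lp_norm_leP _ p0 c0) fc.
apply/Lp_norm_leP => //; first by rewrite mulr_ge0 ?powR_ge0.
rewrite powRM ?powR_ge0// -powRrM mulVf ?gt_eqF// powRr1 ?(ltW C0)// EFinM.
apply: le_trans (hC _ _ huf) _; rewrite lee_wpmul2l// lee_fin ltW//.
Qed.

End hinge_contraction.

(** * Mean ergodic theorem *)

Section L2_norm.
Import ComplexField.Normc.
Local Open Scope complex_scope.
Context d (Omega : measurableType d) (R : realType).
Variable mu : {measure set Omega -> \bar R}.
Local Notation L0 := (L0 mu).
Implicit Types (f g h : L0) (a c : R).

Definition norm2 f : R := fine (Lp_norm 2%:E f).

Let le12 : 1 <= (2 : R). Proof. by rewrite ler1n. Qed.

Lemma norm2_ge0 f : 0 <= norm2 f.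
Proof. by rewrite fine_ge0// Lp_norm_ge0. Qed.

Lemma norm2K f : Lp 2%:E f -> (norm2 f)%:E = Lp_norm 2%:E f.
Proof. by move=> f2; rewrite fineK// ge0_fin_numE// Lp_norm_ge0. Qed.

Lemma norm2_sqr f : Lp 2%:E f ->
  ((norm2 f ^+ 2)%:E = \int[mu]_x (modulus f x ^+ 2)%:E)%E.
Proof.
move=> f2; rewrite -integral_modulus2 -powR_mulrn ?norm2_ge0// -poweR_EFin norm2K//.
rewrite Lp_normE -poweRrM mulVf// poweRe1//.
by apply: integral_ge0 => x _; rewrite lee_fin powR_ge0.
Qed.

Lemma norm2D f g : Lp 2%:E f -> Lp 2%:E g -> norm2 (f + g) <= norm2 f + norm2 g.
Proof.
move=> f2 g2; rewrite -lee_fin EFinD !norm2K//; last exact: LpD.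
exact: Lp_normD.
Qed.

Lemma norm2_le f c : (Lp_norm 2%:E f <= c%:E)%E -> norm2 f <= c.
Proof. by move=> h; rewrite -lee_fin norm2K//; exact: LpW h. Qed.

Lemma norm2N f : norm2 (- f) = norm2 f.
Proof. by rewrite /norm2 Lp_normN. Qed.

Lemma norm2_parallelogram f g : Lp 2%:E f -> Lp 2%:E g ->
  norm2 (f + g) ^+ 2 + norm2 (f - g) ^+ 2 = 2 * norm2 f ^+ 2 + 2 * norm2 g ^+ 2.
Proof.
move=> f2 g2; have fg2 := LpD le12 f2 g2; have fg2' := LpB le12 f2 g2.
apply: EFin_inj; rewrite !EFinD (EFinM 2 (norm2 f ^+ 2)) (EFinM 2 (norm2 g ^+ 2)) !norm2_sqr//.
have m2 (h : L0) : measurable_fun setT (fun x => (modulus h x ^+ 2)%:E).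
  by apply/measurable_EFinP; apply: measurable_funX; exact: measurable_modulus.
have p2 (h : L0) x : (0 <= (modulus h x ^+ 2)%:E)%E by rewrite lee_fin sqr_ge0.
rewrite -ge0_integralD// -!ge0_integralZl//.
rewrite -ge0_integralD//; last 4 first.
- by move=> x _; rewrite mule_ge0.
- by apply: emeasurable_funM.
- by move=> x _; rewrite mule_ge0.
- by apply: emeasurable_funM.
apply: ae_eq_integral => //.
- by apply: emeasurable_funD.
- by apply: emeasurable_funD; apply: emeasurable_funM.
move: (L0_DE f g) (L0_BE f g); apply: filterS2 => x /(_ I) eD /(_ I) eB _.
by rewrite -!EFinM -!EFinD /modulus eD eB normc_parallelogram.
Qed.

(** Pointwise |f|^p <= c^(p - 1) |f|. The last hypothesis is left as an inequality between powers so
    that each use can choose a convenient [e]. *)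
Lemma Lp_interpolation (p : R) f a c (e : R) : 1 <= p -> 0 <= e -> 0 <= c ->
  ae_le setT c f -> (Lp_norm 1 f <= a%:E)%E -> c `^ (p - 1) * a <= e `^ p ->
  (Lp_norm p%:E f <= e%:E)%E.
Proof.
move=> p1 e0 c0 fc fa cae; have p0 : 0 < p by apply: lt_le_trans p1.
apply/Lp_norm_leP => //; have mm := measurable_modulus f.
apply: (@le_trans _ _ (\int[mu]_x (c `^ (p - 1) * modulus f x)%:E)%E).
  apply: ae_le_integralr => //.
  - exact: measurable_modulus_powR.
  - exact: measurable_funM.
  - by move=> x; rewrite powR_ge0.
  - by move=> x; rewrite mulr_ge0 ?modulus_ge0 ?powR_ge0.
  - move: fc; apply: filterS => x /(_ I) h.
    rewrite -(@mulr_powRB1 _ (modulus f x) p) ?modulus_ge0// mulrC.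
    rewrite ler_wpM2r ?modulus_ge0//.
    by apply: ge0_ler_powR; rewrite ?subr_ge0 ?nnegrE ?modulus_ge0.
under eq_integral do rewrite EFinM.
rewrite ge0_integralZl//; last 3 first.
- exact/measurable_EFinP.
- by move=> x _; rewrite lee_fin modulus_ge0.
- by rewrite lee_fin powR_ge0.
rewrite -Lp_norm1E; apply: (@le_trans _ _ ((c `^ (p - 1) * a)%:E)).
  by rewrite EFinM lee_wpmul2l// lee_fin powR_ge0.
by rewrite lee_fin.
Qed.

Lemma L2_interpolation f a c : 0 <= a -> 0 <= c -> ae_le setT c f ->
  (Lp_norm 1 f <= a%:E)%E -> (Lp_norm 2%:E f <= (Num.sqrt (c * a))%:E)%E.
Proof.
move=> a0 c0 fc fa; apply: (Lp_interpolation le12 (sqrtr_ge0 _) c0 fc fa).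
rewrite powR_mulrn ?sqrtr_ge0// sqr_sqrtr ?mulr_ge0//.
by rewrite (_ : 2 - 1 = 1) ?powRr1//; lra.
Qed.

End L2_norm.

Section mean_ergodic.
Import ComplexField.Normc.
Local Open Scope complex_scope.
Context d (Omega : measurableType d) (R : realType).
Variable mu : {measure set Omega -> \bar R}.
Hypothesis mu_gt0 : (0 < mu setT)%E.
Local Notation L0 := (L0 mu).
Variable T : R -> L0 -> L0.
Hypothesis T_semigroup : dunford_schwartz_semigroup T.
Hypothesis T_continuous : strongly_continuous_L1 T.
Implicit Types (f g h : L0) (r s t u v w c e : R).
Local Notation M := (sg_average T).

Let le12 : 1 <= (2 : R). Proof. by rewrite ler1n. Qed.
Let ML1 := sg_average_L1 T_semigroup T_continuous.
Let Mae_le := sg_average_ae_le mu_gt0 T_semigroup T_continuous.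
Let Mds := sg_average_ds mu_gt0 T_semigroup T_continuous.

Definition bounded_L1 f := Lp 1 f /\ exists2 c, 0 <= c & ae_le setT c f.

Let bounded_L2 f : bounded_L1 f -> Lp 2%:E f.
Proof.
move=> [/LpP[a a0 fa] [c c0 fc]].
exact: LpW (L2_interpolation a0 c0 fc fa).
Qed.

Lemma bounded_L1D f g : bounded_L1 f -> bounded_L1 g -> bounded_L1 (f + g).
Proof.
move=> [f1 [c c0 fc]] [g1 [c' c0' gc]]; split; first exact: LpD.
by exists (c + c'); [rewrite addr_ge0|exact: ae_leD].
Qed.

Lemma bounded_L1N f : bounded_L1 f -> bounded_L1 (- f).
Proof.
by move=> [f1 [c c0 fc]]; split; [exact: LpN|exists c => //; exact: ae_leN].
Qed.

Lemma bounded_L1_average t f : 0 < t -> bounded_L1 f -> bounded_L1 (M t f).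
Proof.
by move=> t0 [f1 [c c0 fc]]; split; [exact: ML1|exists c => //; exact: Mae_le].
Qed.

Lemma sg_average_norm2 t f : 0 < t -> bounded_L1 f -> norm2 (M t f) <= norm2 f.
Proof.
move=> t0 bf; have [f1 [c c0 fc]] := bf.
apply: norm2_le; rewrite norm2K; last exact: bounded_L2.
apply: hinge_L2 (Mae_le t0 f1 fc) _ => // lambda l0.
exact: ds_hinge (Mds t0) l0 f1.
Qed.

(* The squared distance of two late averages is controlled, through the
   parallelogram law, by the infimum [m] of [norm2 (M t f)]: all late averages
   have norm close to [m], and so has the midpoint of any two of them, because
   averaging it again yields nearly [M w f]. *)
Lemma mean_ergodic_cauchy f e : bounded_L1 f -> 0 < e ->
  exists2 t0, 0 < t0 & forall u v, t0 <= u -> t0 <= v ->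
    norm2 (M u f - M v f) ^+ 2 <= e.
Proof.
move=> bf e0; have [f1 [c c0 fc]] := bf; have /LpP[a a0 fa] := f1.
pose B := 2 * Num.sqrt (c * a).
have B0 : 0 <= B by rewrite mulr_ge0// sqrtr_ge0.
(* Both the uniform and the L1 bound on this difference carry the factor 2 t / u, hence so does
   their geometric mean, the L2 bound. *)
have cob t u : 0 < t -> 0 < u -> norm2 (M u (M t f) - M u f) <= B * t / u.
  move=> t0 u0; apply: norm2_le.
  have h1 := sg_average_average_ae_le mu_gt0 T_semigroup T_continuous c0 t0 u0 f1 fc.
  have h2 := sg_average_average_norm1 mu_gt0 T_semigroup T_continuous t0 u0 fa.
  have k0 x : 0 <= x -> 0 <= 2 * x * t / u.
    by move=> x0; rewrite divr_ge0 ?(ltW u0)// mulr_ge0 ?(ltW t0)// mulr_ge0.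
  apply: le_trans (L2_interpolation (k0 _ a0) (k0 _ c0) h1 h2) _.
  rewrite lee_fin (_ : _ * _ = (2 * t / u) ^+ 2 * (c * a)); last by ring.
  rewrite sqrtrM ?sqr_ge0// sqrtr_sqr ger0_norm.
    by rewrite le_eqVlt /B; apply/orP; left; apply/eqP; ring.
  by rewrite divr_ge0 ?(ltW u0)// mulr_ge0// ltW.
have bM t : 0 < t -> bounded_L1 (M t f) by move=> t0; exact: bounded_L1_average.
have M2 t : 0 < t -> Lp 2%:E (M t f) by move=> t0; exact: bounded_L2 (bM _ t0).
have MM2 t u : 0 < t -> 0 < u -> Lp 2%:E (M u (M t f) - M u f).
  by move=> t0 u0; apply: LpB => //; [exact: bounded_L2 (bounded_L1_average u0 (bM _ t0))|exact: M2].
pose A := [set norm2 (M t f) | t in [set t : R | 0 < t]].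
have Alb : has_lbound A by exists 0 => _ [t _ <-]; exact: norm2_ge0.
have Ainf : has_inf A by split=> //; exists (norm2 (M 1 f)); exists 1 => //=.
pose m := inf A.
have m0 : 0 <= m by apply: lb_le_inf => [|_ [t _ <-]]; [exact: Ainf.1|exact: norm2_ge0].
have mle t : 0 < t -> m <= norm2 (M t f) by move=> t0; apply: inf_lbound => //; exists t.
(* The parallelogram law will bound the squared distance by 4 (m + 2 eta)^2 - 4 m^2 = 16 eta m + 16
   eta^2, at most 16 eta (m + 1) since eta <= 1. *)
pose eta := Num.min 1 (e / (16 * (m + 1))).
have m16 : 0 < 16 * (m + 1) by rewrite mulr_gt0// ltr_wpDl.
have eta0 : 0 < eta by rewrite lt_min ltr01 divr_gt0.
have eta1 : eta <= 1 by rewrite ge_min lexx.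
have etae : eta * (16 * (m + 1)) <= e by rewrite -ler_pdivlMr// ge_min lexx orbT.
have [_ [t /= t0 <-] tm] := inf_adherent eta0 Ainf.
have {}tm : norm2 (M t f) <= m + eta by exact: ltW.
pose t1 := B * t / eta + 1.
have t10 : 0 < t1 by rewrite ltr_wpDl// divr_ge0 ?(ltW eta0)// mulr_ge0// ltW.
have late u : t1 <= u -> norm2 (M u f) <= m + 2 * eta.
  move=> t1u; have u0 : 0 < u by apply: lt_le_trans t1u.
  rewrite -[M u f](subKr (M u (M t f))).
  apply: le_trans (norm2D _ _) _.
  - exact: bounded_L2 (bounded_L1_average u0 (bM _ t0)).
  - by apply: LpN => //; exact: MM2.
  rewrite norm2N; have h1 := sg_average_norm2 u0 (bM _ t0).
  have h2 : B * t / u <= eta.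
    rewrite ler_pdivrMr// [eta * u]mulrC -ler_pdivrMr//; apply: le_trans t1u.
    by rewrite lerDl.
  apply: le_trans (lerD (le_trans h1 tm) (le_trans (cob _ _ t0 u0) h2)) _.
  by rewrite -addrA lerD2l mulrDl mul1r.
exists t1 => // u v t1u t1v.
have u0 : 0 < u by apply: lt_le_trans t1u.
have v0 : 0 < v by apply: lt_le_trans t1v.
have bh : bounded_L1 (M u f + M v f) by apply: bounded_L1D; exact: bM.
(* [M w] contracts L2 and sends the sum to twice [M w f] up to B (u + v) / w; as [w] is free, this
   error can be made smaller than any [delta]. *)
have mid : 2 * m <= norm2 (M u f + M v f).
  apply/ler_addgt0Pr => delta d0.
  pose w := B * (u + v) / delta + 1.
  have Buv : 0 <= B * (u + v) by rewrite mulr_ge0// addr_ge0// ltW.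
  have w0 : 0 < w by rewrite ltr_wpDl// divr_ge0// ltW.
  have wd : B * (u + v) / w <= delta.
    by rewrite ler_pdivrMr// [delta * w]mulrC -ler_pdivrMr// lerDl.
  have Mh : M w (M u f + M v f) = M w (M u f) + M w (M v f).
    by rewrite (dsD (Mds w0))//; exact: ML1.
  have two : norm2 (M w f + M w f) = 2 * norm2 (M w f).
    rewrite -[M w f + M w f]mulr2n -scaler_nat /norm2 Lp_normZ//.
    by rewrite -(rmorph_nat (real_complex R)) normcR ger0_norm// fineM// -norm2K//; exact: M2.
  have : norm2 (M w f + M w f) <= norm2 (M w (M u f + M v f)) +
      (norm2 (M w (M u f) - M w f) + norm2 (M w (M v f) - M w f)).
    rewrite -(norm2N (M w (M u f) - M w f)) -(norm2N (M w (M v f) - M w f)).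
    have E : M w f + M w f = M w (M u f + M v f) + (- (M w (M u f) - M w f) - (M w (M v f) - M w f)).
      by rewrite Mh !opprB addrACA [_ + (M w f - _)]addrC subrK [_ + (M w f - _)]addrC subrK.
    rewrite {1}E; apply: le_trans (norm2D _ _) _.
    - exact: bounded_L2 (bounded_L1_average w0 bh).
    - by apply: LpB => //; [apply: LpN => //|]; exact: MM2.
    - by rewrite lerD2l norm2D//; apply: LpN => //; exact: MM2.
  rewrite two => h; apply: (@le_trans _ _ (2 * norm2 (M w f))).
    by rewrite ler_wpM2l// mle.
  apply: le_trans h (lerD (sg_average_norm2 w0 bh) _).
  apply: le_trans (lerD (cob _ _ u0 w0) (cob _ _ v0 w0)) _.
  by rewrite -mulrDl -mulrDr.
have := norm2_parallelogram (M2 _ u0) (M2 _ v0).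
have := late _ t1u; have := late _ t1v.
have := norm2_ge0 (M u f); have := norm2_ge0 (M v f).
move: mid; move: (norm2 (M u f + M v f)) (norm2_ge0 (M u f + M v f)) (norm2 (M u f - M v f)).
move: (norm2 (M u f)) (norm2 (M v f)) => x y z z0 z' mid y0 x0 ym xm par.
have x2 : x ^+ 2 <= (m + 2 * eta) ^+ 2 by rewrite ler_pXn2r ?nnegrE// (le_trans x0).
have y2 : y ^+ 2 <= (m + 2 * eta) ^+ 2 by rewrite ler_pXn2r ?nnegrE// (le_trans x0).
have mid2 : (2 * m) ^+ 2 <= z ^+ 2 by rewrite ler_pXn2r ?nnegrE// mulr_ge0.
have : 16 * eta * m + 16 * eta ^+ 2 <= e.
  have : eta ^+ 2 <= eta by rewrite expr2 ler_piMr// ltW.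
  by move: etae; lra.
move: x2 y2 mid2 par; rewrite !exprMn sqrrD; lra.
Qed.

(** The part of [f] below [lambda] stays below it under averaging. The rest satisfies lambda |hi| <=
    |f|^2, so its L1 norm is at most the squared L2 norm over [lambda], and the L1 inequality
    divides by [lambda] once more. *)
Lemma weak_maximal_inequality2 f lambda : bounded_L1 f -> 0 < lambda ->
  exists E, [/\ measurable E, (mu E <= (norm2 f ^+ 2 / lambda ^+ 2)%:E)%E &
    forall t, 0 < t -> ae_le (~` E) (2 * lambda) (M t f)].
Proof.
move=> bf l0; have [f1 _] := bf.
have [lo [hi [fE loE hiE]]] := truncation f (measurable_cst lambda) (fun=> ltW l0).
have lo1 : Lp 1 lo.
  apply: Lp_le_ae f1 => //; move: loE; apply: filterS => x ->.
  by rewrite ge_min lexx.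
have hi1 : Lp 1 hi.
  apply: Lp_le_ae f1 => //; move: hiE; apply: filterS => x ->.
  by rewrite ge_max modulus_ge0 andbT gerDl oppr_le0 ltW.
have hiN : (Lp_norm 1 hi <= (norm2 f ^+ 2 / lambda)%:E)%E.
  rewrite EFinM lee_pdivlMr// norm2_sqr; last exact: bounded_L2.
  rewrite Lp_norm1E muleC -ge0_integralZl//; last 3 first.
  - exact/measurable_EFinP/measurable_modulus.
  - by move=> x _; rewrite lee_fin modulus_ge0.
  - by rewrite lee_fin ltW.
  apply: (@ae_le_integralr _ _ _ _ (fun x => lambda * modulus hi x)).
  - by apply: measurable_funM => //; exact: measurable_modulus.
  - by apply: measurable_funX; exact: measurable_modulus.
  - by move=> x; rewrite mulr_ge0 ?modulus_ge0// ltW.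
  - by move=> x; rewrite sqr_ge0.
  - move: hiE; apply: filterS => x ->; rewrite maxr_pMr ?(ltW l0)// mulr0.
    rewrite ge_max sqr_ge0 andbT /cst; move: (modulus f x) => y.
    have := sqr_ge0 (y - lambda); have := sqr_ge0 y; have := sqr_ge0 lambda.
    by rewrite sqrrB; lra.
have [E [mE Ele hE]] := continuous_maximal_inequality mu_gt0 T_semigroup T_continuous hiN l0.
exists E; split => //; first by rewrite expr2 invfM mulrA.
move=> t t0; rewrite fE (dsD (Mds t0))// (_ : 2 * lambda = lambda + lambda); last by ring.
apply: ae_leD; last exact: hE.
have : ae_le setT lambda (M t lo).
  apply: Mae_le => //; move: loE; apply: filterS => x -> _.
  by rewrite ge_min lexx orbT.
exact: ae_leW.
Qed.

End mean_ergodic.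

(** * Almost uniform convergence *)

Section bounded_approximation.
Import ComplexField.Normc.
Local Open Scope complex_scope.
Context d (Omega : measurableType d) (R : realType).
Variable mu : {measure set Omega -> \bar R}.
Local Notation L0 := (L0 mu).
Implicit Types (f g h : L0) (p c a e : R).

(** Where |f| > delta, the excess |f| - delta is at most |f|, hence at most |f|^p / delta^(p -
    1). *)
Lemma high_part_L1 p f g delta : 1 <= p -> 0 < delta -> Lp p%:E f ->
  (\forall x \ae mu, modulus g x = Num.max (modulus f x - delta) 0) -> Lp 1 g.
Proof.
move=> p1 d0 /LpP[c c0 fc] gE; have p0 : 0 < p by apply: lt_le_trans p1.
move/(Lp_norm_leP _ p0 c0) : fc => fc.
apply: (@LpW _ _ _ _ 1%E _ ((delta `^ (p - 1))^-1 * (c `^ p))).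
rewrite Lp_norm1E.
apply: (@le_trans _ _ (\int[mu]_x ((delta `^ (p - 1))^-1 * modulus f x `^ p)%:E)%E).
  apply: ae_le_integralr.
  - exact: measurable_modulus.
  - by apply: measurable_funM => //; exact: measurable_modulus_powR.
  - by move=> x; exact: modulus_ge0.
  - by move=> x; rewrite mulr_ge0 ?powR_ge0// invr_ge0 powR_ge0.
  - move: gE; apply: filterS => x ->; have f0 := modulus_ge0 f x.
    have r0 : 0 <= (delta `^ (p - 1))^-1 * modulus f x `^ p.
      by rewrite mulr_ge0 ?powR_ge0// invr_ge0 powR_ge0.
    rewrite ge_max r0 andbT; have [fd|df] := leP (modulus f x) delta.
      by apply: le_trans r0; rewrite subr_le0.
    rewrite mulrC ler_pdivlMr ?powR_gt0// -(mulr_powRB1 f0 p0).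
    apply: ler_pM; rewrite ?powR_ge0 ?subr_ge0 ?(ltW df)//.
      by rewrite gerDl oppr_le0 ltW.
    by apply: ge0_ler_powR; rewrite ?subr_ge0 ?nnegrE ?(ltW d0) ?(ltW df).
under eq_integral do rewrite EFinM.
rewrite ge0_integralZl//; last 3 first.
- exact/measurable_EFinP/measurable_modulus_powR.
- by move=> x _; rewrite lee_fin powR_ge0.
- by rewrite lee_fin invr_ge0 powR_ge0.
by rewrite EFinM lee_wpmul2l// lee_fin invr_ge0 powR_ge0.
Qed.

(** Removing the part below 1 / (n + 1) brings [f] into L1, and capping the rest at n + 1 makes it
    bounded; the error goes to 0 in Lp by dominated convergence. *)
Lemma bounded_L1_dense p f e : 1 <= p -> Lp p%:E f -> 0 < e ->
  exists g, [/\ bounded_L1 g, Lp p%:E g & (Lp_norm p%:E (f - g)%R <= e%:E)%E].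
Proof.
move=> p1 fp e0; have p0 : 0 < p by apply: lt_le_trans p1.
pose eta n : R := n.+1%:R^-1.
have eta0 n : 0 < eta n by rewrite invr_gt0 ltr0n.
have eta1 n : eta n <= 1 by rewrite invf_le1 ?ltr0n// ler1n.
(* A majorant of the error: the part below [eta n] plus what exceeds the cap. It is itself below |f|
   because eta n <= 1 <= n + 1. *)
pose K n x := Num.min (modulus f x) (eta n) + Num.max (modulus f x - n.+1%:R) 0.
have mK n : measurable_fun setT (K n).
  have mf := measurable_modulus f.
  apply: measurable_funD; first exact: measurable_minr.
  by apply: measurable_maxr => //; exact: measurable_funB.
have K0 n x : 0 <= K n x.
  by rewrite addr_ge0// ?le_min ?modulus_ge0 ?(ltW (eta0 n))// le_max lexx orbT.
have KE n x : modulus f x <= n.+1%:R -> K n x = Num.min (modulus f x) (eta n).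
  by move=> fn; rewrite /K max_r ?addr0// subr_le0.
have Kf n x : K n x <= modulus f x.
  have f0 := modulus_ge0 f x.
  have [fn|nf] := leP (modulus f x) n.+1%:R; first by rewrite KE// ge_min lexx.
  rewrite /K max_l ?subr_ge0 ?(ltW nf)// addrCA gerDl subr_le0 ge_min.
  by rewrite (le_trans (eta1 n)) ?ler1n ?orbT.
have approx n : exists g, [/\ bounded_L1 g, Lp p%:E g &
    \forall x \ae mu, modulus (f - g) x <= K n x].
  have [a [b [fE aE bE]]] := truncation f (measurable_cst (eta n)) (fun=> ltW (eta0 n)).
  have n0 (x : Omega) : 0 <= cst n.+1%:R x :> R by rewrite ler0n.
  have [g [h [bgh gE hE]]] := truncation b (measurable_cst (n.+1%:R : R)) n0.
  have bf : \forall x \ae mu, modulus b x <= modulus f x.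
    move: bE; apply: filterS => x ->.
    by rewrite ge_max modulus_ge0 andbT gerDl oppr_le0 /cst (ltW (eta0 n)).
  have gb : \forall x \ae mu, modulus g x <= modulus b x.
    by move: gE; apply: filterS => x ->; rewrite ge_min lexx.
  exists g; split.
  - split; first by apply: Lp_le_ae gb _ => //; exact: high_part_L1 (eta0 n) fp bE.
    exists n.+1%:R => //; move: gE; apply: filterS => x -> _.
    by rewrite ge_min lexx orbT.
  - by apply: Lp_le_ae fp => //; move: gb bf; apply: filterS2 => x; exact: le_trans.
  - have -> : f - g = a + h by rewrite fE bgh addrA addrAC addrK.
    have bh : \forall x \ae mu, modulus b x <= modulus f x /\
        modulus h x = Num.max (modulus b x - n.+1%:R) 0 by exact: filterI.
    move: (modulus_le_D a h) aE bh; apply: filterS3 => x h1 h2 [h3 h4].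
    apply: le_trans h1 _; rewrite h2 h4 /K lerD2l.
    rewrite ge_max !le_max lexx !orbT andbT; apply/orP; left.
    by rewrite lerD2r.
have Kcvg x : (fun n => (K n x `^ p)%:E) @ \oo --> 0%E.
  apply/cvge0P => [n|b b0]; first by rewrite lee_fin powR_ge0.
  have [n1 hn1] : exists n, forall m, (n <= m)%N -> modulus f x <= m.+1%:R.
    exists (Num.truncn (modulus f x)) => m nm.
    by apply: le_trans (ltW (truncnS_gt _)) _; rewrite ler_nat ltnS.
  have [n2 hn2] : exists n, forall m, (n <= m)%N -> eta m <= b.
    exists (Num.truncn b^-1) => m nm; rewrite /eta -[leRHS]invrK lef_pV2 ?posrE ?invr_gt0//.
    by apply: le_trans (ltW (truncnS_gt _)) _; rewrite ler_nat ltnS.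
  exists (maxn n1 n2) => // m /=; rewrite geq_max => /andP[/hn1 fm /hn2 mb].
  rewrite lee_fin; apply: le_trans mb; apply: (@le_trans _ _ (eta m `^ p)).
    apply: ge0_ler_powR; rewrite ?(ltW p0) ?nnegrE ?(ltW (eta0 m))//.
    by rewrite KE// ge_min lexx orbT.
  by apply: ge1r_powR => //; rewrite eta0 eta1.
have Kint : (\int[mu]_x (K n x `^ p)%:E)%E @[n --> \oo] --> 0%E.
  have mKp n : measurable_fun setT (fun x => (K n x `^ p)%:E).
    by apply/measurable_EFinP; apply: (measurableT_comp (measurable_powR _)).
  have mfp : measurable_fun setT (fun x => (modulus f x `^ p)%:E).
    exact/measurable_EFinP/measurable_modulus_powR.
  have intf : mu.-integrable setT (fun x => (modulus f x `^ p)%:E).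
    apply/integrableP; split => //.
    under eq_integral do rewrite gee0_abs ?lee_fin ?powR_ge0//.
    have /LpP[c c0 /(Lp_norm_leP _ p0 c0) fc] := fp.
    by apply: le_lt_trans fc _; exact: ltry.
  have := @dominated_cvg _ _ _ mu setT measurableT _ (cst 0%E) _ mKp
    (fun x _ => Kcvg x) _ intf.
  rewrite integral0; apply => // n x _.
  rewrite gee0_abs ?lee_fin ?powR_ge0//.
  by apply: ge0_ler_powR; rewrite ?(ltW p0) ?nnegrE ?modulus_ge0.
have ep : 0 < e `^ p by rewrite powR_gt0.
have /cvge0P -/(_ _)/(_ _ ep)[|n _ hn] := Kint.
  by move=> n; apply: integral_ge0 => x _; rewrite lee_fin powR_ge0.
have [g [bg gp gK]] := approx n.
exists g; split => //; apply/Lp_norm_leP => //; first exact: ltW.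
apply: le_trans (hn n (leqnn n)); apply: ae_le_integralr.
- exact: measurable_modulus_powR.
- by apply: (measurableT_comp (measurable_powR _)).
- by move=> x; rewrite powR_ge0.
- by move=> x; rewrite powR_ge0.
- move: gK; apply: filterS => x gK.
  by apply: ge0_ler_powR; rewrite ?(ltW p0) ?nnegrE ?modulus_ge0.
Qed.

End bounded_approximation.

Section almost_uniform.
Import ComplexField.Normc.
Local Open Scope complex_scope.
Context d (Omega : measurableType d) (R : realType).
Variable mu : {measure set Omega -> \bar R}.
Local Notation L0 := (L0 mu).
Implicit Types (F : R -> L0) (f : L0) (u v lambda eps : R).

(** The set may depend on [lambda], which makes the property stable under approximation; a single
    set for all [lambda] is recovered below by a countable union. *)
Definition au_cauchy F := forall lambda eps, 0 < lambda -> 0 < eps ->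
  exists E, [/\ measurable E, (mu E <= eps%:E)%E & exists2 t0, 0 < t0 &
    forall u v, t0 <= u -> t0 <= v -> ae_le (~` E) lambda (F u - F v)].

(** The limit is built along integer times only; the Cauchy estimate between a real time and large
    integers then extends the convergence to all times. *)
Lemma au_cauchy_limit F : au_cauchy F -> exists f,
  ae_cvg (fun n => F n%:R) f /\
  forall eps, 0 < eps -> exists G, [/\ measurable G, (mu (~` G) <= eps%:E)%E &
    forall e, 0 < e -> exists2 t0, 0 < t0 & forall u, t0 <= u -> ae_le G e (f - F u)].
Proof.
move=> cF; pose half n : R := 2^-1 ^+ n.
have half0 n : 0 < half n by rewrite exprn_gt0.
have hU (t : R) : exists n0, forall n, (n0 <= n)%N -> t <= n%:R.
  exists (Num.truncn t).+1 => n nt; apply: le_trans (ltW (truncnS_gt _)) _.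
  by rewrite ler_nat.
have bad j k : exists EU : set Omega * R, [/\ measurable EU.1, (mu EU.1 <= (half k)%:E)%E, 0 < EU.2 &
    forall u v, EU.2 <= u -> EU.2 <= v -> ae_le (~` EU.1) (half j) (F u - F v)].
  by have [E [mE Ek [t0 t00 h]]] := cF _ _ (half0 j) (half0 k); exists (E, t0).
have /choice[b hb] jk : exists EU : set Omega * R, [/\ measurable EU.1, (mu EU.1 <= (half jk.2)%:E)%E,
    0 < EU.2 & forall u v, EU.2 <= u -> EU.2 <= v ->
      ae_le (~` EU.1) (half jk.1) (F u - F v)] by exact: bad.
(* For fixed [j] the measure of [b (j, k)] is at most 2^-k for each [k], so the points lying in all
   of these sets form a null set. *)
have nullB : \forall x \ae mu, forall j, exists k, ~ (b (j, k)).1 x.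
  apply/ae_foralln => j; pose B := \bigcap_k (b (j, k)).1.
  have mB : measurable B by apply: bigcap_measurableType => k _; have [] := hb (j, k).
  exists B; split => //.
    apply/eqP; rewrite eq_le measure_ge0 andbT; apply/lee_addgt0Pr => e.
    move=> /half_exp_small[k hk]; rewrite add0e.
    have [mE Ek _ _] := hb (j, k).
    apply: (@le_trans _ _ (mu (b (j, k)).1)); last by rewrite (le_trans Ek)// lee_fin.
    by apply: le_measure; rewrite ?inE// => x /(_ k); exact.
  by move=> x /= nx k _; apply: contrapT => h; apply: nx; exists k.
have close : \forall x \ae mu, forall j k n m,
    (b (j, k)).2 <= n%:R -> (b (j, k)).2 <= m%:R ->
    ~ (b (j, k)).1 x -> normc (F n%:R x - F m%:R x) <= half j.
  apply/ae_foralln => j; apply/ae_foralln => k; apply/ae_foralln => n; apply/ae_foralln => m.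
  have [_ _ _ h] := hb (j, k).
  have [hn|hn] := leP (b (j, k)).2 n%:R; last exact: nearW.
  have [hm|hm] := leP (b (j, k)).2 m%:R; last exact: nearW.
  move: (h _ _ hn hm) (L0_BE (F n%:R) (F m%:R)); apply: filterS2 => x h1 /(_ I) eB _ _ nx.
  by rewrite -eB; exact: h1.
have [f hf] : exists f, ae_cvg (fun n => F n%:R) f.
  apply: ae_cauchy_cvg; move: nullB close; apply: filterS2 => x hx hc e.
  move=> /half_exp_small[j hj]; have [k nk] := hx j.
  have [n0 hn0] := hU (b (j, k)).2; exists n0 => m nm.
  by apply: le_trans hj; apply: hc nk => //; exact: hn0.
exists f; split => // eps eps0.
(* Fresh exceptional sets of measure eps / 2^(j + 1), so that their union over all precisions 2^-j
   has measure at most [eps]. *)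
have /choice[c hc] j : exists EU : set Omega * R, [/\ measurable EU.1,
    (mu EU.1 <= (eps / (2 ^ j.+1)%:R)%:E)%E, 0 < EU.2 & forall u v, EU.2 <= u -> EU.2 <= v ->
      ae_le (~` EU.1) (half j) (F u - F v)].
  have ej : 0 < eps / (2 ^ j.+1)%:R by rewrite divr_gt0// ltr0n expn_gt0.
  by have [E [mE Ek [t0 t00 h]]] := cF _ _ (half0 j) ej; exists (E, t0).
have mC : measurable (\bigcup_j (c j).1) by apply: bigcup_measurable => j _; have [] := hc j.
exists (~` \bigcup_j (c j).1); split.
- exact: measurableC.
- rewrite setCK; apply: (@le_trans _ _ (\sum_(j <oo) mu (c j).1)%E).
    by apply: measure_sigma_subadditive => // j; have [] := hc j.
  apply: le_trans (epsilon_trick0 xpredT (ltW eps0)).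
  by apply: lee_nneseries => // j _; have [] := hc j.
- move=> e /half_exp_small[j hj]; have [mE _ t0 h] := hc j.
  exists (c j).2 => // u tu.
  have : \forall x \ae mu, forall n, (c j).2 <= n%:R -> ~ (c j).1 x ->
      normc (F u x - F n%:R x) <= half j.
    apply/ae_foralln => n.
    have [hn|hn] := leP (c j).2 n%:R; last exact: nearW.
    move: (h _ _ tu hn) (L0_BE (F u) (F n%:R)); apply: filterS2 => x h1 /(_ I) eB _ nx.
    by rewrite -eB; exact: h1.
  move: hf (L0_BE f (F u)); apply: filterS3 => x hfx /(_ I) eB hx nx.
  have {}nx : ~ (c j).1 x by move=> cx; apply: nx; exists j.
  rewrite /modulus eB; apply/ler_addgt0Pr => a a0.
  have [n1 hn1] := hfx _ a0; have [n2 hn2] := hU (c j).2.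
  pose n := maxn n1 n2.
  have -> : f x - F u x = - (F n%:R x - f x) - (F u x - F n%:R x).
    by rewrite !opprB addrA subrK.
  apply: le_trans (le_normcD _ _) _; rewrite !normcN addrC lerD//.
    by apply: le_trans hj; apply: hx nx; apply: hn2; exact: leq_maxr.
  by apply: hn1; exact: leq_maxl.
Qed.

End almost_uniform.

Section ergodic_L1.
Import ComplexField.Normc.
Local Open Scope complex_scope.
Context d (Omega : measurableType d) (R : realType).
Variable mu : {measure set Omega -> \bar R}.
Hypothesis mu_gt0 : (0 < mu setT)%E.
Local Notation L0 := (L0 mu).
Variable T : R -> L0 -> L0.
Hypothesis T_semigroup : dunford_schwartz_semigroup T.
Hypothesis T_continuous : strongly_continuous_L1 T.
Implicit Types (f g h : L0) (r s t u v w c e : R).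
Local Notation M := (sg_average T).

Let le11 : 1 <= (1 : R). Proof. exact: lexx. Qed.
Let ML1 := sg_average_L1 T_semigroup T_continuous.
Let Mds := sg_average_ds mu_gt0 T_semigroup T_continuous.
Let MC := sg_average_averageC mu_gt0 T_semigroup T_continuous.

(* [M u f] is close to [M u (M t f)], hence to [M w f] for [w] much larger than
   [u], off the set where the maximal function of [M t f - M w f] is large. The
   limit inferior of these sets over [w] works for all [u]. *)
Lemma au_cauchy_bounded f : bounded_L1 f -> au_cauchy (M ^~ f).
Proof.
move=> bf lambda eps l0 eps0; have [f1 [c c0 fc]] := bf.
(* The distance from [M u f] to [M (w k) f] will be at most l + 2 l + l, and it occurs twice, for
   [u] and for [v]. *)
pose l := lambda / 8; have l8 : 0 < l by rewrite divr_gt0.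
(* With squared L2 norms below eps * l^2, the weak inequality at height [l] yields sets of measure
   at most [eps]. *)
have ll0 : 0 < eps * l ^+ 2 by rewrite mulr_gt0// exprn_gt0.
have [t t0 ht] := mean_ergodic_cauchy mu_gt0 T_semigroup T_continuous bf ll0.
pose w (k : nat) := t + k%:R.
have w0 k : 0 < w k by rewrite ltr_pwDl.
pose h k := M t f - M (w k) f.
have bh k : bounded_L1 (h k) by apply: bounded_L1D; [|apply: bounded_L1N]; exact: (bounded_L1_average mu_gt0).
have /choice[E hE] k : exists E, [/\ measurable E, (mu E <= eps%:E)%E &
    forall u, 0 < u -> ae_le (~` E) (2 * l) (M u (h k))].
  have [E [mE Ek hE]] := weak_maximal_inequality2 mu_gt0 T_semigroup T_continuous (bh k) l8.
  exists E; split => //; apply: le_trans Ek _; rewrite lee_fin ler_pdivrMr ?exprn_gt0//.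
  by apply: ht => //; rewrite lerDl.
have mE k : measurable (E k) by have [] := hE k.
exists (liminf_set E); split.
- exact: measurable_liminf_set.
- by apply: measure_liminf_set_le => // k; have [] := hE k.
(* Beyond this time 2 c t / u <= l, so [M u (M t f)] is uniformly within [l] of [M u f]; adding 1
   keeps the threshold positive. *)
exists (2 * c * t / l + 1); first by rewrite ltr_wpDl// divr_ge0 ?(ltW l8)// mulr_ge0 ?(ltW t0)// mulr_ge0.
have decomp u : 2 * c * t / l + 1 <= u -> \forall x \ae mu, forall k, ~ E k x ->
    2 * c * u / l <= w k -> normc (M u f x - M (w k) f x) <= l + (2 * l + l).
  move=> tu; have u0 : 0 < u.
    apply: lt_le_trans tu; rewrite ltr_wpDl// divr_ge0 ?(ltW l8)//.
    by rewrite mulr_ge0 ?(ltW t0)// mulr_ge0.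
  apply/ae_foralln => k.
  have [wk|wk] := leP (2 * c * u / l) (w k); last exact: nearW.
  have Mu1 := ML1 u0 f1; have Mt1 := ML1 t0 f1; have Mw1 := ML1 (w0 k) f1.
  have e1 : ae_le setT l (M u (M t f) - M u f).
    have := sg_average_average_ae_le mu_gt0 T_semigroup T_continuous c0 t0 u0 f1 fc.
    apply: ae_leW => //; rewrite ler_pdivrMr// [l * u]mulrC -ler_pdivrMr//.
    by apply: le_trans tu; rewrite lerDl.
  have e3 : ae_le setT l (M u (M (w k) f) - M (w k) f).
    rewrite (MC u0 (w0 k) f1).
    have := sg_average_average_ae_le mu_gt0 T_semigroup T_continuous c0 u0 (w0 k) f1 fc.
    apply: ae_leW => //; rewrite ler_pdivrMr// [l * w k]mulrC -ler_pdivrMr//.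
  have [_ _ /(_ _ u0) e2] := hE k.
  have dE : M u f - M (w k) f = - (M u (M t f) - M u f) +
      (M u (h k) + (M u (M (w k) f) - M (w k) f)).
    have zE (a b c' e : L0) : a - e = - (b - a) + ((b - c') + (c' - e)).
      by rewrite opprB addrA [a - b + _]addrA subrK addrA subrK.
    by rewrite /h (dsB (Mds u0) Mt1 Mw1); exact: zE.
  have := ae_leD (ae_leN (ae_leW (@subsetT _ (~` E k)) (lexx _) e1))
    (ae_leD e2 (ae_leW (@subsetT _ (~` E k)) (lexx _) e3)).
  rewrite -dE; move: (L0_BE (M u f) (M (w k) f)).
  by apply: filterS2 => x /(_ I) eB hx nx _; rewrite -eB; exact: hx.
move=> u v tu tv; move: (decomp _ tu) (decomp _ tv) (L0_BE (M u f) (M v f)).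
apply: filterS3 => x hu hv /(_ I) eB nx; rewrite /modulus eB.
pose b := Num.max (2 * c * u / l) (2 * c * v / l).
have [k bk nk] := notin_liminf_set nx (Num.truncn b).+1.
have wb : b <= w k.
  apply: (@le_trans _ _ k%:R); last by rewrite lerDr ltW.
  by apply: le_trans (ltW (truncnS_gt _)) _; rewrite ler_nat.
have [wu wv] : 2 * c * u / l <= w k /\ 2 * c * v / l <= w k.
  by move: wb; rewrite ge_max => /andP.
have -> : M u f x - M v f x = (M u f x - M (w k) f x) - (M v f x - M (w k) f x).
  by rewrite opprB addrA subrK.
apply: le_trans (le_normcD _ _) _; rewrite normcN.
apply: le_trans (lerD (hu k nk wu) (hv k nk wv)) _.
by rewrite /l; lra.
Qed.

Lemma au_cauchy_L1 f : Lp 1 f -> au_cauchy (M ^~ f).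
Proof.
move=> f1 lambda eps l0 eps0.
have l4 : 0 < lambda / 4 by rewrite divr_gt0.
have l2 : 0 < lambda / 2 by rewrite divr_gt0.
have eps2 : 0 < eps / 2 by rewrite divr_gt0.
(* An L1 error of this size gives, by the maximal inequality at height lambda / 4, a set of measure
   at most eps / 2. The two error averages then cost lambda / 2. *)
have a0 : 0 < (eps / 2) * (lambda / 4) by rewrite mulr_gt0.
have [g [bg g1 fg]] := bounded_L1_dense le11 f1 a0.
have [E [mE Ele [t0 t00 hE]]] := au_cauchy_bounded bg l2 eps2.
have [E' [mE' Ele' hE']] := continuous_maximal_inequality mu_gt0 T_semigroup T_continuous fg l4.
exists (E `|` E'); split; first exact: measurableU.
  apply: le_trans (measureU2 _ _ _) _ => //; rewrite [in leRHS](splitr eps) EFinD leeD//.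
  by apply: le_trans Ele' _; rewrite mulfK// gt_eqF.
exists t0 => // u v tu tv.
have u0 : 0 < u by apply: lt_le_trans tu.
have v0 : 0 < v by apply: lt_le_trans tv.
have fE : f = g + (f - g) by rewrite addrC subrK.
have fg1 : Lp 1 (f - g) by exact: LpB.
have -> : M u f - M v f = (M u g - M v g) + (M u (f - g) - M v (f - g)).
  by rewrite {1 2}fE (dsD (Mds u0))// (dsD (Mds v0))// opprD addrACA.
have -> : lambda = lambda / 2 + (lambda / 4 + lambda / 4) by lra.
apply: ae_leD; first by apply: ae_leW (hE _ _ tu tv) => //; apply: subsetC; exact: subsetUl.
by apply: ae_leB; [apply: ae_leW (hE' _ u0)|apply: ae_leW (hE' _ v0)] => //;
  apply: subsetC; exact: subsetUr.
Qed.

End ergodic_L1.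

(** * The extended operators on Lp *)

Section extension.
Import ComplexField.Normc.
Local Open Scope complex_scope.
Context d (Omega : measurableType d) (R : realType).
Variable mu : {measure set Omega -> \bar R}.
Hypothesis mu_gt0 : (0 < mu setT)%E.
Local Notation L0 := (L0 mu).
Implicit Types (f g h : L0) (p c e lambda : R).

Lemma Lp_split p f delta : 1 <= p -> 0 < delta -> Lp p%:E f ->
  exists g h, [/\ f = g + h, Lp 1 g, Lp p%:E g, Lp p%:E h & ae_le setT delta h] /\
    \forall x \ae mu, modulus g x = Num.max (modulus f x - delta) 0.
Proof.
move=> p1 d0 fp; have p0 : 0 < p by apply: lt_le_trans p1.
have [h [g [fE hE gE]]] := truncation f (measurable_cst delta) (fun=> ltW d0).
exists g, h; split => //; split.
- by rewrite addrC.
- exact: high_part_L1 d0 fp gE.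
- apply: Lp_le_ae fp => //; move: gE; apply: filterS => x ->.
  by rewrite ge_max modulus_ge0 andbT gerDl oppr_le0 /cst (ltW d0).
- by apply: Lp_le_ae fp => //; move: hE; apply: filterS => x ->; rewrite ge_min lexx.
- by move: hE; apply: filterS => x -> _; rewrite ge_min lexx orbT.
Qed.

Lemma ae_le_Loo c f : ae_le setT c f -> Lp +oo%E f.
Proof. by move=> /(Lp_norm_ooP _ _ mu_gt0); exact: LpW. Qed.

Lemma Lp_L1_plus_Loo p f : 1 <= p -> Lp p%:E f -> L1_plus_Loo f.
Proof.
move=> p1 /(Lp_split p1 ltr01)[g [h [[fE g1 _ _ h1] _]]].
by exists g, h; split => //; exact: ae_le_Loo h1.
Qed.

Variables (S SE : L0 -> L0).
Hypothesis dsS : dunford_schwartz S.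
Hypothesis extS : dunford_schwartz_extension S SE.

Lemma extension_L1 f : Lp 1 f -> SE f = S f.
Proof. by case: extS => h _ _ _; exact: h. Qed.

Lemma extensionD p f g : 1 <= p -> Lp p%:E f -> Lp p%:E g -> SE (f + g) = SE f + SE g.
Proof.
move=> p1 fp gp; case: extS => _ lin _ _.
by have := lin 1 f g (Lp_L1_plus_Loo p1 fp) (Lp_L1_plus_Loo p1 gp); rewrite !scale1r.
Qed.

Lemma extensionB p f g : 1 <= p -> Lp p%:E f -> Lp p%:E g -> SE (f - g) = SE f - SE g.
Proof.
move=> p1 fp gp; have fg := LpB p1 fp gp.
by rewrite -[in SE f](subrK g f) (extensionD p1 fg gp) addrK.
Qed.

Lemma extension_ae_le c f : ae_le setT c f -> ae_le setT c (SE f).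
Proof.
move=> fc; have foo := ae_le_Loo fc; apply/(Lp_norm_ooP _ _ mu_gt0).
move/(Lp_norm_ooP _ _ mu_gt0) : fc; apply: le_trans.
by case: extS => _ _ h _; exact: h.
Qed.

(** Split at height [lambda]: the high part is in L1, where the extension is the original
    contraction, and the low part stays below [lambda]. Hence the bound on Lp follows from the L1
    and supremum bounds alone. *)
Lemma extension_hinge p f lambda : 1 <= p -> Lp p%:E f -> 0 < lambda ->
  (hinge (SE f) lambda <= hinge f lambda)%E.
Proof.
move=> p1 fp l0; have [g [h [[fE g1 gp hp hl] gE]]] := Lp_split p1 l0 fp.
apply: (hinge_le (ltW l0) gE (a := SE g) (b := SE h)).
- by rewrite fE (extensionD p1).
- by rewrite extension_L1//; exact: ds_norm1.
- exact: extension_ae_le.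
Qed.

End extension.

Section extension_semigroup.
Import ComplexField.Normc.
Local Open Scope complex_scope.
Context d (Omega : measurableType d) (R : realType).
Variable mu : {measure set Omega -> \bar R}.
Hypothesis mu_gt0 : (0 < mu setT)%E.
Local Notation L0 := (L0 mu).
Variables T TE : R -> L0 -> L0.
Hypothesis T_semigroup : dunford_schwartz_semigroup T.
Hypothesis T_continuous : strongly_continuous_L1 T.
Hypothesis TE_extension : forall s : R, 0 <= s ->
  dunford_schwartz_extension (T s) (TE s).
Variable p : R.
Hypothesis p_ge1 : 1 <= p.
Implicit Types (f g h : L0) (r s t u v c e : R).

Let le11 : 1 <= (1 : R). Proof. exact: lexx. Qed.
Let p_gt0 : 0 < p. Proof. exact: lt_le_trans p_ge1. Qed.
Let sgds := sg_ds T_semigroup.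

(** The case p = 1 is separate, as the dyadic constant b / (b - 1) with b = 2^(p - 1) degenerates
    there. For p > 1 the constant comes from the hinge comparison and depends neither on [s] nor on
    [f]. *)
Lemma extension_norm : exists2 C, 0 < C & forall s f c, 0 <= s -> 0 <= c ->
  (Lp_norm p%:E f <= c%:E)%E -> (Lp_norm p%:E (TE s f) <= (C * c)%:E)%E.
Proof.
have [p1|p1] := eqVneq p 1.
  exists 1 => // s f c s0 c0; rewrite p1 => fc; have f1 : Lp 1 f := LpW fc.
  rewrite mul1r (extension_L1 (TE_extension s0))//; apply: le_trans fc.
  exact: (ds_norm1 (sgds s0) f1).
have {}p1 : 1 < p by rewrite lt_neqAle eq_sym p1.
have [C C0 hC] := hinge_Lp mu p1; exists C => // s f c s0 c0 fc.
apply: hC (fc) => // lambda l0.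
exact: (extension_hinge mu_gt0 (sgds s0) (TE_extension s0) p_ge1 (LpW fc) l0).
Qed.

(** [f] is replaced by a bounded [g] in L1, at a cost uniform in time; for [g], continuity in L1 and
    the uniform bound interpolate to continuity in Lp. *)
Lemma extension_uniform f : Lp p%:E f -> uniform_in_Lp p (TE ^~ f).
Proof.
move=> fp; have [C C0 hC] := extension_norm; split.
  by move=> r r0; have /LpP[c c0 fc] := fp; apply: LpW (hC _ _ _ r0 c0 fc).
move=> e e0; pose e1 := e / (3 * C).
have e10 : 0 < e1 by rewrite divr_gt0// mulr_gt0.
have e30 : 0 < e / 3 by rewrite divr_gt0.
have [g [[g1 [c c0 gc]] gp fg]] := bounded_L1_dense p_ge1 fp e10.
(* The L1 modulus of continuity required by interpolation: [T r g - T s g] is bounded by c + c, and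
   a (c + c)^(p - 1) <= (e / 3)^p. *)
pose a := (e / 3) `^ p / ((c + c) `^ (p - 1) + 1).
have k0 : 0 < (c + c) `^ (p - 1) + 1 by rewrite ltr_wpDl// powR_ge0.
have a0 : 0 < a by rewrite divr_gt0// powR_gt0.
have [delta d0 hd] := (sg_uniform T_semigroup T_continuous g1).2 _ a0.
exists delta => // r s r0 s0 rs.
have Tgg : (Lp_norm p%:E (T r g - T s g)%R <= (e / 3)%:E)%E.
  apply: (@Lp_interpolation _ _ _ _ p _ a (c + c)) => //; first exact: ltW.
  - by rewrite addr_ge0.
  - by apply: ae_leB; [exact: ds_ae_le (sgds r0) _ _ _ _|exact: ds_ae_le (sgds s0) _ _ _ _].
  - exact: hd.
  - rewrite /a mulrA ler_pdivrMr// mulrC ler_wpM2l ?powR_ge0//.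
    by rewrite lerDl.
have fgp : Lp p%:E (f - g) by exact: LpB.
have TEfg t : 0 <= t -> (Lp_norm p%:E (TE t f - T t g)%R <= (e / 3)%:E)%E.
  move=> t0; rewrite -(extension_L1 (TE_extension t0) g1).
  rewrite -(extensionB mu_gt0 (TE_extension t0) p_ge1 fp gp).
  apply: le_trans (hC _ _ _ t0 (ltW e10) fg) _.
  by rewrite lee_fin /e1 le_eqVlt; apply/orP; left; apply/eqP; field; rewrite gt_eqF.
have h1 := Lp_norm_triangle (TE r f) (T r g) (TE s f) p_ge1.
have h2 := Lp_norm_triangle (T r g) (T s g) (TE s f) p_ge1.
have h3 := TEfg _ s0; rewrite Lp_normB// in h3.
apply: le_trans h1 (le_trans (leeD (TEfg _ r0) (le_trans h2 (leeD Tgg h3))) _).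
by rewrite -!EFinD lee_fin; lra.
Qed.

Lemma average_extension_L1 g t : Lp 1 g -> Lp p%:E g -> 0 < t ->
  average p (TE ^~ g) t = sg_average T t g.
Proof.
move=> g1 gp t0; have ug := sg_uniform T_semigroup T_continuous g1.
have TEg r : 0 <= r -> TE r g = T r g.
  by move=> r0; exact: (extension_L1 (TE_extension r0) g1).
have uTE : uniform_in_Lp 1 (TE ^~ g).
  split=> [r r0|e e0]; first by rewrite TEg//; exact: ug.1.
  have [delta d0 hd] := ug.2 _ e0; exists delta => // r s r0 s0 rs.
  by rewrite !TEg//; exact: hd.
rewrite sg_averageE.
rewrite (average_consistent p_ge1 le11 (extension_uniform gp) uTE t0).
exact: (eq_average TEg le11 uTE ug t0).
Qed.

Lemma au_cauchy_extension f : Lp p%:E f -> au_cauchy (average p (TE ^~ f)).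
Proof.
move=> fp lambda eps l0 eps0.
have l4 : 0 < lambda / 4 by rewrite divr_gt0.
have l2 : 0 < lambda / 2 by rewrite divr_gt0.
have [g [h [[fE g1 gp hp hl] _]]] := Lp_split p_ge1 l4 fp.
have [E [mE Ele [t0 t00 hE]]] :=
  au_cauchy_L1 mu_gt0 T_semigroup T_continuous g1 l2 eps0.
exists E; split => //; exists t0 => // u v tu tv.
have ug := extension_uniform gp; have uh := extension_uniform hp.
have avE t : 0 < t ->
    average p (TE ^~ f) t = sg_average T t g + average p (TE ^~ h) t.
  move=> tgt0; rewrite -(average_extension_L1 g1 gp tgt0).
  rewrite -(averageD p_ge1 ug uh tgt0); apply: eq_average => //.
  - by move=> r r0; rewrite fE (extensionD mu_gt0 (TE_extension r0) p_ge1).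
  - exact: extension_uniform.
  - exact: uniform_in_LpD.
have u0 : 0 < u by apply: lt_le_trans tu.
have v0 : 0 < v by apply: lt_le_trans tv.
rewrite !avE// opprD addrACA.
have -> : lambda = lambda / 2 + (lambda / 4 + lambda / 4) by lra.
(* The low part contributes at most lambda / 4 at every time, so no exceptional set beyond the one
   for [g] is needed. *)
have avh t : 0 < t -> ae_le (~` E) (lambda / 4) (average p (TE ^~ h) t).
  move=> tgt0; have : ae_le setT (lambda / 4) (average p (TE ^~ h) t).
    apply: (average_ae_le p_ge1 uh tgt0) => r r0 _.
    exact: (extension_ae_le mu_gt0 (TE_extension r0) hl).
  exact: ae_leW.
by apply: ae_leD; [exact: hE|apply: ae_leB; exact: avh].
Qed.

End extension_semigroup.

Theorem theorem4p1 (R : realType) (d : measure_display)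
    (Omega : measurableType d)
    (mu : {sigma_finite_measure set Omega -> \bar R})
    (mu_infinite : mu setT = +oo%E)
    (T TE : R -> L0 mu -> L0 mu)
    (T_semigroup : dunford_schwartz_semigroup T)
    (T_continuous : strongly_continuous_L1 T)
    (TE_extension : forall s : R, 0 <= s ->
      dunford_schwartz_extension (T s) (TE s))
    (p : R) (p_ge1 : 1 <= p) (f : L0 mu) (f_Lp : Lp p%:E f) :
  exists2 fhat : L0 mu, Lp p%:E fhat &
    cvg_au (pinfty_nbhs R) (ergodic_average p%:E TE f) fhat.
Proof.
have mu_gt0 : (0 < mu setT)%E by rewrite mu_infinite.
have p_gt0 : 0 < p by apply: lt_le_trans p_ge1.
have cF := au_cauchy_extension mu_gt0 T_semigroup T_continuous TE_extension p_ge1 f_Lp.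
have uF := extension_uniform mu_gt0 T_semigroup T_continuous TE_extension p_ge1 f_Lp.
have [C C0 hC] := extension_norm mu_gt0 T_semigroup TE_extension p_ge1.
have [fhat [cvgF auF]] := au_cauchy_limit cF.
exists fhat.
  have /LpP[c c0 fc] := f_Lp.
  have Cc0 : 0 <= C * c by rewrite mulr_ge0// ltW.
  apply: (@LpW _ _ _ _ _ _ (C * c)).
  (* The shift to n + 1 discards time 0, where the norm bound on averages does not apply. *)
  have cvgS : ae_cvg (fun n => average p (TE ^~ f) n.+1%:R) fhat.
    move: cvgF; apply: filterS => x h e /h[n hn]; exists n => m nm.
    by apply: hn; exact: leqW.
  apply: (Lp_norm_fatou p_gt0 Cc0 _ cvgS) => n.
  by apply: (average_norm p_ge1 uF) => // r r0 _; exact: hC.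
move=> eps /auF[G [mG Geps hG]]; exists G; split => //.
apply/cvge0P => [u|e e0]; first exact: Lnorm_ge0.
have [t0 t00 ht] := hG _ e0.
exists t0; split; first exact: num_real.
move=> u tu; rewrite unlock mu_gt0; apply/ess_supP.
move: (ht u (ltW tu)); apply: filterS => x hx /=.
rewrite lee_fin ComplexField.Normc.normcM normcR ger0_norm ?mulr_ge0 ?normc_ge0//.
rewrite indicE; case: (boolP (x \in G)) => [/set_mem Gx|_].
  by rewrite normr1 mulr1; exact: hx.
by rewrite normr0 mulr0 ltW.
Qed.
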